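(* With $V_h$, $W_{1,h}$, $W_{2,h}$, $P_{1,h}$, $P_{2,h}$ as defined in the context (for either the 3-node triangular or the 4-node quadrilateral element), the variational problem: find $(\bar{\mathbf{u}}_h,\boldsymbol{\epsilon}_{1,h},\boldsymbol{\epsilon}_{2,h},\boldsymbol{\sigma}_{1,h},\boldsymbol{\sigma}_{2,h})\in V_h\times W_{1,h}\times W_{2,h}\times W_{1,h}\times W_{2,h}$ such that $$\int_\Omega\boldsymbol{\sigma}_{1,h}:\mathbf{B}\mathbf{v}\,d\Omega+\int_\Omega(-\boldsymbol{\sigma}_{1,h}+\boldsymbol{\sigma}_{2,h}):\boldsymbol{\delta}_1\,d\Omega+\int_\Omega(\mathbf{D}\boldsymbol{\epsilon}_{2,h}-\boldsymbol{\sigma}_{2,h}):\boldsymbol{\delta}_2\,d\Omega=f(\mathbf{v})\quad\forall\,\mathbf{v}\in V_h,\ \boldsymbol{\delta}_1\in W_{1,h},\ \boldsymbol{\delta}_2\in W_{2,h},$$ $$\int_\Omega\boldsymbol{\tau}_1:(\mathbf{B}\bar{\mathbf{u}}_h-\boldsymbol{\epsilon}_{1,h})\,d\Omega+\int_\Omega\boldsymbol{\tau}_2:(\boldsymbol{\epsilon}_{1,h}-\boldsymbol{\epsilon}_{2,h})\,d\Omega=0\quad\forall\,\boldsymbol{\tau}_1\in W_{1,h},\ \boldsymbol{\tau}_2\in W_{2,h},$$ has a unique solution, and it satisfies $$\boldsymbol{\epsilon}_{1,h}=P_{1,h}(\mathbf{B}\bar{\mathbf{u}}_h),\quad\boldsymbol{\epsilon}_{2,h}=P_{2,h}P_{1,h}(\mathbf{B}\bar{\mathbf{u}}_h),\quad\boldsymbol{\sigma}_{1,h}=P_{1,h}P_{2,h}\big(\mathbf{D}P_{2,h}P_{1,h}(\mathbf{B}\bar{\mathbf{u}}_h)\big),\quad\boldsymbol{\sigma}_{2,h}=\mathbf{D}P_{2,h}P_{1,h}(\mathbf{B}\bar{\mathbf{u}}_h).$$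 Moreover, $\bar{\mathbf{u}}_h$ is the unique element of $V_h$ solving the strain-smoothed element problem $$\int_\Omega\mathbf{D}\,P_{2,h}P_{1,h}(\mathbf{B}\bar{\mathbf{u}}_h):P_{2,h}P_{1,h}(\mathbf{B}\mathbf{v})\,d\Omega=f(\mathbf{v})\quad\forall\,\mathbf{v}\in V_h.$$
   Context: Elasticity setting. $\Omega\subset\mathbb{R}^2$ is a bounded polygonal domain, with $\partial\Omega=\Gamma_D\cup\Gamma_N$, $\Gamma_D\neq\emptyset$, $\Gamma_N=\partial\Omega\setminus\Gamma_D$. $V=\{\mathbf{u}\in (H^1(\Omega))^2:\mathbf{u}=\mathbf{0}\text{ on }\Gamma_D\}$, $W=(L^2(\Omega))^3$. For $\mathbf{u}=(u_x,u_y)\in V$, $\mathbf{B}\mathbf{u}=(\partial_x u_x,\ \partial_y u_y,\ \partial_y u_x+\partial_x u_y)^T\in W$. $\mathbf{D}$ is a constant symmetric positive definite $3\times3$ matrix, and $:$ is the Euclidean inner product of $\mathbb{R}^3$. The bilinear form $a(\mathbf{u},\mathbf{v})=\int_\Omega\mathbf{D}\mathbf{B}\mathbf{u}:\mathbf{B}\mathbf{v}\,d\Omega$ is taken to be symmetric, continuous and coercive on $V$. $f$ is the continuous linear functional on $V$ given by $f(\mathbf{u})=\int_\Omega\mathbf{b}\cdot\mathbf{u}\,d\Omega+\int_{\Gamma_N}\mathbf{t}\cdot\mathbf{u}\,d\Gamma$. $\mathcal{P}_n(K)$ denotes polynomials of degree $\le n$ on $K$. Displacement space. (i) Triangular element: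 $\mathcal{T}_h$ is a quasi-uniform triangulation of $\Omega$ with maximum element diameter $h>0$ and $V_h=\{\mathbf{u}\in V:\mathbf{u}|_T\in(\mathcal{P}_1(T))^2\ \forall T\in\mathcal{T}_h\}$. (ii) Quadrilateral element: $\mathcal{T}_h$ is a quasi-uniform subdivision of $\Omega$ into quadrilaterals with maximum diameter $h>0$; each $T$ has nodes $\mathbf{x}_{T,1},\dots,\mathbf{x}_{T,4}$ and center point $\mathbf{x}_{T,0}$ (the average of the nodes); $\widehat{\mathcal{T}}_h$ is the triangulation obtained by subdividing each $T$ into the four triangles spanned by $\mathbf{x}_{T,0}$ and an edge of $T$; and $V_h=\{\mathbf{u}\in V:\mathbf{u}|_{\widehat T}\in(\mathcal{P}_1(\widehat T))^2\ \forall\widehat T\in\widehat{\mathcal{T}}_h,\ \mathbf{u}(\mathbf{x}_{T,0})=\frac14\sum_{i=1}^4\mathbf{u}(\mathbf{x}_{T,i})\ \forall T\in\mathcal{T}_h\}$. Auxiliary subdivisions (''center'' means centroid for triangles and $\mathbf{x}_{T,0}$ for quadrilaterals). $\mathcal{T}_{1,h}$ is the subdivision of $\Omega$ consisting, for each edge $e$ shared by two elements of $\mathcal{T}_h$, of the quadrilateral whose vertices are the endpoints of $e$ and the centers of the two elements, and, for each boundary edge $e$, of the triangle whose vertices are the endpoints of $e$ and the center of the element containing $e$. $\mathcal{T}_{2,h}$ is obtained by partitioning each element of $\mathcal{T}_h$ into pieces (three for triangles, four for quadrilaterals) by joining its center to the midpoints of its edges. For $k=1,2$, $W_{k,h}=\{\boldsymbol{\epsilon}\in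 W:\boldsymbol{\epsilon}|_T\in(\mathcal{P}_0(T))^3\ \forall T\in\mathcal{T}_{k,h}\}$, and $P_{k,h}:W\to W_{k,h}$ is the averaging operator $(P_{k,h}\boldsymbol{\epsilon})(x)=\frac{1}{|T|}\int_T\boldsymbol{\epsilon}\,d\Omega$ for $x\in T\in\mathcal{T}_{k,h}$. *)

(* Defs.v *)
(* Built on MathComp-Analysis. *)
From HB Require Import structures.
From mathcomp Require Import all_boot all_order all_algebra.
From mathcomp Require Import all_classical all_reals all_analysis.

Set Implicit Arguments.
Unset Strict Implicit.
Unset Printing Implicit Defensive.

Import Order.TTheory GRing.Theory Num.Theory.
Import numFieldNormedType.Exports.

Local Open Scope classical_set_scope.
Local Open Scope ring_scope.

(** * The plane *)

Notation plane R := (R * R)%type.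

Definition area {R : realType} := (@lebesgue_measure R \x @lebesgue_measure R)%E.

(* The norm of the product normed module [R * R] is the max norm, so the
   Euclidean distance is spelled out. *)
Definition edist {R : realType} (p q : plane R) : R :=
  Num.sqrt ((p.1 - q.1) ^+ 2 + (p.2 - q.2) ^+ 2).

Definition cross {R : realType} (p q : plane R) : R := p.1 * q.2 - p.2 * q.1.

Definition dot2 {R : realType} (p q : plane R) : R := p.1 * q.1 + p.2 * q.2.

Definition segpt {R : realType} (s : plane R * plane R) (t : R) : plane R :=
  (1 - t) *: s.1 + t *: s.2.

Definition segment {R : realType} (p q : plane R) : set (plane R) :=
  [set segpt (p, q) t | t in `[0, 1]].

Definition triangle {R : realType} (p q r : plane R) : set (plane R) :=
  [set x | exists a b c : R,
     [/\ 0 <= a, 0 <= b, 0 <= c, a + b + c = 1 &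
         x = a *: p + b *: q + c *: r]].

Definition diameter {R : realType} (A : set (plane R)) : R :=
  sup [set d | exists x y, [/\ A x, A y & d = edist x y]].

(** * Polygonal domains *)

Definition boundary {R : realType} (Om : set (plane R)) : set (plane R) :=
  closure Om `\` interior Om.

(* [sides] lists nondegenerate straight pieces making up the boundary; two
   distinct pieces meet at most in end points, so that integrating over the
   pieces integrates over the boundary.  Regular openness excludes slits. *)
Definition polygonal_domain {R : realType} (Om : set (plane R))
    (sides : seq (plane R * plane R)) : Prop :=
  [/\ open Om, connected Om, Om !=set0, bounded_set Om &
   [/\ interior (closure Om) = Om,
       boundary Om = \bigcup_(s in [set` sides]) segment s.1 s.2,
       uniq sides,
       forall s, s \in sides -> s.1 != s.2 &
       forall s s', s \in sides -> s' \in sides -> s != s' ->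
         segment s.1 s.2 `&` segment s'.1 s'.2 `<=`
         [set s.1; s.2] `&` [set s'.1; s'.2]]].

Definition ae_on {R : realType} (A : set (plane R)) (P : plane R -> Prop) :
    Prop :=
  {ae @area R, forall x, A x -> P x}.

Definition int_on {R : realType} (A : set (plane R)) (g : plane R -> R) : R :=
  \int[@area R]_(x in A) g x.

(* Line integral over [sides] (arc length), each side being parametrized over
   [0, 1]. *)
Definition line_int {R : realType} (sides : seq (plane R * plane R))
    (g : plane R -> R) : R :=
  \sum_(s <- sides)
    edist s.1 s.2 * \int[@lebesgue_measure R]_(t in `[0, 1]) g (segpt s t).

Definition line_integrable {R : realType} (sides : seq (plane R * plane R))
    (g : plane R -> R) : Prop :=
  forall s, s \in sides ->
    (@lebesgue_measure R).-integrable `[0, 1]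
      (EFin \o (fun t => g (segpt s t))).

Definition line_ae {R : realType} (sides : seq (plane R * plane R))
    (P : plane R -> Prop) : Prop :=
  forall s, s \in sides ->
    {ae @lebesgue_measure R, forall t, `[0, 1]%classic t -> P (segpt s t)}.

(** * Lebesgue and Sobolev spaces

   Elements of L^2(Om) and H^1(Om) are represented by functions on the plane
   that are only relevant on Om, up to equality almost everywhere on Om. *)

Definition L2 {R : realType} (Om : set (plane R)) (g : plane R -> R) : Prop :=
  measurable_fun Om g /\
  (@area R).-integrable Om (EFin \o (fun x => g x ^+ 2)).

Definition dirx {R : realType} : plane R := (1, 0).
Definition diry {R : realType} : plane R := (0, 1).

Definition C1 {R : realType} (phi : plane R -> R) : Prop :=
  [/\ forall x, differentiable phi x,
      continuous ('D_dirx phi) & continuous ('D_diry phi)].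

Definition compactly_supported_in {R : realType} (Om : set (plane R))
    (phi : plane R -> R) : Prop :=
  exists K, [/\ compact K, K `<=` Om & forall x, ~ K x -> phi x = 0].

(* [g] is the weak derivative of [w] in the direction [d], as an element of
   L^2(Om).  Testing against C^1 functions with compact support amounts, by
   mollification, to testing against C^infinity ones. *)
Definition is_weak_deriv {R : realType} (Om : set (plane R)) (d : plane R)
    (w g : plane R -> R) : Prop :=
  L2 Om g /\
  forall phi, C1 phi -> compactly_supported_in Om phi ->
    int_on Om (fun x => w x * 'D_d phi x) = - int_on Om (fun x => g x * phi x).

Definition weak_deriv {R : realType} (Om : set (plane R)) (d : plane R)
    (w : plane R -> R) : plane R -> R :=
  xget (cst 0) [set g | is_weak_deriv Om d w g].

Definition H1 {R : realType} (Om : set (plane R)) (w : plane R -> R) : Prop :=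
  [/\ L2 Om w, exists g, is_weak_deriv Om dirx w g &
      exists g, is_weak_deriv Om diry w g].

Definition H1sqnorm {R : realType} (Om : set (plane R)) (w : plane R -> R) :
    R :=
  int_on Om (fun x => w x ^+ 2) +
  int_on Om (fun x => weak_deriv Om dirx w x ^+ 2) +
  int_on Om (fun x => weak_deriv Om diry w x ^+ 2).

(* The trace operator H^1(Om) -> L^2(boundary) is the continuous extension of
   the restriction of C^1 functions: [g] is the trace of [w] when some C^1
   functions converge to [w] in H^1(Om) and to [g] in L^2(boundary). *)
Definition is_trace {R : realType} (Om : set (plane R))
    (sides : seq (plane R * plane R)) (w g : plane R -> R) : Prop :=
  [/\ H1 Om w,
      forall s, s \in sides ->
        measurable_fun `[0 : R, 1] (fun t => g (segpt s t)),
      line_integrable sides (fun x => g x ^+ 2) &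
      exists phi : nat -> plane R -> R,
        [/\ forall n, C1 (phi n),
            (fun n => H1sqnorm Om (fun x => phi n x - w x)) @ \oo
              --> (0 : R) &
            (fun n => line_int sides (fun x => (phi n x - g x) ^+ 2)) @ \oo
              --> (0 : R)]].

(** * Elasticity *)

Definition fstf {R : realType} (u : plane R -> plane R) x : R := (u x).1.
Definition sndf {R : realType} (u : plane R -> plane R) x : R := (u x).2.

Definition is_vtrace {R : realType} (Om : set (plane R))
    (sides : seq (plane R * plane R)) (u g : plane R -> plane R) : Prop :=
  is_trace Om sides (fstf u) (fstf g) /\ is_trace Om sides (sndf u) (sndf g).

Definition inV {R : realType} (Om : set (plane R))
    (sides : seq (plane R * plane R)) (GD : set (plane R))
    (u : plane R -> plane R) : Prop :=
  [/\ H1 Om (fstf u), H1 Om (sndf u) &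
      exists2 g, is_vtrace Om sides u g &
                 line_ae sides (fun x => GD x -> g x = 0)].

Definition Vsqnorm {R : realType} (Om : set (plane R))
    (u : plane R -> plane R) : R :=
  H1sqnorm Om (fstf u) + H1sqnorm Om (sndf u).

Definition inW {R : realType} (Om : set (plane R))
    (eps : plane R -> 'cV[R]_3) : Prop :=
  forall i, L2 Om (fun x => eps x i ord0).

Definition dot3 {R : realType} (s e : 'cV[R]_3) : R :=
  \sum_i s i ord0 * e i ord0.

Definition Bop {R : realType} (Om : set (plane R)) (u : plane R -> plane R) :
    plane R -> 'cV[R]_3 :=
  fun x => \col_(i < 3)
    [:: weak_deriv Om dirx (fstf u) x;
        weak_deriv Om diry (sndf u) x;
        weak_deriv Om diry (fstf u) x + weak_deriv Om dirx (sndf u) x]`_i.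

Definition sym_posdef {R : realType} (D : 'M[R]_3) : Prop :=
  D^T = D /\ forall e : 'cV[R]_3, e != 0 -> 0 < dot3 (D *m e) e.

Definition aform {R : realType} (Om : set (plane R)) (D : 'M[R]_3)
    (u v : plane R -> plane R) : R :=
  int_on Om (fun x => dot3 (D *m Bop Om u x) (Bop Om v x)).

Definition aform_admissible {R : realType} (Om : set (plane R))
    (sides : seq (plane R * plane R)) (GD : set (plane R)) (D : 'M[R]_3) :
    Prop :=
  [/\ forall u v, inV Om sides GD u -> inV Om sides GD v ->
        aform Om D u v = aform Om D v u,
      exists M : R, forall u v, inV Om sides GD u -> inV Om sides GD v ->
        `|aform Om D u v| <=
          M * (Num.sqrt (Vsqnorm Om u) * Num.sqrt (Vsqnorm Om v)) &
      exists2 alpha : R, 0 < alpha &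
        forall u, inV Om sides GD u -> alpha * Vsqnorm Om u <= aform Om D u u].

(* [f] is linear and continuous on V and is given there by the body force [b]
   and the traction [t] on the Neumann part of the boundary. *)
Definition load {R : realType} (Om : set (plane R))
    (sides : seq (plane R * plane R)) (GD : set (plane R))
    (b t : plane R -> plane R) (f : (plane R -> plane R) -> R) : Prop :=
  let GN := boundary Om `\` GD in
  [/\ forall (a : R) u v, inV Om sides GD u -> inV Om sides GD v ->
        f (fun x => a *: u x + v x) = a * f u + f v,
      exists M : R, forall u, inV Om sides GD u ->
        `|f u| <= M * Num.sqrt (Vsqnorm Om u) &
      forall u g, inV Om sides GD u -> is_vtrace Om sides u g ->
        let tg := fun x => \1_GN x * dot2 (t x) (g x) in
        [/\ (@area R).-integrable Om (EFin \o (fun x => dot2 (b x) (u x))),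
            line_integrable sides tg &
            f u = int_on Om (fun x => dot2 (b x) (u x)) + line_int sides tg]].

(** * Meshes *)

Variant elt_kind := Tri3 | Quad4.

Definition nnodes (k : elt_kind) : nat := if k is Tri3 then 3 else 4.

(* The nodes of each element are listed counterclockwise. *)
Record mesh (R : realType) (k : elt_kind) := Mesh {
  nelts : nat;
  node : 'I_nelts -> 'I_(nnodes k) -> plane R }.

Definition center {R : realType} {k} (M : mesh R k) (T : 'I_(nelts M)) :
    plane R :=
  (nnodes k)%:R^-1 *: \sum_i node T i.

(* The [i]-th edge of an element joins its nodes [i] and [i + 1] (cyclically). *)
Definition edge {R : realType} {k} (M : mesh R k) (T : 'I_(nelts M)) i :
    set (plane R) :=
  segment (node T i) (node T (ordS i)).

Definition midpoint {R : realType} {k} (M : mesh R k) (T : 'I_(nelts M)) i :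
    plane R :=
  2^-1 *: (node T i + node T (ordS i)).

Definition subtri {R : realType} {k} (M : mesh R k) (T : 'I_(nelts M)) i :
    set (plane R) :=
  triangle (center T) (node T i) (node T (ordS i)).

(* The closed region occupied by an element.  For a triangle this is the convex
   hull of the nodes, the center being the centroid.  Quadrilaterals are not
   assumed to be convex. *)
Definition elt {R : realType} {k} (M : mesh R k) (T : 'I_(nelts M)) :
    set (plane R) :=
  \bigcup_i subtri T i.

(* The triangles spanned by the center and the edges are nondegenerate and
   consistently oriented: for triangles this is nondegeneracy, and for
   quadrilaterals it says that they can be subdivided from their center. *)
Definition proper_elts {R : realType} {k} (M : mesh R k) : Prop :=
  forall (T : 'I_(nelts M)) i,
    0 < cross (node T i - center T) (node T (ordS i) - center T).

Definition conforming {R : realType} {k} (M : mesh R k) : Prop :=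
  forall T T' : 'I_(nelts M), T != T' ->
    [\/ elt T `&` elt T' = set0,
        exists i j, node T i = node T' j /\
                    elt T `&` elt T' = [set node T i] |
        exists i j, edge T i = edge T' j /\
                    elt T `&` elt T' = edge T i].

Definition subdivision {R : realType} {k} (Om : set (plane R))
    (M : mesh R k) : Prop :=
  [/\ proper_elts M, conforming M & closure Om = \bigcup_T elt (M := M) T].

Definition mesh_size {R : realType} {k} (M : mesh R k) : R :=
  \big[Num.max/0]_(T < nelts M) diameter (elt T).

(* Every element contains a disc of radius [kappa * h], where [h] is the
   maximum element diameter. *)
Definition quasi_uniform {R : realType} {k} (kappa : R) (M : mesh R k) : Prop :=
  forall T : 'I_(nelts M), exists z,
    [set x | edist x z <= kappa * mesh_size M] `<=` elt T.

(** * Discrete spaces *)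

Definition P1_on {R : realType} (A : set (plane R)) (u : plane R -> plane R) :
    Prop :=
  exists a b c : plane R, forall x, A x -> u x = a + x.1 *: b + x.2 *: c.

(* Elements of V_h are represented by functions that are affine on the closed
   cells; these are continuous on the closure of Om, so that values at nodes
   and centers make sense. *)
Definition inVh {R : realType} {k} (Om : set (plane R))
    (sides : seq (plane R * plane R)) (GD : set (plane R)) (M : mesh R k)
    (u : plane R -> plane R) : Prop :=
  inV Om sides GD u /\
  match k with
  | Tri3 => forall T : 'I_(nelts M), P1_on (elt T) u
  | Quad4 =>
      (forall (T : 'I_(nelts M)) i, P1_on (subtri T i) u) /\
      (forall T : 'I_(nelts M), u (center T) = 4^-1 *: \sum_i u (node T i))
  end.

Definition corner {R : realType} {k} (M : mesh R k) : finType :=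
  ('I_(nelts M) * 'I_(nnodes k))%type.

(* The cells of the two auxiliary subdivisions, indexed by pairs (element,
   local index).  [cell1 (T, i)] is made of the triangles joining the [i]-th
   edge of [T] to the centers of the (one or two) elements having this edge;
   the two indices of a shared edge give the same cell. *)
Definition cell1 {R : realType} {k} (M : mesh R k) (q : corner M) :
    set (plane R) :=
  \bigcup_(q' in [set q' : corner M | edge q'.1 q'.2 = edge q.1 q.2])
    subtri q'.1 q'.2.

(* The piece of [T] at its [i]-th node. *)
Definition cell2 {R : realType} {k} (M : mesh R k) (q : corner M) :
    set (plane R) :=
  let: (T, i) := q in
  triangle (center T) (midpoint T (ord_pred i)) (node T i) `|`
  triangle (center T) (node T i) (midpoint T i).

(* Closed cells overlap on null sets, hence "almost everywhere". *)
Definition inWh {R : realType} {k} (Om : set (plane R)) (M : mesh R k)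
    (cell : corner M -> set (plane R)) (eps : plane R -> 'cV[R]_3) : Prop :=
  inW Om eps /\ forall q, exists c, ae_on (cell q) (fun x => eps x = c).

(* Intersecting with Om only removes a null set from a cell, on which elements
   of W carry no information. *)
Definition cell_avg {R : realType} (Om A : set (plane R))
    (eps : plane R -> 'cV[R]_3) : 'cV[R]_3 :=
  (fine (@area R A))^-1 *:
  \col_(i < 3) int_on (Om `&` A) (fun x => eps x i ord0).

(* On the null set where closed cells overlap, some cell is picked. *)
Definition avg_proj {R : realType} {k} (Om : set (plane R)) (M : mesh R k)
    (cell : corner M -> set (plane R)) (eps : plane R -> 'cV[R]_3) :
    plane R -> 'cV[R]_3 :=
  fun x => if [pick q | x \in cell q] is Some q
           then cell_avg Om (cell q) eps else 0.

Definition P1h {R : realType} {k} (Om : set (plane R)) (M : mesh R k) :=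
  avg_proj Om (cell1 (M := M)).
Definition P2h {R : realType} {k} (Om : set (plane R)) (M : mesh R k) :=
  avg_proj Om (cell2 (M := M)).

(** * The two variational problems *)

Definition smoothed {R : realType} {k} (Om : set (plane R)) (M : mesh R k)
    (u : plane R -> plane R) : plane R -> 'cV[R]_3 :=
  P2h Om M (P1h Om M (Bop Om u)).

Definition mixed_solution {R : realType} {k} (Om : set (plane R))
    (sides : seq (plane R * plane R)) (GD : set (plane R)) (M : mesh R k)
    (D : 'M[R]_3) (f : (plane R -> plane R) -> R)
    (u : plane R -> plane R) (eps1 eps2 sig1 sig2 : plane R -> 'cV[R]_3) :
    Prop :=
  let inW1 := inWh Om (cell1 (M := M)) in
  let inW2 := inWh Om (cell2 (M := M)) in
  [/\ inVh Om sides GD M u,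
      [/\ inW1 eps1, inW2 eps2, inW1 sig1 & inW2 sig2],
      forall v d1 d2, inVh Om sides GD M v -> inW1 d1 -> inW2 d2 ->
        int_on Om (fun x => dot3 (sig1 x) (Bop Om v x)) +
        int_on Om (fun x => dot3 (- sig1 x + sig2 x) (d1 x)) +
        int_on Om (fun x => dot3 (D *m eps2 x - sig2 x) (d2 x)) = f v &
      forall t1 t2, inW1 t1 -> inW2 t2 ->
        int_on Om (fun x => dot3 (t1 x) (Bop Om u x - eps1 x)) +
        int_on Om (fun x => dot3 (t2 x) (eps1 x - eps2 x)) = 0].

Definition smoothed_solution {R : realType} {k} (Om : set (plane R))
    (sides : seq (plane R * plane R)) (GD : set (plane R)) (M : mesh R k)
    (D : 'M[R]_3) (f : (plane R -> plane R) -> R) (u : plane R -> plane R) :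
    Prop :=
  inVh Om sides GD M u /\
  forall v, inVh Om sides GD M v ->
    int_on Om (fun x => dot3 (D *m smoothed Om M u x) (smoothed Om M v x)) =
    f v.

(* Main.v *)
(* Averaging over cells is the orthogonal projection of L^2 onto the piecewise constant
   fields, so the mixed system is block triangular in the strains and stresses and reduces to
   the smoothed problem for the displacement.  The latter is a symmetric positive
   semidefinite problem on a space of finite dimension, and everything rests on the
   injectivity of the smoothed strain.

   The average of a strain over a [cell1] is an area-weighted mean of the strains of the one
   or two subtriangles at an edge, and the average over a [cell2] is a mean of two edge
   averages.  If the latter means vanish, the edge averages alternate in sign around each
   element, and a sign argument shows that they vanish too.  Hence no edge is stretched, so
   that an element with a strainless subtriangle moves rigidly, and a subtriangle at a
   boundary edge is strainless.  The strained elements, if any, are thus glued to each other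
   along all their edges, which is impossible in the plane as their total area would be
   zero.  So the strain vanishes, and coercivity of the exact form gives [u = 0]. *)
From HB Require Import structures.
From mathcomp Require Import all_boot all_order all_algebra.
From mathcomp Require Import all_classical all_reals all_analysis.
From mathcomp Require Import ring lra.

Import Order.TTheory GRing.Theory Num.Theory.
Import numFieldNormedType.Exports.
Import measurable_realfun.

Local Open Scope classical_set_scope.
Local Open Scope ring_scope.

Set Implicit Arguments.
Unset Strict Implicit.
Unset Printing Implicit Defensive.

Require Import Defs.

(** A vanishing smoothed strain only constrains means of two neighbouring edge averages, and around
    a quadrilateral, an even cycle, averages of alternating sign satisfy this constraint: such an
    hourglass pattern cannot be excluded element by element. What defeats it is that the center is
    the mean of the nodes and the displacement there the mean of the nodal displacements. Then the
    exact strains, weighted by area, have zero alternating sum in each quadrilateral and are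
    orthogonal to the pattern of signs; comparing the two over the whole mesh excludes it. On the
    analytic side, [Bop] uses weak derivatives picked by choice, so the strain of a discrete
    displacement is known only through uniqueness of weak derivatives. This is why the fundamental
    lemma for [C1] test functions and an integration by parts appear. Elements of V_h are likewise
    plain functions on the plane: they form no finite-dimensional vector space as they stand, and
    finite dimension has to be read off their nodal values. *)

HB.instance Definition _ (R : realType) := Measure.on (@area R).

(** * Area in the plane: open sets, shears, null lines *)

Section PlaneMeasure.
Context {R : realType}.
Implicit Types (A B : set (plane R)).

Lemma open_plane_rat_box A (x : plane R) : open A -> A x ->
  exists r : (rat * rat) * (rat * rat),
    [/\ x.1 \in `]ratr r.1.1, ratr r.1.2[, x.2 \in `]ratr r.2.1, ratr r.2.2[ &
      `[ratr r.1.1, ratr r.1.2] `*` `[ratr r.2.1, ratr r.2.2] `<=` A].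
Proof.
move=> oA Ax.
have : nbhs x A by exact: open_nbhs_nbhs.
case => -[P Q] /= [/nbhs_ballP [e /= e0 eP] /nbhs_ballP [e' /= e'0 eQ]] PQ.
have rb (z d : R) : 0 < d -> exists a b : rat,
   ratr a < z < ratr b /\ [set` `[ratr a, ratr b]] `<=` ball z d.
  move=> d0.
  have zd1 : z - d < z by lra.
  have zd2 : z < z + d by lra.
  have [a /[!in_itv]/= /andP[a1 a2]] := rat_in_itvoo zd1.
  have [b /[!in_itv]/= /andP[b1 b2]] := rat_in_itvoo zd2.
  exists a, b; split; first by rewrite a2 b1.
  move=> y /=; rewrite in_itv/= => /andP[ay yb].
  rewrite /ball/= ltr_norml; lra.
have [a [b [ab sab]]] := rb x.1 e e0.
have [c [d [cd scd]]] := rb x.2 e' e'0.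
exists ((a, b), (c, d)); split => // -[y1 y2] /= [h1 h2].
by apply: PQ; split => /=; [exact/eP/sab|exact/eQ/scd].
Qed.

(** [P] is abstract because the cover serves twice: for measurability of open sets, and for passing
    from boxes to an open set in the fundamental lemma. There the closed box must lie in [A], being
    the support of test functions. Indices that code no admissible rational box get [set0]. *)
Lemma open_plane_countable_cover (P : set (plane R) -> Prop) A : open A ->
  (forall a b c d : R, `[a, b] `*` `[c, d] `<=` A -> P (`]a, b[ `*` `]c, d[)) ->
  P set0 ->
  exists2 F : (set (plane R))^nat, A = \bigcup_n F n & forall n, P (F n).
Proof.
move=> oA AP P0.
pose F n : set (plane R) :=
  if (unpickle n : option ((rat * rat) * (rat * rat))) is Some r then
    if pselect (`[ratr r.1.1 : R, ratr r.1.2] `*` `[ratr r.2.1, ratr r.2.2] `<=` A)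
    then `]ratr r.1.1, ratr r.1.2[ `*` `]ratr r.2.1, ratr r.2.2[ else set0
  else set0.
exists F; last first.
  move=> n; rewrite /F; case: unpickle => // r; case: pselect => // rA; exact: AP.
apply/seteqP; split=> [x Ax|x [n _]].
  have [r [r1 r2 rA]] := open_plane_rat_box oA Ax.
  by exists (pickle r); [exact: I|rewrite /F pickleK; case: pselect].
rewrite /F; case: unpickle => // r; case: pselect => // rA [/= x1 x2].
by apply: rA; split => /=; apply: subset_itv_oo_cc.
Qed.

Lemma open_plane_measurable A : open A -> measurable A.
Proof.
move=> oA; have [||F -> mF] := open_plane_countable_cover (P := measurable) oA.
- by move=> a b c d _; exact: measurableX.
- exact: measurable0.
- exact: bigcupT_measurable.
Qed.

(** Uniqueness of Lebesgue measure: the image measure rescaled by [|d|] gives half-open intervals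
    their length. A negative [d] turns them into intervals open at the other end. *)
Lemma lebesgue_measure_affine (B : set R) (d c : R) : measurable B -> d != 0 ->
  @lebesgue_measure R [set y | B (d * y + c)] = (`|d|^-1%:E * @lebesgue_measure R B)%E.
Proof.
move=> mB d0.
have mf : measurable_fun setT (fun y : R => d * y + c).
  by apply: measurable_funD => //; exact: measurable_funM.
pose mu : {measure set (measurableTypeR R) -> \bar R} := mscale (NngNum (normr_ge0 d))
  (pushforward (@lebesgue_measure R) (fun y : R => d * y + c : measurableTypeR R)).
have muE X : mu mf X = (`|d|%:E * @lebesgue_measure R [set y | X ((d * y + c)%R)])%E by [].
suff : @lebesgue_measure R B = mu mf B.
  by move=> ->; rewrite muE muleA -EFinM mulVf ?normr_eq0// mul1e.
apply: (@lebesgue_measure_unique _ (mu mf)) => //= _ [[a b]] _ <- /=.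
rewrite muE/= lebesgue_measure_itv/= lte_fin.
have [d_gt0|d_lt0] := ltrP 0 d.
- rewrite [X in (_ * lebesgue_measure X)%E](_ : _ = [set` `](a - c) / d, (b - c) / d]]); last first.
    apply/seteqP; split => y /=; rewrite !in_itv/= ltr_pdivrMr// ler_pdivlMr// => /andP[? ?];
    by apply/andP; split; lra.
  rewrite lebesgue_measure_itv/= lte_fin ltr_pM2r ?invr_gt0// ltrD2r.
  case: ifPn => _; last by rewrite mule0.
  rewrite -!EFinB -EFinM gtr0_norm//; congr EFin; field.
  by rewrite gt_eqF.
- have {}d_lt0 : d < 0 by rewrite lt_neqAle d0.
  rewrite [X in (_ * lebesgue_measure X)%E](_ : _ = [set` `[(b - c) / d, (a - c) / d[]); last first.
    apply/seteqP; split => y /=; rewrite !in_itv/= ltr_ndivlMr// ler_ndivrMr// => /andP[? ?];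
    by apply/andP; split; lra.
  rewrite lebesgue_measure_itv/= lte_fin ltr_nM2r ?invr_lt0// ltrD2r.
  case: ifPn => _; last by rewrite mule0.
  rewrite -!EFinB -EFinM ltr0_norm//; congr EFin; field.
  by rewrite lt_eqF.
Qed.

Lemma measurable_affine_form (a b c : R) :
  measurable_fun setT (fun z : plane R => a * z.1 + b * z.2 + c).
Proof.
apply: measurable_funD => //; apply: measurable_funD.
- exact: measurable_funM.
- exact: measurable_funM.
Qed.

Lemma area_setX (A B : set R) : measurable A -> measurable B ->
  area (A `*` B) = (@lebesgue_measure R A * @lebesgue_measure R B)%E.
Proof. by move=> mA mB; rewrite /area product_measure1E. Qed.

(** [area] is the integral of the measures of vertical sections, and each section of the preimage is
    an affine preimage of a section of [A], with an offset that depends on the abscissa. *)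
Lemma area_shear_y A (s d c : R) : measurable A -> d != 0 ->
  area [set z : plane R | A (z.1, s * z.1 + d * z.2 + c)] = (`|d|^-1%:E * area A)%E.
Proof.
move=> mA d0.
rewrite /area /product_measure1.
rewrite -ge0_integralZl; [|by []|exact: measurable_fun_xsection|
  by move=> x _; exact: measure_ge0|by rewrite lee_fin invr_ge0].
apply: eq_integral => x _ /=.
rewrite -(@lebesgue_measure_affine _ d (s * x + c))//; last exact: measurable_xsection.
congr (lebesgue_measure _); apply/seteqP; split => y /=.
  by rewrite /xsection/= !inE/= (_ : d * y + _ = s * x + d * y + c); last ring.
by rewrite /xsection/= !inE/= (_ : d * y + _ = s * x + d * y + c); last ring.
Qed.

(** Uniqueness of the product measure: the image measure agrees with [area] on rectangles.
    Conjugation by the swap then gives horizontal shears. *)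
Lemma area_swap A : measurable A -> area [set z : plane R | A (z.2, z.1)] = area A.
Proof.
move=> mA.
have mf : measurable_fun setT (fun z : plane R => (z.2, z.1)).
  exact: measurable_fun_pair.
pose mu : {measure set (measurableTypeR R * measurableTypeR R) -> \bar R} :=
  pushforward (@area R) (fun z : measurableTypeR R * measurableTypeR R => (z.2, z.1)).
rewrite [RHS](@product_measure_unique _ _ _ _ R _ _ (mu mf))//.
move=> X Y mX mY.
transitivity (area (Y `*` X)); last by rewrite area_setX// muleC.
by congr (area _); apply/seteqP; split => -[u v] [].
Qed.

Lemma area_shear_x A (s d c : R) : measurable A -> d != 0 ->
  area [set z : plane R | A (d * z.1 + s * z.2 + c, z.2)] = (`|d|^-1%:E * area A)%E.
Proof.
move=> mA d0.
have mf : measurable_fun setT (fun z : plane R => (z.2, z.1)).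
  exact: measurable_fun_pair.
have mA' : measurable [set z : plane R | A (z.2, z.1)].
  by rewrite -[X in measurable X]setTI; exact: mf.
rewrite -(area_swap mA) -(area_shear_y s c mA' d0) -area_swap/=.
  congr area; apply/seteqP; split => -[x y] /=;
    by rewrite [s * x + _]addrC.
have mg : measurable_fun setT (fun z : plane R => (d * z.1 + s * z.2 + c, z.2)).
  apply: measurable_fun_pair => //; exact: measurable_affine_form.
by rewrite -[X in measurable X]setTI; exact: mg.
Qed.

Lemma area_line (a b c : R) : (a != 0) || (b != 0) ->
  area [set z : plane R | a * z.1 + b * z.2 + c = 0] = 0%E.
Proof.
have key (a' b' c' : R) : b' != 0 -> area [set z : plane R | a' * z.1 + b' * z.2 + c' = 0] = 0%E.
  move=> b0; rewrite /area /product_measure1 integral0_eq// => x _ /=.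
  rewrite [xsection _ _](_ : _ = [set - (a' * x + c') / b']); first exact: lebesgue_measure_set1.
  apply/seteqP; split => y /=; rewrite /xsection/= inE/= => h.
    by apply: (mulIf b0); rewrite mulfVK//; lra.
  by rewrite h; field.
have [b0|b0] := eqVneq b 0; last by move=> _; exact: key.
rewrite orbF => a0.
have <- : [set z : plane R | [set w : plane R | b * w.1 + a * w.2 + c = 0] (z.2, z.1)]
     = [set z : plane R | a * z.1 + b * z.2 + c = 0].
  by apply/seteqP; split => -[x y] /=; rewrite [b * y + _]addrC.
rewrite area_swap ?key//.
have := @measurable_affine_form b a c; move=> /(_ measurableT [set 0]) => h.
by have := h (measurable_set1 _); rewrite setTI.
Qed.

Lemma area_bounded (A : set (plane R)) : measurable A -> bounded_set A -> (area A < +oo)%E.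
Proof.
move=> mA [M [_ /(_ (`|M| + 1))]] h.
have {}h : forall x, A x -> `|x| <= `|M| + 1.
  by apply: h; rewrite (le_lt_trans (ler_norm M))// ltrDl.
set N := `|M| + 1 in h.
have sA : A `<=` `[-N, N] `*` `[-N, N].
  move=> [x y] /h; rewrite prod_normE/= ge_max !ler_norml => /andP[? ?].
  by split; rewrite /= in_itv.
apply: (@le_lt_trans _ _ (area (`[-N, N] `*` `[-N, N]))).
  by apply: le_measure => //; rewrite inE//; apply: measurableX.
rewrite area_setX// !lebesgue_measure_itv/=.
by case: ifP => _; rewrite ?mule0 ?mul0e// -!EFinD -EFinM ltry.
Qed.

Lemma area_negligibleS A B : A `<=` B -> (@area R).-negligible B -> (@area R).-negligible A.
Proof. by move=> AB nB; exact: (@negligibleS _ _ _ (@area R) _ _ AB). Qed.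

Lemma area_negligibleP A : measurable A -> (@area R).-negligible A <-> area A = 0%E.
Proof. by move=> mA; exact: negligibleP. Qed.

Lemma area_negligibleU A B : (@area R).-negligible A -> (@area R).-negligible B ->
  (@area R).-negligible (A `|` B).
Proof. by move=> nA nB; exact: (@negligibleU _ _ _ (@area R)). Qed.

End PlaneMeasure.

(** * Triangles: half-plane description, area, null boundary *)

Section Triangles.
Context {R : realType}.
Implicit Types (p q r x : plane R).

Definition unit_triangle : set (plane R) :=
  [set z | [/\ 0 <= z.1, 0 <= z.2 & z.1 + z.2 <= 1]].

(* The value [1/2] is never computed: only positivity matters. *)
Definition unit_triangle_area : R := fine (area unit_triangle).

Definition triangle_interior p q r : set (plane R) :=
  [set x | [/\ 0 < cross (q - p) (x - p), 0 < cross (r - q) (x - q) &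
               0 < cross (p - r) (x - r)]].

(** The barycentric coordinates of [x] are the three cross products divided by
    [cross (q - p) (r - p)]. *)
Lemma triangleE p q r : 0 < cross (q - p) (r - p) ->
  triangle p q r = [set x | [/\ 0 <= cross (q - p) (x - p),
    0 <= cross (r - q) (x - q) & 0 <= cross (p - r) (x - r)]].
Proof.
rewrite /cross/= => D0; apply/seteqP; split.
  move=> _ [a [b [c [a0 b0 c0 abc ->]]]] /=; split.
  - rewrite /cross/= /GRing.scale/=.
    rewrite [leRHS](_ : _ = c * ((q.1 - p.1) * (r.2 - p.2) - (q.2 - p.2) * (r.1 - p.1))).
      by rewrite mulr_ge0// ltW.
    have -> : a = 1 - b - c by lra.
    ring.
  - rewrite /cross/= /GRing.scale/=.
    rewrite [leRHS](_ : _ = a * ((q.1 - p.1) * (r.2 - p.2) - (q.2 - p.2) * (r.1 - p.1))).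
      by rewrite mulr_ge0// ltW.
    have -> : a = 1 - b - c by lra.
    ring.
  - rewrite /cross/= /GRing.scale/=.
    rewrite [leRHS](_ : _ = b * ((q.1 - p.1) * (r.2 - p.2) - (q.2 - p.2) * (r.1 - p.1))).
      by rewrite mulr_ge0// ltW.
    have -> : a = 1 - b - c by lra.
    ring.
move=> x /= []; rewrite /cross/= => h1 h2 h3.
pose D := (q.1 - p.1) * (r.2 - p.2) - (q.2 - p.2) * (r.1 - p.1).
exists (((r.1 - q.1) * (x.2 - q.2) - (r.2 - q.2) * (x.1 - q.1)) / D),
  (((p.1 - r.1) * (x.2 - r.2) - (p.2 - r.2) * (x.1 - r.1)) / D),
  (((q.1 - p.1) * (x.2 - p.2) - (q.2 - p.2) * (x.1 - p.1)) / D).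
split; try by rewrite divr_ge0// ltW.
  by rewrite /D; field; rewrite gt_eqF.
apply/eqP; rewrite -pair_eqE/=; apply/andP; split; apply/eqP; rewrite /GRing.scale/= /D; field; rewrite gt_eqF//.
Qed.

Lemma triangle_rot p q r : triangle p q r = triangle q r p.
Proof.
apply/seteqP; split => x [a [b [c [a0 b0 c0 abc ->]]]].
  exists b, c, a; split => //; first by lra.
  by rewrite -addrA addrC.
exists c, a, b; split => //; first by lra.
by rewrite addrC addrA.
Qed.

Lemma measurable_halfplane p q : measurable [set x : plane R | 0 <= cross (q - p) (x - p)].
Proof.
have := @measurable_affine_form R (- (q.2 - p.2)) (q.1 - p.1) (- cross (q - p) p).
move=> /(_ measurableT `[0, +oo[%classic (measurable_itv _)); rewrite setTI.
congr measurable; apply/seteqP; split => x /=; rewrite in_itv/= andbT /cross/=; congr (_ <= _); ring.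
Qed.

Lemma measurable_unit_triangle : measurable unit_triangle.
Proof.
have -> : unit_triangle = triangle (0, 0) (1, 0) (0, 1).
  rewrite triangleE; last by rewrite /cross/= !subr0; lra.
  apply/seteqP; split => x []; rewrite /cross/= => *; split; rewrite /cross/=; lra.
rewrite triangleE; last by rewrite /cross/= !subr0; lra.
rewrite [X in measurable X](_ : _ = [set x | 0 <= cross ((1, 0) - (0, 0)) (x - (0, 0))] `&`
   ([set x | 0 <= cross ((0, 1) - (1, 0)) (x - (1, 0))] `&` [set x | 0 <= cross ((0, 0) - (0, 1)) (x - (0, 1))])).
  by do ?apply: measurableI; exact: measurable_halfplane.
by apply/seteqP; split => x [] // ? [].
Qed.

Lemma measurable_triangle p q r : 0 < cross (q - p) (r - p) -> measurable (triangle p q r).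
Proof.
move=> D0; rewrite triangleE//.
rewrite [X in measurable X](_ : _ = [set x | 0 <= cross (q - p) (x - p)] `&`
   ([set x | 0 <= cross (r - q) (x - q)] `&` [set x | 0 <= cross (p - r) (x - r)])).
  by do ?apply: measurableI; exact: measurable_halfplane.
by apply/seteqP; split => x [] // ? [].
Qed.

Lemma unit_triangle_area_fin : area unit_triangle = unit_triangle_area%:E.
Proof.
have A0 : (0 <= area unit_triangle)%E by exact: (measure_ge0 (@area R)).
rewrite /unit_triangle_area fineK// ge0_fin_numE//.
apply: area_bounded; first exact: measurable_unit_triangle.
exists 1; split; first exact: num_real.
move=> M M1 [x y] [/= x0 y0 xy]; rewrite prod_normE/= ge_max !ger0_norm//; lra.
Qed.

Lemma unit_triangle_area_gt0 : 0 < unit_triangle_area.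
Proof.
rewrite -lte_fin -unit_triangle_area_fin.
apply: (@lt_le_trans _ _ (area (`[0, 2^-1] `*` `[0, 2^-1]))).
  rewrite area_setX// !lebesgue_measure_itv/= !lte_fin invr_gt0 ltr0n.
  by rewrite -!EFinB -EFinM lte_fin subr0 mulr_gt0 // invr_gt0.
apply: le_measure; rewrite ?inE; [exact: measurableX|exact: measurable_unit_triangle|].
by move=> [x y] [/=]; rewrite !in_itv/= => /andP[? ?] /andP[? ?]; split => /=; lra.
Qed.

Lemma area_triangle p q r : 0 < cross (q - p) (r - p) ->
  area (triangle p q r) = (unit_triangle_area * cross (q - p) (r - p))%:E.
Proof.
wlog h : p q r / (r - p).2 != 0.
  move=> th D0.
  (* If [r - p] is horizontal then [p - q] is not, as the triangle is nondegenerate; rotating the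
     vertices reduces to the other case. *)
  have [r0|r0] := eqVneq (r - p).2 0; last exact: th.
  have D1 : 0 < cross (r - q) (p - q).
    by move: D0; rewrite /cross/=; congr (_ < _); ring.
  rewrite triangle_rot th//.
    by congr (_ * _)%:E; rewrite /cross/=; ring.
  apply/negP => /eqP p0; move: D0; rewrite /cross/= in r0 p0 *.
  by rewrite (_ : q.2 - p.2 = - (p.2 - q.2)) ?p0 ?r0; lra.
move=> D0; pose D := cross (q - p) (r - p); have Dn0 : D != 0 by rewrite gt_eqF.
(* The barycentric coordinates at [q] and [r] map the triangle onto the unit triangle. The first is
   [al * z.1 + be * z.2 + c1]; the second is rewritten through the first and [z.2]. The map is thus
   a horizontal shear followed by a vertical one, with factor [al * d = D^-1]. *)
pose al := (r - p).2 / D; have al0 : al != 0 by rewrite mulf_neq0// invr_eq0.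
pose be := - (r - p).1 / D.
pose s := - (q - p).2 / D / al.
pose d := (D * al)^-1; have d0 : d != 0 by rewrite invr_eq0 mulf_neq0.
pose c1 := - cross p (r - p) / D.
pose c2 := - cross (q - p) p / D - s * c1.
have -> : triangle p q r = [set z : plane R | [set w : plane R | unit_triangle
    (w.1, s * w.1 + d * w.2 + c2)] (al * z.1 + be * z.2 + c1, z.2)].
  have ds : s * be + d = (q - p).1 / D.
    by rewrite /d /s /be /al /D /cross/=; field; rewrite h/= gt_eqF.
  have sa : s * al = - (q - p).2 / D by rewrite /s mulfVK.
  have e1 z : al * z.1 + be * z.2 + c1 = cross (z - p) (r - p) / D.
    by rewrite /al /be /c1 /cross/=; ring.
  have e2 z : s * (al * z.1 + be * z.2 + c1) + d * z.2 + c2 = cross (q - p) (z - p) / D.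
    rewrite (_ : _ + _ = (s * al) * z.1 + (s * be + d) * z.2 + (c2 + s * c1)); last ring.
    by rewrite ds sa /c2 /cross/=; ring.
  rewrite triangleE//; apply/seteqP; split => z /=; rewrite /unit_triangle/= e2 e1 => -[h1 h2 h3]; split.
  - rewrite divr_ge0 ?(ltW D0)//; move: h3; rewrite /cross/=; congr (_ <= _); ring.
  - by rewrite divr_ge0 ?(ltW D0).
  - rewrite -mulrDl ler_pdivrMr// mul1r -subr_ge0; move: h2; rewrite /D /cross/=; congr (_ <= _); ring.
  - by move: h2; rewrite pmulr_lge0 ?invr_gt0.
  - move: h3; rewrite -mulrDl ler_pdivrMr// mul1r -subr_ge0 /D /cross/=; congr (_ <= _); ring.
  - move: h1; rewrite pmulr_lge0 ?invr_gt0// /cross/=; congr (_ <= _); ring.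
rewrite area_shear_x// ?area_shear_y//.
- rewrite unit_triangle_area_fin -!EFinM; congr EFin.
  rewrite mulrA mulrC; congr (_ * _).
  rewrite -!normfV -normrM /d invrK mulrCA mulVf// mulr1 gtr0_norm//.
- exact: measurable_unit_triangle.
- have mg : measurable_fun setT (fun w : plane R => (w.1, s * w.1 + d * w.2 + c2)).
    by apply: measurable_fun_pair => //; exact: measurable_affine_form.
  by rewrite -[X in measurable X]setTI; apply: mg => //; exact: measurable_unit_triangle.
Qed.

Lemma area_cross_line p q : p != q ->
  area [set x : plane R | cross (q - p) (x - p) = 0] = 0%E.
Proof.
move=> pq; rewrite -(@area_line R (- (q.2 - p.2)) (q.1 - p.1) (- cross (q - p) p)); last first.
  move: pq; apply: contraNT; rewrite negb_or !negbK oppr_eq0 !subr_eq0 -pair_eqE /pair_eq => /andP[/eqP-> /eqP->].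
  by rewrite !eqxx.
congr area; apply/seteqP; split => x /=; rewrite /cross/= => h; rewrite -[RHS]h; ring.
Qed.

Lemma measurable_cross_line p q :
  measurable [set x : plane R | cross (q - p) (x - p) = 0].
Proof.
have := @measurable_affine_form R (- (q.2 - p.2)) (q.1 - p.1) (- cross (q - p) p).
move=> /(_ measurableT [set 0] (measurable_set1 _)); rewrite setTI.
congr measurable; apply/seteqP; split => x /=; rewrite /cross/= => h; rewrite -[RHS]h; ring.
Qed.

Lemma negligible_cross_line p q : p != q ->
  (@area R).-negligible [set x : plane R | cross (q - p) (x - p) = 0].
Proof. by move=> pq; apply/negligibleP; [exact: measurable_cross_line|exact: area_cross_line]. Qed.

Lemma negligible_segment p q : p != q -> (@area R).-negligible (segment p q).
Proof.
move=> pq; apply: negligibleS (negligible_cross_line pq) => _ [t _ <-] /=.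
by rewrite /cross/segpt/= /GRing.scale/=; ring.
Qed.

Lemma cross_gt0_neq p q r : 0 < cross (q - p) (r - p) -> [/\ p != q, q != r & r != p].
Proof.
move=> D0; split; apply/eqP => e; move: D0; rewrite e /cross/=; lra.
Qed.

Lemma negligible_triangle_boundary p q r : 0 < cross (q - p) (r - p) ->
  (@area R).-negligible (triangle p q r `\` triangle_interior p q r).
Proof.
move=> D0; have [pq qr rp] := cross_gt0_neq D0.
apply: negligibleS (negligibleU (negligible_cross_line pq)
  (negligibleU (negligible_cross_line qr) (negligible_cross_line rp))).
rewrite triangleE// => x /= [[h1 h2 h3]] h.
have [e1|e1] := eqVneq (cross (q - p) (x - p)) 0; first by left.
have [e2|e2] := eqVneq (cross (r - q) (x - q)) 0; first by right; left.
have [e3|e3] := eqVneq (cross (p - r) (x - r)) 0; first by right; right.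
by exfalso; apply: h; split; rewrite lt_neqAle eq_sym ?e1 ?e2 ?e3.
Qed.

Lemma continuous_affine_form (a b c : R) :
  continuous (fun z : plane R => a * z.1 + b * z.2 + c).
Proof.
move=> z; apply: cvgD; last exact: cvg_cst.
apply: cvgD; apply: cvgM; [exact: cvg_cst|exact: cvg_fst|exact: cvg_cst|exact: cvg_snd].
Qed.

Lemma open_halfplane p q : open [set x : plane R | 0 < cross (q - p) (x - p)].
Proof.
have ogt : open [set y : R | 0 < y] by exact: open_gt.
have := @continuous_affine_form (- (q.2 - p.2)) (q.1 - p.1) (- cross (q - p) p).
move=> /continuousP /(_ _ ogt).
congr open; apply/seteqP; split => x /=; rewrite /cross/=; congr (_ < _); ring.
Qed.

Lemma open_triangle_interior p q r : open (triangle_interior p q r).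
Proof.
rewrite [X in open X](_ : _ = [set x | 0 < cross (q - p) (x - p)] `&`
   ([set x | 0 < cross (r - q) (x - q)] `&` [set x | 0 < cross (p - r) (x - r)])).
  by do ?apply: openI; exact: open_halfplane.
by apply/seteqP; split => x [] // ? [].
Qed.

Lemma triangle_interior_subset p q r : 0 < cross (q - p) (r - p) ->
  triangle_interior p q r `<=` triangle p q r.
Proof. by move=> D0; rewrite triangleE// => x [? ? ?]; split; exact: ltW. Qed.

End Triangles.

(** * Geometry of the mesh: orientation of shared edges, subtriangles and their halves *)

Section MeshGeometry.
Context {R : realType}.
Implicit Types (a b c p q r x : plane R).

Lemma cross_swap a b : cross a b = - cross b a.
Proof. by rewrite /cross; ring. Qed.

Lemma segment_left p q : segment p q p.
Proof.
by exists 0; rewrite /= ?in_itv/= ?lexx ?ler01// /segpt/= subr0 scale1r scale0r addr0.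
Qed.

Lemma segment_right p q : segment p q q.
Proof.
by exists 1; rewrite /= ?in_itv/= ?lexx ?ler01// /segpt/= subrr scale1r scale0r add0r.
Qed.

Lemma segment_cross p q a b c : segment p q a -> segment p q b -> segment p q c ->
  cross (b - a) (c - a) = 0.
Proof.
by move=> [s _ <-] [t _ <-] [u _ <-]; rewrite /cross/segpt/= /GRing.scale/=; ring.
Qed.

(** The parameters [s] and [t] of [p] and [q] on the other segment lie in [0, 1], yet convex
    combinations of them take the values 0 and 1; so one of them is 0 and the other is 1. *)
Lemma segment_inj p q p' q' : p != q -> segment p q = segment p' q' ->
  (p = p' /\ q = q') \/ (p = q' /\ q = p').
Proof.
move=> pq E.
have pq' : p' != q'.
  apply: contra pq => /eqP e.
  have : segment p' q' p by rewrite -E; exact: segment_left.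
  have : segment p' q' q by rewrite -E; exact: segment_right.
  rewrite e => -[t _ <-] [s _ <-]; rewrite /segpt/= -!scalerDl.
  by rewrite !subrK.
have [s /= + sp] : segment p' q' p by rewrite -E; exact: segment_left.
rewrite in_itv/= => /andP[s0 s1].
have [t /= + tq] : segment p' q' q by rewrite -E; exact: segment_right.
rewrite in_itv/= => /andP[t0 t1].
have [s' /= + sp'] : segment p q p' by rewrite E; exact: segment_left.
rewrite in_itv/= => /andP[s'0 s'1].
have [t' /= + tq'] : segment p q q' by rewrite E; exact: segment_right.
rewrite in_itv/= => /andP[t'0 t'1].
have inj (u v : R) : segpt (p', q') u = segpt (p', q') v -> u = v.
  rewrite /segpt/= => uv; apply/eqP; rewrite -subr_eq0.
  have : (u - v) *: (q' - p') = 0.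
    apply/eqP; rewrite -pair_eqE/=; move: uv => [e1 e2]; rewrite /GRing.scale/= in e1 e2 *.
    by apply/andP; split; apply/eqP; lra.
  by move/eqP; rewrite scaler_eq0 [q' - p' == 0]subr_eq0 [q' == p']eq_sym (negbTE pq') orbF.
have comp u : segpt (p, q) u = segpt (p', q') ((1 - u) * s + u * t).
  rewrite -sp -tq /segpt/=; apply/eqP; rewrite -pair_eqE /pair_eq/= /GRing.scale/=.
  by apply/andP; split; apply/eqP; ring.
have e0 : (1 - s') * s + s' * t = 0.
  by apply: inj; rewrite -comp sp' /segpt/= subr0 scale1r scale0r addr0.
have e1 : (1 - t') * s + t' * t = 1.
  by apply: inj; rewrite -comp tq' /segpt/= subrr scale1r scale0r add0r.
have se : segpt (p', q') 0 = p' by rewrite /segpt/= subr0 scale1r scale0r addr0.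
have te : segpt (p', q') 1 = q' by rewrite /segpt/= subrr scale1r scale0r add0r.
have [st|ts] := lerP s t.
  have h1 : 0 <= s' * (t - s) by rewrite mulr_ge0// subr_ge0.
  have h2 : 0 <= (1 - t') * (t - s) by rewrite mulr_ge0// subr_ge0.
  have s_eq : s = 0 by lra.
  have t_eq : t = 1 by lra.
  by left; rewrite -sp -tq s_eq t_eq se te.
have h1 : 0 <= (1 - s') * (s - t) by rewrite mulr_ge0// subr_ge0// ltW.
have h2 : 0 <= t' * (s - t) by rewrite mulr_ge0// subr_ge0 ltW.
have s_eq : s = 1 by lra.
have t_eq : t = 0 by lra.
by right; rewrite -sp -tq s_eq t_eq se te.
Qed.

(** This excludes neighbours that traverse a shared edge in the same direction: the common point [z]
    is off the line of the edge, whereas conforming elements share at most a segment. *)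
Lemma same_side_overlap c c' p q : 0 < cross (p - c) (q - c) -> 0 < cross (p - c') (q - c') ->
  exists z, [/\ triangle c p q z, triangle c' p q z & 0 < cross (q - p) (z - p)].
Proof.
move=> D0 D0'.
pose m := 2^-1 *: (p + q).
pose al := 2^-1 * cross (p - c') (q - c').
pose b1 := cross (p - c') (c - m); pose b2 := cross (c' - q) (c - m).
have al0 : 0 < al by rewrite mulr_gt0// invr_gt0.
(* The point moves from the midpoint [m] towards [c]. At [m], the forms of the two other sides of
   the second triangle both equal [al], and they vary at rates [b1] and [b2]; [la] is small enough
   to keep them nonnegative. *)
pose la := al / (al + `|b1| + `|b2|).
have den0 : 0 < al + `|b1| + `|b2|.
  by rewrite -addrA ltr_pwDl// addr_ge0.
have la0 : 0 < la by rewrite divr_gt0.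
have la1 : la <= 1 by rewrite ler_pdivrMr// mul1r -addrA lerDl addr_ge0.
have bnd (b : R) : `|b| <= `|b1| + `|b2| -> 0 <= al + la * b.
  move=> hb; have : la * `|b| <= al.
    rewrite /la -mulrA ler_piMr ?(ltW al0)// mulrC ler_pdivrMr// mul1r.
    by rewrite (le_trans hb)// -addrA lerDr ltW.
  have : 0 <= la * (b + `|b|) by rewrite mulr_ge0 ?(ltW la0)// -lerBlDr sub0r lerNl -normrN ler_norm.
  lra.
exists (m + la *: (c - m)).
have zc : cross (q - p) (m + la *: (c - m) - p) = la * cross (p - c) (q - c).
  by rewrite /cross /m/= /GRing.scale/=; field.
split; last by rewrite zc mulr_gt0.
- exists la, ((1 - la) / 2), ((1 - la) / 2); split; rewrite ?(ltW la0) ?divr_ge0 ?subr_ge0//; first by field.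
  by rewrite /m; apply/eqP; rewrite -pair_eqE/= /GRing.scale/=; apply/andP; split; apply/eqP; field.
- rewrite triangleE//; split; last first.
  + have -> : cross (c' - q) (m + la *: (c - m) - q) = al + la * b2.
      by rewrite /al /b2 /cross /m/= /GRing.scale/=; field.
    by apply: bnd; rewrite lerDr.
  + by rewrite zc; exact: ltW (mulr_gt0 la0 D0).
  + have -> : cross (p - c') (m + la *: (c - m) - c') = al + la * b1.
      by rewrite /al /b1 /cross /m/= /GRing.scale/=; field.
    by apply: bnd; rewrite lerDl.
Qed.

(* Four vectors in cyclic order, each less than half a turn from the next, turn
   around the origin only once, so that a direction [y] cannot be met twice. *)
Lemma opposite_cones_disjoint (a0 a1 a2 a3 y : plane R) :
  0 < cross a0 a1 -> 0 < cross a1 a2 -> 0 < cross a2 a3 -> 0 < cross a3 a0 ->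
  0 < cross a0 y -> 0 < cross y a1 -> 0 < cross a2 y -> 0 < cross y a3 -> False.
Proof.
move=> c01 c12 c23 c30 h0 h1 h2 h3.
have : 0 < cross a0 a1 * cross a2 y * cross y a3 + cross a1 a2 * cross a0 y * cross y a3
  + cross a2 a3 * cross a0 y * cross y a1 + cross a3 a0 * cross y a1 * cross a2 y.
  by rewrite !addr_gt0// !mulr_gt0.
by rewrite (_ : _ + _ = 0) ?ltxx// /cross; ring.
Qed.

Lemma ordS_cases k (i j : 'I_(nnodes k)) : i != j ->
  [\/ j = ordS i, i = ordS j | k = Quad4 /\ j = ordS (ordS i)].
Proof.
case: k i j => -[[|[|[|[|]]]]// hi] [[|[|[|[|]]]]// hj] // _;
 by [apply: Or31; apply: val_inj|apply: Or32; apply: val_inj|apply: Or33; split => //; apply: val_inj].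
Qed.

Lemma ordS4 (i : 'I_(nnodes Quad4)) : ordS (ordS (ordS (ordS i))) = i.
Proof. by apply: val_inj; case: i => -[|[|[|[|]]]]. Qed.

Context {k : elt_kind} (M : mesh R k).
Implicit Types (T : 'I_(nelts M)) (u v w : corner M).

Definition cnode u := node u.1 u.2.
Definition cnext u := node u.1 (ordS u.2).
Definition ccenter u := center u.1.
Definition csub u := subtri u.1 u.2.
Definition csub_interior u := triangle_interior (ccenter u) (cnode u) (cnext u).
Definition ccross u := cross (cnode u - ccenter u) (cnext u - ccenter u).
Definition cedge u := edge u.1 u.2.
Definition cmid u := midpoint u.1 u.2.
Definition half1 u := triangle (ccenter u) (cnode u) (cmid u).
Definition half2 u := triangle (ccenter u) (cmid u) (cnext u).

Lemma sum_node_center T : \sum_i (node T i - center T) = 0.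
Proof.
rewrite big_split/= sumrN sumr_const card_ord /center -scaler_nat scalerA mulfV ?scale1r ?subrr//.
by rewrite pnatr_eq0; case: k.
Qed.

Hypothesis hP : proper_elts M.

Lemma ccross_gt0 u : 0 < ccross u.
Proof. exact: hP. Qed.

Lemma cnode_neq u : cnode u != cnext u.
Proof. by have := ccross_gt0 u => /cross_gt0_neq[]. Qed.

(** Only the two sides through the center are used, that is, the angular order of the nodes seen
    from the center. Convexity of the element does not enter. *)
Lemma csub_interior_disjoint T i j : i != j ->
  csub_interior (T, i) `&` csub_interior (T, j) = set0.
Proof.
move=> ij; rewrite -subset0 => x [].
have key (c p q : plane R) : triangle_interior c p q x -> 0 < cross (p - c) (x - c) /\ 0 < cross (x - c) (q - c).
  by move=> [h1 _ h3]; split => //; move: h3; rewrite /cross/=; congr (_ < _); ring.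
move=> /key[i1 i2] /key[j1 j2].
rewrite /ccenter/cnode/cnext/= in i1 i2 j1 j2.
have [e|e|[ek e]] := ordS_cases ij.
- by move: j1 i2; rewrite e cross_swap; lra.
- by move: i1 j2; rewrite e cross_swap; lra.
- rewrite e in j1 j2.
  have := @opposite_cones_disjoint _ _ _ _ (x - center T) (hP T i) (hP T (ordS i)) (hP T (ordS (ordS i))).
  apply => //.
  have := hP T (ordS (ordS (ordS i))).
  suff -> : ordS (ordS (ordS (ordS i))) = i by [].
  by clear -ek; move: i; rewrite ek => i; rewrite ordS4.
Qed.

Lemma csub_interior_nonempty u : csub_interior u (3^-1 *: (ccenter u + cnode u + cnext u)).
Proof.
have := ccross_gt0 u; rewrite /ccross /csub_interior /triangle_interior/=.
move: (ccenter u) (cnode u) (cnext u) => c p q; rewrite /cross/= /GRing.scale/= => D0.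
by split; lra.
Qed.

Lemma csub_corner u : [/\ csub u (ccenter u), csub u (cnode u) & csub u (cnext u)].
Proof.
split; [exists 1, 0, 0|exists 0, 1, 0|exists 0, 0, 1];
  by split; rewrite ?ler01// ?scale1r ?scale0r ?addr0 ?add0r//.
Qed.

Lemma csub_elt u : csub u `<=` elt u.1.
Proof. by move=> x ux; exists u.2. Qed.

Hypothesis hC : conforming M.

(** With counterclockwise elements, traversing the edge in the same direction would put both
    subtriangles on the same side of it, where they overlap. This contradicts disjointness inside
    one element, and conformity for two elements. *)
Lemma cedge_cases u v : cedge u = cedge v -> u != v ->
  [/\ cnode v = cnext u & cnext v = cnode u].
Proof.
move=> E uv; have [[e1 e2]|[e1 e2]] := segment_inj (cnode_neq u) E; last by [].
exfalso.
have [T_eq|Tneq] := eqVneq u.1 v.1.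
  have ij : u.2 != v.2.
    by apply: contra uv => /eqP ij; rewrite [u]surjective_pairing [v]surjective_pairing T_eq ij.
  have := csub_interior_disjoint u.1 ij.
  have -> : csub_interior (u.1, u.2) = csub_interior (u.1, v.2).
    by rewrite /csub_interior /cnode /cnext/= -/(cnode u) -/(cnext u) e1 e2 T_eq.
  by rewrite setIid -subset0 => /(_ _ (csub_interior_nonempty (u.1, v.2))).
have D0 := ccross_gt0 u.
have D0' : 0 < cross (cnode u - ccenter v) (cnext u - ccenter v).
  by rewrite e1 e2; exact: (ccross_gt0 v).
have [z [z1 z2 z0]] := same_side_overlap D0 D0'.
have [_ up uq] := csub_corner u.
have [_ vp vq] := csub_corner v.
have Ip : (elt u.1 `&` elt v.1) (cnode u) by split; apply: csub_elt => //; rewrite e1.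
have Iq : (elt u.1 `&` elt v.1) (cnext u) by split; apply: csub_elt => //; rewrite e2.
have Iz : (elt u.1 `&` elt v.1) z.
  split; apply: csub_elt; first exact: z1.
  by rewrite /csub /subtri -e1 -e2.
have [h|[i [j [_ h]]]|[i [j [_ h]]]] := hC Tneq.
- by rewrite h in Ip.
- by rewrite h/= in Ip Iq; have := cnode_neq u; rewrite Ip Iq eqxx.
- rewrite h in Ip Iq Iz.
  by move: z0; rewrite (segment_cross Ip Iq Iz) ltxx.
Qed.

(** Reversing a direction twice restores it, so three corners cannot reverse one another
    pairwise. *)
Lemma cedge_at_most_two u v w : cedge u = cedge v -> cedge u = cedge w ->
  u != v -> u != w -> v = w.
Proof.
move=> uv uw nuv nuw; apply/eqP; apply: contraT => vw.
have [e1 e2] := cedge_cases uv nuv.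
have [e3 e4] := cedge_cases uw nuw.
have [e5 e6] := cedge_cases (etrans (esym uv) uw) vw.
by have := cnode_neq v; rewrite e1 e2 -e3 e5 e2 eqxx.
Qed.

Lemma measurable_csub u : measurable (csub u).
Proof. by apply: measurable_triangle; exact: ccross_gt0. Qed.

Lemma area_csub u : area (csub u) = (unit_triangle_area * ccross u)%:E.
Proof. by rewrite -area_triangle//; exact: ccross_gt0. Qed.

Lemma negligible_csubI u v : u != v -> (@area R).-negligible (csub u `&` csub v).
Proof.
move=> uv; have [T_eq|Tneq] := eqVneq u.1 v.1.
  have ij : u.2 != v.2.
    by apply: contra uv => /eqP ij; rewrite [u]surjective_pairing [v]surjective_pairing T_eq ij.
  apply: negligibleS (negligibleU (negligible_triangle_boundary (ccross_gt0 u))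
    (negligible_triangle_boundary (ccross_gt0 v))).
  move=> x [xu xv].
  have [iu|iu] := pselect (csub_interior u x); last by left.
  right; split => // iv.
  have := csub_interior_disjoint u.1 ij; rewrite -subset0 => h; apply: (h x).
  split; [exact: iu|rewrite T_eq; exact: iv].
have sub : csub u `&` csub v `<=` elt u.1 `&` elt v.1.
  by move=> x [? ?]; split; exact: csub_elt.
apply: area_negligibleS sub _.
have [h|[i [j [_ h]]]|[i [j [_ h]]]] := hC Tneq; rewrite h.
- exact: negligible_set0.
- have [p pn] : exists p, node u.1 i != p by exists (cnext (u.1, i)); exact: (cnode_neq (u.1, i)).
  apply: area_negligibleS (negligible_segment pn) => _ ->; exact: segment_left.
- apply: negligible_segment; exact: (cnode_neq (u.1, i)).
Qed.

Lemma half_split u : csub u = half1 u `|` half2 u.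
Proof.
rewrite /csub /subtri /half1 /half2 /cmid /midpoint -/(ccenter u) -/(cnode u) -/(cnext u).
move: (ccenter u) (cnode u) (cnext u) => o p r.
apply/seteqP; split => x.
  move=> [a [b [c [a0 b0 c0 abc ->]]]].
  have [bc|bc] := lerP c b; [left; exists a, (b - c), (2 * c)|right; exists a, (2 * b), (c - b)].
    split; rewrite ?subr_ge0 ?mulr_ge0//; first by lra.
    by apply/eqP; rewrite -pair_eqE /pair_eq/= /GRing.scale/=; apply/andP; split; apply/eqP; field.
  split; rewrite ?subr_ge0 ?mulr_ge0 ?(ltW bc)//; first by lra.
  by apply/eqP; rewrite -pair_eqE /pair_eq/= /GRing.scale/=; apply/andP; split; apply/eqP; field.
move=> [] [a [b [c [a0 b0 c0 abc ->]]]].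
  exists a, (b + c / 2), (c / 2); split; [by []|lra|lra|lra|].
  by apply/eqP; rewrite -pair_eqE /pair_eq/= /GRing.scale/=; apply/andP; split; apply/eqP; field.
exists a, (b / 2), (b / 2 + c); split; [by []|lra|lra|lra|].
by apply/eqP; rewrite -pair_eqE /pair_eq/= /GRing.scale/=; apply/andP; split; apply/eqP; field.
Qed.

Lemma half1_cross u : cross (cnode u - ccenter u) (cmid u - ccenter u) = ccross u / 2.
Proof.
rewrite /ccross /cmid /midpoint -/(cnode u) -/(cnext u).
by move: (ccenter u) (cnode u) (cnext u) => o p r; rewrite /cross/= /GRing.scale/=; field.
Qed.

Lemma half2_cross u : cross (cmid u - ccenter u) (cnext u - ccenter u) = ccross u / 2.
Proof.
rewrite /ccross /cmid /midpoint -/(cnode u) -/(cnext u).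
by move: (ccenter u) (cnode u) (cnext u) => o p r; rewrite /cross/= /GRing.scale/=; field.
Qed.

Lemma half_cross_gt0 u : 0 < ccross u / 2.
Proof. by rewrite divr_gt0 ?ccross_gt0. Qed.

Lemma area_half1 u : area (half1 u) = (unit_triangle_area * (ccross u / 2))%:E.
Proof. by rewrite area_triangle half1_cross// half_cross_gt0. Qed.

Lemma area_half2 u : area (half2 u) = (unit_triangle_area * (ccross u / 2))%:E.
Proof. by rewrite area_triangle half2_cross// half_cross_gt0. Qed.

Lemma measurable_half1 u : measurable (half1 u).
Proof. by apply: measurable_triangle; rewrite half1_cross half_cross_gt0. Qed.

Lemma measurable_half2 u : measurable (half2 u).
Proof. by apply: measurable_triangle; rewrite half2_cross half_cross_gt0. Qed.

Lemma negligible_half12 u : (@area R).-negligible (half1 u `&` half2 u).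
Proof.
have h1 : 0 < cross (cnode u - ccenter u) (cmid u - ccenter u) by rewrite half1_cross half_cross_gt0.
have h2 : 0 < cross (cmid u - ccenter u) (cnext u - ccenter u) by rewrite half2_cross half_cross_gt0.
have [n1 _ _] := cross_gt0_neq h2.
apply: negligibleS (negligible_cross_line n1) => x.
rewrite /half1 /half2 !triangleE//= => -[[_ _ h3]] [h4 _ _].
apply/eqP; rewrite eq_le h4 andbT; move: h3; rewrite /cross/=; lra.
Qed.

Lemma half1_sub u : half1 u `<=` csub u.
Proof. by rewrite half_split; exact: subsetUl. Qed.

Lemma half2_sub u : half2 u `<=` csub u.
Proof. by rewrite half_split; exact: subsetUr. Qed.

Definition cprev u : corner M := (u.1, ord_pred u.2).

Lemma cprev_next u : cnext (cprev u) = cnode u.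
Proof. by rewrite /cnext/cprev/= ord_predK. Qed.

(** In this form a cell at a node consists of one half of each of two consecutive subtriangles, and
    the first average is constant on each half. *)
Lemma cell2E u : cell2 u = half2 (cprev u) `|` half1 u.
Proof. by case: u => T i; rewrite /half2 cprev_next. Qed.

End MeshGeometry.

(** * Sums over equivalence classes and over the nodes of an element *)

(** Each term is spread evenly over its class; after exchanging the sums the class constants factor
    out. No representatives have to be chosen. *)
Lemma sum_class_eq0 (R : numFieldType) (I : finType) (r : rel I) (s F : I -> R) :
  equivalence_rel r -> (forall i j, r i j -> s i = s j) ->
  (forall i, \sum_(j | r i j) F j = 0) -> \sum_i s i * F i = 0.
Proof.
move=> eqr sr F0.
have rr i : r i i by have [] := eqr i i i.
have rsym i j : r i j = r j i.
  apply/idP/idP => h; [have [_ /(_ h) e] := eqr i j i|have [_ /(_ h) e] := eqr j i j];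
  by move: e; rewrite rr.
pose N i : R := #|[pred j | r i j]|%:R.
have N0 i : N i != 0.
  by rewrite pnatr_eq0 -lt0n; apply/card_gt0P; exists i; rewrite inE.
have Nr i j : r i j -> N i = N j.
  move=> rij; congr _%:R; apply: eq_card => l; rewrite !inE.
  by have [_ ->] := eqr i j l.
transitivity (\sum_i \sum_(j | r i j) s i / N i * F i).
  apply: eq_bigr => i _; rewrite sumr_const -[RHS]mulr_natl mulrA; congr (_ * _).
  rewrite -[X in X%:R]/(#|[pred j | r i j]|) -/(N i).
  by rewrite mulrCA mulfV// mulr1.
rewrite (exchange_big_dep xpredT)//= big1// => j _.
transitivity (\sum_(i | r j i) s j / N j * F i); last by rewrite -mulr_sumr F0 mulr0.
apply: eq_big => i; first by rewrite rsym.
by move=> rij; rewrite (sr _ _ rij) (Nr _ _ rij).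
Qed.

Lemma sum_Tri3 (V : nmodType) (F : 'I_(nnodes Tri3) -> V) i :
  \sum_j F j = F i + F (ordS i) + F (ordS (ordS i)).
Proof.
pose g n := nth 0 [seq F j | j <- enum 'I_3] n.
have FE j : F j = g j by rewrite /g (nth_map j) ?nth_ord_enum ?size_enum_ord.
rewrite (eq_bigr (fun j => g (val j))) => [|j _]; last exact: FE.
rewrite !FE -(big_mkord xpredT g)/= !big_nat_recr//= big_nil add0r.
case: i => -[|[|[|]]]// ? /=; rewrite ?(erefl : (1 %% 3 = 1)%N) ?(erefl : (2 %% 3 = 2)%N)
  ?(erefl : (3 %% 3 = 0)%N)//.
- by rewrite [RHS]addrC addrA.
- by rewrite -[RHS]addrA [RHS]addrC.
Qed.

Lemma sum_Quad4 (V : nmodType) (F : 'I_(nnodes Quad4) -> V) i :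
  \sum_j F j = F i + F (ordS i) + F (ordS (ordS i)) + F (ordS (ordS (ordS i))).
Proof.
pose g n := nth 0 [seq F j | j <- enum 'I_4] n.
have FE j : F j = g j by rewrite /g (nth_map j) ?nth_ord_enum ?size_enum_ord.
rewrite (eq_bigr (fun j => g (val j))) => [|j _]; last exact: FE.
rewrite !FE -(big_mkord xpredT g)/= !big_nat_recr//= big_nil add0r.
case: i => -[|[|[|[|]]]]// ? /=; rewrite ?(erefl : (1 %% 4 = 1)%N) ?(erefl : (2 %% 4 = 2)%N)
  ?(erefl : (3 %% 4 = 3)%N) ?(erefl : (4 %% 4 = 0)%N)//.
- by rewrite [RHS]addrC !addrA.
- by rewrite -[RHS]addrA [RHS]addrC !addrA.
- by rewrite -2![RHS]addrA [RHS]addrC !addrA.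
Qed.

(** * Algebra of the strain of an affine displacement *)

Section StrainAlgebra.
Context {R : realType}.
Implicit Types (a b p r : plane R).

(* The gradient of the affine function with value [0] at the origin and values [p], [r]
   at [a], [b] is [(p, r) (a, b)^-1]; multiplying by [cross a b] removes the denominator. *)
Definition strainx a b p r : R := p.1 * b.2 - r.1 * a.2.
Definition strainy a b p r : R := r.2 * a.1 - p.2 * b.1.
Definition strainxy a b p r : R := r.1 * a.1 - p.1 * b.1 + (p.2 * b.2 - r.2 * a.2).
Definition strain a b p r : 'cV[R]_3 :=
  \col_(i < 3) [:: strainx a b p r; strainy a b p r; strainxy a b p r]`_i.

Lemma strain_eq0 a b p r : strain a b p r = 0 ->
  [/\ strainx a b p r = 0, strainy a b p r = 0 & strainxy a b p r = 0].
Proof.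
move=> e; split.
- by have /matrixP/(_ ord0 ord0) := e; rewrite !mxE.
- by have /matrixP/(_ (Ordinal (erefl : 1 < 3)%N) ord0) := e; rewrite !mxE.
- by have /matrixP/(_ (Ordinal (erefl : 2 < 3)%N) ord0) := e; rewrite !mxE.
Qed.

Definition rot2 a : plane R := (- a.2, a.1).

Lemma strain_rot2 (w : R) a b : strain a b (w *: rot2 a) (w *: rot2 b) = 0.
Proof.
apply/matrixP => i j; rewrite !mxE; case: i => -[|[|[|]]]//= ?;
rewrite /strainx /strainy /strainxy/= /GRing.scale/=; ring.
Qed.

(** A gradient with zero symmetric part is a multiple of the quarter turn. Translations are absent
    because the affine map vanishes at the origin. *)
Lemma strain0_rot2 a b p r : 0 < cross a b -> strain a b p r = 0 ->
  exists w : R, p = w *: rot2 a /\ r = w *: rot2 b.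
Proof.
move=> D0 /strain_eq0[]; rewrite /strainx /strainy /strainxy => e1 e2 e3.
have D1 : cross a b != 0 by rewrite gt_eqF.
rewrite /cross in D1.
(* The rate of rotation is the x-derivative of the second component. *)
exists ((p.2 * b.2 - r.2 * a.2) / cross a b); rewrite /cross.
split; apply/eqP; rewrite -pair_eqE /pair_eq/= /GRing.scale/=; apply/andP; split;
  apply/eqP; apply: (mulIf D1); rewrite ?mulrN mulrAC ?mulNr mulfVK//.
- apply/eqP; rewrite -subr_eq0; apply/eqP.
  by transitivity (a.1 * (p.1 * b.2 - r.1 * a.2) +
    a.2 * (r.1 * a.1 - p.1 * b.1 + (p.2 * b.2 - r.2 * a.2))); [ring|rewrite e1 e3; ring].
- apply/eqP; rewrite -subr_eq0; apply/eqP.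
  by transitivity (a.2 * (r.2 * a.1 - p.2 * b.1)); [ring|rewrite e2; ring].
- apply/eqP; rewrite -subr_eq0; apply/eqP.
  by transitivity (b.1 * (p.1 * b.2 - r.1 * a.2) +
    b.2 * (r.1 * a.1 - p.1 * b.1 + (p.2 * b.2 - r.2 * a.2))); [ring|rewrite e1 e3; ring].
- apply/eqP; rewrite -subr_eq0; apply/eqP.
  by transitivity (b.2 * (r.2 * a.1 - p.2 * b.1)); [ring|rewrite e2; ring].
Qed.

(** Read as a quadratic form, the strain evaluated on the edge vector is the elongation of the edge.
    The latter depends only on the end points, hence is the same seen from both sides. *)
Lemma strain_stretch a b p r (d : plane R) : d = b - a ->
  d.1 ^+ 2 * strainx a b p r + d.2 ^+ 2 * strainy a b p r + d.1 * d.2 * strainxy a b p r =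
  cross a b * dot2 (r - p) d.
Proof. by move=> ->; rewrite /strainx /strainy /strainxy /cross /dot2/=; ring. Qed.

(** Up to sign, every component is made of terms [p b - r a] in coordinates. Their alternating sum
    around the cycle is [(p0 + p2) (a1 + a3) - (p1 + p3) (a0 + a2)], and the zero sums make the two
    products equal. *)
Lemma strain4_alternating a0 a1 a2 a3 p0 p1 p2 p3 :
  a0 + a1 + a2 + a3 = 0 -> p0 + p1 + p2 + p3 = 0 ->
  strain a0 a1 p0 p1 - strain a1 a2 p1 p2 + strain a2 a3 p2 p3 - strain a3 a0 p3 p0 = 0.
Proof.
move=> /eqP; rewrite addrC addr_eq0 => /eqP -> /eqP; rewrite addrC addr_eq0 => /eqP ->.
apply/matrixP => i j; rewrite !mxE; case: i => -[|[|[|]]]//= ?;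
rewrite /strainx /strainy /strainxy/=; ring.
Qed.

Lemma dot2_cross_eq0 a b (n : plane R) : 0 < cross a b -> dot2 n a = 0 -> dot2 n b = 0 -> n = 0.
Proof.
rewrite /cross /dot2 => D0 e1 e2; have D1 := gt_eqF D0; apply/eqP; rewrite -pair_eqE /pair_eq/=.
have : (a.1 * b.2 - a.2 * b.1) * n.1 = 0.
  transitivity (b.2 * (n.1 * a.1 + n.2 * a.2) - a.2 * (n.1 * b.1 + n.2 * b.2)); first ring.
  by rewrite e1 e2; ring.
have : (a.1 * b.2 - a.2 * b.1) * n.2 = 0.
  transitivity (a.1 * (n.1 * b.1 + n.2 * b.2) - b.1 * (n.1 * a.1 + n.2 * a.2)); first ring.
  by rewrite e1 e2; ring.
move=> /eqP; rewrite mulf_eq0 D1/= => n2 /eqP; rewrite mulf_eq0 D1/= => n1.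
by apply/andP.
Qed.

(* After removing the rigid motion of the triangle [0, a0, a1], the displacements
   [n] and [- n] of the two other vertices are orthogonal to three sides of the
   quadrilateral. *)
Lemma rigid4 a0 a1 a2 a3 p0 p1 p2 p3 :
  a0 + a1 + a2 + a3 = 0 -> p0 + p1 + p2 + p3 = 0 -> 0 < cross a0 a1 ->
  dot2 (p2 - p1) (a2 - a1) = 0 -> dot2 (p3 - p2) (a3 - a2) = 0 ->
  dot2 (p0 - p3) (a0 - a3) = 0 -> strain a0 a1 p0 p1 = 0 ->
  exists w : R, [/\ p0 = w *: rot2 a0, p1 = w *: rot2 a1, p2 = w *: rot2 a2 & p3 = w *: rot2 a3].
Proof.
move=> a_sum p_sum D0 w1 w2 w3 s0.
have [w [e0 e1]] := strain0_rot2 D0 s0.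
exists w; pose n := p2 - w *: rot2 a2.
have e2 : p2 = n + w *: rot2 a2 by rewrite subrK.
have a3E : a3 = - (a0 + a1 + a2) by apply/eqP; rewrite -addr_eq0 addrC a_sum.
have e3 : p3 = - n + w *: rot2 a3.
  have -> : p3 = - (p0 + p1 + p2) by apply/eqP; rewrite -addr_eq0 addrC p_sum.
  rewrite e0 e1 e2 a3E; apply/eqP; rewrite -pair_eqE /pair_eq/= /GRing.scale/=.
  by apply/andP; split; apply/eqP; ring.
have n1 : dot2 n (a2 - a1) = 0.
  rewrite -w1 e1 e2 /dot2/= /GRing.scale/=; ring.
have n2 : dot2 n (a3 - a2) = 0.
  apply: (@mulfI _ (-2)); first by rewrite oppr_eq0 pnatr_eq0.
  rewrite mulr0 -w2 e3 e2 /dot2/= /GRing.scale/=; ring.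
have n3 : dot2 n (a0 - a3) = 0.
  rewrite -w3 e3 e0 /dot2/= /GRing.scale/=; ring.
have : n = 0.
  apply: (dot2_cross_eq0 D0); move: n1 n2 n3; rewrite a3E /dot2/=; lra.
by move=> n0; rewrite e2 e3 n0 oppr0 !add0r.
Qed.

End StrainAlgebra.

(** * Cycles of three or four nodes *)

Lemma ordS3 (i : 'I_(nnodes Tri3)) : ordS (ordS (ordS i)) = i.
Proof. by apply: val_inj; case: i => -[|[|[|]]]. Qed.

Lemma ordS4_cycle k (ek : k = Quad4) (i : 'I_(nnodes k)) : ordS (ordS (ordS (ordS i))) = i.
Proof. by move: i; rewrite ek => i; rewrite ordS4. Qed.

Lemma sum_cycle4 k (V : nmodType) (F : 'I_(nnodes k) -> V) i (ek : k = Quad4) :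
  \sum_j F j = F i + F (ordS i) + F (ordS (ordS i)) + F (ordS (ordS (ordS i))).
Proof. by move: F i; rewrite ek => F i; rewrite (sum_Quad4 _ i). Qed.

(** One formula covers both elements: on an odd cycle an alternating [h] is zero, and so are both
    sides. *)
Lemma alternating_cycle (R : realFieldType) k (h e : 'I_(nnodes k) -> R) i :
  (forall j, h (ordS j) = - h j) ->
  (k = Quad4 -> e i - e (ordS i) + e (ordS (ordS i)) - e (ordS (ordS (ordS i))) = 0) ->
  \sum_j Num.sg (h j) * (e j - h j) = - ((nnodes k)%:R * `|h i|).
Proof.
case: k h e i => h e i hS.
  move=> _; have h0 j : h j = 0 by have := ordS3 j => /(congr1 h); rewrite !hS; lra.
  by rewrite h0 normr0 mulr0 oppr0 big1// => j _; rewrite h0 sgr0 mul0r.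
move=> /(_ erefl) e0; rewrite (sum_Quad4 _ i) !hS !sgrN normrEsg/= !opprK.
transitivity (Num.sg (h i) * (e i - e (ordS i) + e (ordS (ordS i)) - e (ordS (ordS (ordS i))))
  - 4 * (Num.sg (h i) * h i)); first ring.
by rewrite e0; ring.
Qed.

(** On a triangle the zero sums carry the rotation over to the third node. On a quadrilateral they
    leave one displacement free, which the unstretched edges fix. *)
Lemma rigid_cycle {R : realType} k (p a : 'I_(nnodes k) -> plane R) i :
  (forall j, dot2 (p (ordS j) - p j) (a (ordS j) - a j) = 0) ->
  0 < cross (a i) (a (ordS i)) -> strain (a i) (a (ordS i)) (p i) (p (ordS i)) = 0 ->
  \sum_j p j = 0 -> \sum_j a j = 0 ->
  exists w : R, forall j, p j = w *: rot2 (a j).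
Proof.
case: k p a i => p a i st D0 s0.
  rewrite !(sum_Tri3 _ i) => p_sum a_sum.
  have [w [e0 e1]] := strain0_rot2 D0 s0; exists w => j.
  have e2 : p (ordS (ordS i)) = w *: rot2 (a (ordS (ordS i))).
    move/eqP: p_sum; rewrite addrC addr_eq0 => /eqP ->.
    move/eqP: a_sum; rewrite addrC addr_eq0 => /eqP ->.
    rewrite e0 e1; apply/eqP; rewrite -pair_eqE /pair_eq/= /GRing.scale/=.
    by apply/andP; split; apply/eqP; ring.
  have [<-//|ij] := eqVneq i j.
  have [->//|e|[]//] := ordS_cases ij.
  by move: e2; rewrite e ordS3.
rewrite !(sum_Quad4 _ i) => p_sum a_sum.
have s3 := st (ordS (ordS (ordS i))); rewrite ordS4 in s3.
have [w [e0 e1 e2 e3]] := rigid4 a_sum p_sum D0 (st _) (st _) s3 s0.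
exists w => j.
have [<-//|ij] := eqVneq i j.
have [->//|e|[_ ->]//] := ordS_cases ij.
by move: e3; rewrite e ordS4.
Qed.

(** * Injectivity of the smoothed strain, in terms of nodal values *)

Section Injectivity.
Context {R : realType} {k : elt_kind} (M : mesh R k) (u : plane R -> plane R).
Hypothesis hP : proper_elts M.
Hypothesis hC : conforming M.
Hypothesis ucenter : forall T : 'I_(nelts M),
  u (center T) = (nnodes k)%:R^-1 *: \sum_i u (node T i).
Implicit Types (q : corner M) (T : 'I_(nelts M)).

Definition lpos T i : plane R := node T i - center T.
Definition lval T i : plane R := u (node T i) - u (center T).
(** For [u] affine on the subtriangle this is its strain times [ccross q], so that integrals over
    subtriangles are proportional to it without denominators. *)
Definition cstrain q : 'cV[R]_3 :=
  strain (lpos q.1 q.2) (lpos q.1 (ordS q.2)) (lval q.1 q.2) (lval q.1 (ordS q.2)).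

Lemma sum_lpos T : \sum_i lpos T i = 0.
Proof. exact: sum_node_center. Qed.

Lemma sum_lval T : \sum_i lval T i = 0.
Proof.
rewrite big_split/= sumrN sumr_const card_ord ucenter -scaler_nat scalerA mulfV ?scale1r ?subrr//.
by rewrite pnatr_eq0; case: k.
Qed.

Definition same_edge : rel (corner M) := fun q q' => `[< cedge q = cedge q' >].

Lemma same_edge_equiv : equivalence_rel same_edge.
Proof.
move=> q q' q''; split; first by apply/asboolP.
by move=> /asboolP e; rewrite /same_edge e.
Qed.

Lemma same_edgexx q : same_edge q q.
Proof. exact/asboolP. Qed.

Lemma same_edge_sym q q' : same_edge q q' = same_edge q' q.
Proof. by apply/asboolP/asboolP => ->. Qed.

(** All subtriangles at an edge see the same elongation, since edge vector and relative displacement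
    change sign together. The sum of the strains, evaluated on the edge vector, is therefore this
    elongation times a positive sum of [ccross]. *)
Lemma stretch_eq0 : (forall q, \sum_(q' | same_edge q q') cstrain q' = 0) ->
  forall T i, dot2 (lval T (ordS i) - lval T i) (lpos T (ordS i) - lpos T i) = 0.
Proof.
move=> E0 T i.
pose d q := lpos q.1 (ordS q.2) - lpos q.1 q.2.
pose w q := lval q.1 (ordS q.2) - lval q.1 q.2.
have dE q : d q = cnext q - cnode q.
  by rewrite /d /lpos opprB addrA subrK.
have wE q : w q = u (cnext q) - u (cnode q).
  by rewrite /w /lval opprB addrA subrK.
have dw q q' : same_edge q q' -> (d q' = d q /\ w q' = w q) \/ (d q' = - d q /\ w q' = - w q).
  move=> /asboolP qq'; have [->|nqq'] := eqVneq q q'; first by left.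
  by have [e1 e2] := cedge_cases hP hC qq' nqq'; right; rewrite !dE !wE e1 e2 !opprB.
pose q0 : corner M := (T, i).
pose Q (e : 'cV[R]_3) := (d q0).1 ^+ 2 * e ord0 ord0 + (d q0).2 ^+ 2 * e (Ordinal (erefl : 1 < 3)%N) ord0
  + (d q0).1 * (d q0).2 * e (Ordinal (erefl : 2 < 3)%N) ord0.
have QE q : same_edge q0 q -> Q (cstrain q) = ccross q * dot2 (w q0) (d q0).
  move=> /dw qq.
  transitivity (ccross q * dot2 (w q) (d q)); last first.
    by case: qq => -[-> ->] //; rewrite /dot2/=; congr (_ * _); ring.
  have {}qq : d q0 = d q \/ d q0 = - d q.
    by case: qq => -[-> _]; [left|right; rewrite opprK].
  rewrite -[RHS]/(cross (lpos q.1 q.2) (lpos q.1 (ordS q.2)) * dot2 (w q) (d q)).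
  rewrite -strain_stretch// /Q; move: (d q0) qq => v qq; rewrite /cstrain !mxE/=.
  by case: qq => ->; rewrite /d//= !sqrrN mulrNN.
have : \sum_(q | same_edge q0 q) Q (cstrain q) = Q (\sum_(q | same_edge q0 q) cstrain q).
  by rewrite /Q !summxE !mulr_sumr -!big_split.
rewrite E0 (eq_bigr _ QE) -mulr_suml /Q !mxE !mulr0 !addr0 => /eqP.
rewrite mulf_eq0 => /orP[|/eqP//].
rewrite gt_eqF// (bigD1 q0) ?same_edgexx//= ltr_pwDl ?ccross_gt0//.
by apply: sumr_ge0 => q _; exact/ltW/ccross_gt0.
Qed.

Lemma cstrain_rigid T i : (forall q, \sum_(q' | same_edge q q') cstrain q' = 0) ->
  cstrain (T, i) = 0 -> forall j, cstrain (T, j) = 0.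
Proof.
move=> E0 Ti.
have [w wP] := rigid_cycle (stretch_eq0 E0 T) (hP T i) Ti (sum_lval T) (sum_lpos T).
by move=> j; rewrite /cstrain/= !wP strain_rot2.
Qed.

(** Shoelace formula: moving the origin to the center adds a telescoping sum, after which every term
    is positive. *)
Lemma sum_edge_cross T : 0 < \sum_i cross (node T i) (node T (ordS i)).
Proof.
have -> : \sum_i cross (node T i) (node T (ordS i)) =
    \sum_i cross (lpos T i) (lpos T (ordS i)).
  pose l i := cross (center T) (lpos T i).
  transitivity (\sum_i (cross (lpos T i) (lpos T (ordS i)) + (l (ordS i) - l i))).
    by apply: eq_bigr => i _; rewrite /l /lpos /cross/=; ring.
  have l0 : \sum_i (l (ordS i) - l i) = 0.
    by apply/eqP; rewrite sumrB subr_eq0 [eqbRHS](reindex_inj (can_inj (@ordSK _))).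
  by rewrite big_split/= l0 addr0.
have i0 : 'I_(nnodes k) by case: k; exact: ord0.
rewrite (bigD1 i0)//= ltr_pwDl//; first exact: hP.
by apply: sumr_ge0 => i _; exact/ltW/hP.
Qed.

(* If some strains did not vanish, the elements carrying them would be glued in pairs
   along all their edges, with opposite orientations, so that their total signed area
   computed from the boundary would be zero. *)
Lemma cstrain_eq0 : (forall q, \sum_(q' | same_edge q q') cstrain q' = 0) ->
  forall q, cstrain q = 0.
Proof.
move=> E0 q0; apply/eqP; apply: contraT => nq0.
pose S := [pred q : corner M | cstrain q != 0].
have ST q j : q \in S -> (q.1, j) \in S.
  rewrite !inE; apply: contra => /eqP e.
  by rewrite [q]surjective_pairing; apply/eqP; exact: (cstrain_rigid E0 e).
pose s q := cross (cnode q) (cnext q).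
have pos : 0 < \sum_(q in S) s q.
  have -> : \sum_(q in S) s q = \sum_(T | cstrain (T, q0.2) != 0) \sum_i s (T, i).
    rewrite pair_big_dep/=; apply: eq_big => -[T i]//=.
    by rewrite andbT; apply/idP/idP => h; [exact: (ST (T, i) q0.2 h)|exact: (ST (T, q0.2) i h)].
  rewrite (bigD1 q0.1)/=; last by move: nq0; rewrite -surjective_pairing.
  rewrite ltr_pwDl//; first exact: sum_edge_cross.
  by apply: sumr_ge0 => T _; apply/ltW/sum_edge_cross.
pose r q q' := same_edge q q' && (q != q').
have rsym q q' : r q q' = r q' q by rewrite /r same_edge_sym eq_sym.
have rS q : q \in S -> exists q', [/\ q' \in S, r q q' & forall q'', r q q'' -> q'' = q'].
  move=> qS.
  have [q' /andP[q'S rq]] : exists q', (q' \in S) && r q q'.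
    apply/existsP; apply: contraT; rewrite negb_exists => /forallP h.
    move: qS; rewrite inE -(E0 q) (bigD1 q) ?same_edgexx//= big1 ?addr0 ?eqxx//.
    move=> q' /andP[e n]; apply/eqP; apply: contraT => nz.
    have := h q'; rewrite /r e [q == q']eq_sym n andbT => /negP h'.
    by exfalso; apply: h'; rewrite andbT inE.
  exists q'; split => // q'' /andP[/asboolP e n].
  move: rq => /andP[/asboolP e' n'].
  exact: (cedge_at_most_two hP hC e e' n n').
have : \sum_(q in S) s q = - \sum_(q in S) s q.
  transitivity (\sum_(q in S) \sum_(q' in S | r q q') - s q').
    apply: eq_bigr => q qS; have [q' [q'S rq uq]] := rS q qS.
    rewrite (bigD1 q')/= ?q'S// big1 ?addr0.
      by move: rq => /andP[/asboolP e n]; have [e1 e2] := cedge_cases hP hC e n;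
        rewrite /s e1 e2 cross_swap.
    by move=> q'' /andP[/andP[_ /uq ->]]; rewrite eqxx.
  rewrite (exchange_big_dep (mem S))/=; last by move=> q q' _ /andP[].
  rewrite -sumrN; apply: eq_bigr => q' q'S.
  have [q [qS rq uq]] := rS q' q'S.
  rewrite (bigD1 q)/=; last by rewrite qS q'S rsym rq.
  rewrite big1 ?addr0//.
  by move=> q'' /andP[/andP[_ /andP[_]]]; rewrite rsym => /uq ->; rewrite eqxx.
lra.
Qed.

(* Componentwise, [h := ccross * G] alternates in sign around each element, hence vanishes
   on triangles.  On quadrilaterals the alternating sum of the exact strains [e] vanishes,
   so that the sum of [sg h * (e - h)] over an element is [- 4 |h|]; but the sum over all
   corners is zero, as [sg h = sg G] depends only on the edge. *)
Lemma smoothed_strain_eq0 (G : corner M -> 'cV[R]_3) :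
  (forall q q', same_edge q q' -> G q = G q') ->
  (forall q, \sum_(q' | same_edge q q') ccross q' *: G q' =
             \sum_(q' | same_edge q q') cstrain q') ->
  (forall q, ccross (cprev q) *: G (cprev q) + ccross q *: G q = 0) ->
  forall q, cstrain q = 0.
Proof.
move=> Gr GE G0; apply: cstrain_eq0 => q; rewrite -GE big1// => {q} q _.
apply/matrixP => c j; rewrite !mxE {j}[j]ord1.
pose h q := ccross q * G q c ord0.
pose e q := cstrain q c ord0.
have hS T i : h (T, ordS i) = - h (T, i).
  apply/eqP; rewrite -addr_eq0 addrC; have /matrixP/(_ c ord0) := G0 (T, ordS i).
  by rewrite !mxE /cprev/= ordSK => ->.
rewrite -/(h q).
have F0 q' : \sum_(q'' | same_edge q' q'') (e q'' - h q'') = 0.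
  rewrite sumrB; have /matrixP/(_ c ord0) := GE q'.
  rewrite !summxE => E; apply/eqP; rewrite subr_eq0 -E; apply/eqP.
  by apply: eq_bigr => q'' _; rewrite mxE.
have sh q' : Num.sg (G q' c ord0) = Num.sg (h q').
  by rewrite /h sgrM (gtr0_sg (ccross_gt0 hP q')) mul1r.
have := sum_class_eq0 (s := fun q => Num.sg (G q c ord0)) same_edge_equiv _ F0.
move=> /(_ (fun q q' r => congr1 (fun x : 'cV[R]_3 => Num.sg (x c ord0)) (Gr q q' r))).
under eq_bigr do rewrite sh.
rewrite (eq_bigr (fun q => Num.sg (h (q.1, q.2)) * (e (q.1, q.2) - h (q.1, q.2)))) => [|[]//].
rewrite -(pair_big xpredT xpredT (fun T i => Num.sg (h (T, i)) * (e (T, i) - h (T, i))))/=.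
rewrite (eq_bigr (fun T => - ((nnodes k)%:R * `|h (T, q.2)|))) => [|T _]; last first.
  apply: (@alternating_cycle _ k (fun i => h (T, i)) (fun i => e (T, i))) => [i|ek]; first exact: hS.
  have := sum_lpos T; have := sum_lval T.
  rewrite !(sum_cycle4 _ q.2 ek) => p_sum a_sum.
  have /matrixP/(_ c ord0) := strain4_alternating a_sum p_sum.
  have S4 : ordS (ordS (ordS (ordS q.2))) = q.2 by rewrite (ordS4_cycle ek).
  by rewrite !mxE /e /cstrain/= S4 !mxE.
rewrite sumrN => /eqP; rewrite oppr_eq0 => /eqP /psumr_eq0P hz.
have /eqP : (nnodes k)%:R * `|h (q.1, q.2)| = 0 by apply: hz => // T _; rewrite mulr_ge0.
rewrite mulf_eq0 pnatr_eq0 normr_eq0 -surjective_pairing => /orP[|/eqP//].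
by case: k.
Qed.

End Injectivity.

(** * Almost everywhere statements and real integrals over plane sets *)

Section SquareIntegrable.
Context {R : realType}.
Implicit Types (A N : set (plane R)) (f g : plane R -> R).

Lemma ae_onW A (P : plane R -> Prop) : (forall x, A x -> P x) -> ae_on A P.
Proof. by move=> h; exact: (@aeW _ _ _ (@area R)). Qed.

Let areaF := @ae_filter_ringOfSetsType _ _ _ (@area R).

Lemma ae_on_map2 A (P Q S : plane R -> Prop) : ae_on A P -> ae_on A Q ->
  (forall x, A x -> P x -> Q x -> S x) -> ae_on A S.
Proof. by move=> hP hQ h; apply: (@filterS2 _ _ areaF _ _ _ _ hP hQ) => x p q Ax; auto. Qed.

Lemma ae_on_map A (P S : plane R -> Prop) : ae_on A P ->
  (forall x, A x -> P x -> S x) -> ae_on A S.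
Proof. by move=> hP h; apply: (@filterS _ _ areaF _ _ _ hP) => x p Ax; auto. Qed.

Lemma ae_on_subset A B (P : plane R -> Prop) : A `<=` B -> ae_on B P -> ae_on A P.
Proof. by move=> AB hP; apply: (@filterS _ _ areaF _ _ _ hP) => x p Ax; apply: p; exact: AB. Qed.

Lemma ae_on_negligible A N (P : plane R -> Prop) : (@area R).-negligible N ->
  (forall x, A x -> ~ N x -> P x) -> ae_on A P.
Proof.
move=> nN h; apply: area_negligibleS nN => x /=; apply: contra_notP => nN Ax; exact: h.
Qed.

Lemma ae_on_forall (I : finType) A (P : I -> plane R -> Prop) :
  (forall i, ae_on A (P i)) -> ae_on A (fun x => forall i, P i x).
Proof.
move=> h; have h' := @filter_forall _ _ _ _ areaF h.
by apply: (@filterS _ _ areaF _ _ _ h') => x hx Ax i; exact: hx.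
Qed.

Definition rintegrable A f := (@area R).-integrable A (EFin \o f).

Lemma rintegrableZ A (a : R) f : measurable A -> rintegrable A f ->
  rintegrable A (fun x => a * f x).
Proof.
move=> mA If.
rewrite /rintegrable (_ : _ \o _ = (fun x => a%:E * (EFin \o f) x)%E)//.
exact: integrableZl.
Qed.

Lemma rintegrable_lin A (a : R) f g : measurable A -> rintegrable A f -> rintegrable A g ->
  rintegrable A (fun x => a * f x + g x).
Proof.
move=> mA If Ig.
rewrite /rintegrable (_ : _ \o _ = (fun x => a%:E * (EFin \o f) x)%E \+ (EFin \o g))%E//.
by apply: integrableD => //; exact: integrableZl.
Qed.

Lemma int_on_lin A (a : R) f g : measurable A -> rintegrable A f -> rintegrable A g ->
  int_on A (fun x => a * f x + g x) = a * int_on A f + int_on A g.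
Proof.
move=> mA If Ig; rewrite /int_on RintegralD//; first by rewrite RintegralZl.
exact: rintegrableZ.
Qed.

Lemma int_onZ A (a : R) f : measurable A -> rintegrable A f ->
  int_on A (fun x => a * f x) = a * int_on A f.
Proof. by move=> mA If; rewrite /int_on RintegralZl. Qed.

Lemma int_on0 A : int_on A (fun=> 0) = 0.
Proof. by rewrite /int_on /Rintegral integral0_eq. Qed.

Lemma rintegrable_sum A (I : finType) (f : I -> plane R -> R) : measurable A ->
  (forall i, rintegrable A (f i)) -> rintegrable A (fun x => \sum_i f i x).
Proof.
move=> mA If; rewrite /rintegrable.
rewrite (_ : _ \o _ = (fun x => \sum_(i <- index_enum I) (EFin \o f i) x)%E); last first.
  by apply/funext => x; rewrite /= sumEFin.
by apply: integrable_sum => // i _; exact: If.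
Qed.

Lemma int_on_sum A (I : finType) (f : I -> plane R -> R) : measurable A ->
  (forall i, rintegrable A (f i)) ->
  int_on A (fun x => \sum_i f i x) = \sum_i int_on A (f i).
Proof.
move=> mA If; rewrite !unlock /=; elim: (index_enum I) => [|i s IH] /=.
  exact: int_on0.
rewrite -IH -[int_on A (f i)]mul1r -int_on_lin//.
  by congr int_on; apply/funext => x; rewrite mul1r.
rewrite (_ : (fun _ => _) = (fun x => \sum_(j <- s) f j x)); last by apply/funext => x; rewrite unlock.
rewrite /rintegrable (_ : _ \o _ = (fun x => \sum_(i <- s) (EFin \o f i) x)%E); last first.
  by apply/funext => x; rewrite /= sumEFin.
by apply: integrable_sum => // j _; exact: If.
Qed.

Lemma rintegrable_subset A B f : measurable A -> measurable B -> B `<=` A ->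
  rintegrable A f -> rintegrable B f.
Proof. by move=> mA mB BA; exact: integrableS. Qed.

Lemma int_on_le A f g : measurable A -> rintegrable A f -> rintegrable A g ->
  (forall x, A x -> f x <= g x) -> int_on A f <= int_on A g.
Proof. by move=> mA If Ig fg; apply: le_Rintegral. Qed.

Lemma int_on_ge0 A f : (forall x, A x -> 0 <= f x) -> 0 <= int_on A f.
Proof. by move=> f0; apply: Rintegral_ge0. Qed.

Lemma rintegrable_measurable A f : rintegrable A f -> measurable_fun A f.
Proof. by move=> If; apply/measurable_EFinP; exact: measurable_int If. Qed.

Lemma rintegrable_dominated A f g : measurable A -> measurable_fun A f -> rintegrable A g ->
  (forall x, A x -> `|f x| <= g x) -> rintegrable A f.
Proof.
move=> mA mf Ig fg; move: Ig; apply: le_integrable => //; first exact/measurable_EFinP.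
by move=> x Ax /=; rewrite lee_fin (le_trans (fg x Ax))// ler_norm.
Qed.

Lemma rintegrable_norm A f : rintegrable A f -> rintegrable A (fun x => `|f x|).
Proof. by move=> If; apply: integrable_norm. Qed.

Lemma int_on_ae A f g : measurable A -> measurable_fun A f -> measurable_fun A g ->
  ae_on A (fun x => f x = g x) -> int_on A f = int_on A g.
Proof.
move=> mA mf mg fg; rewrite /int_on /Rintegral; congr fine.
apply: ae_eq_integral => //; try exact/measurable_EFinP.
have h : ae_on A (fun x => (f x)%:E = (g x)%:E) by refine (ae_on_map fg _) => x Ax ->.
exact: h.
Qed.

Lemma int_on_eq0 A f : measurable A -> rintegrable A f -> (forall x, A x -> 0 <= f x) ->
  int_on A f = 0 -> ae_on A (fun x => f x = 0).
Proof.
move=> mA If f0 i0.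
have mf := rintegrable_measurable If.
have /(ae_eq_integral_abs (@area R) mA) : measurable_fun A (EFin \o f) by exact/measurable_EFinP.
case=> + _ => h.
have : (\int[@area R]_(x in A) `|(EFin \o f) x|)%E = 0%E.
  rewrite -(fineK (_ : (\int[@area R]_(x in A) `|(EFin \o f) x|)%E \is a fin_num)).
    congr EFin; rewrite -[RHS]i0 /int_on /Rintegral; congr fine.
    by apply: eq_integral => x /set_mem Ax /=; rewrite ger0_norm ?f0.
  rewrite ge0_fin_numE; last by apply: integral_ge0.
  by have /integrableP[] := If.
move=> /h {}h; have {}h : ae_on A (fun x => (f x)%:E = 0%:E) by exact: h.
by refine (ae_on_map h _) => x Ax [].
Qed.

End SquareIntegrable.

(** * Square integrable fields and their inner product *)

Section L2Space.
Context {R : realType} (Om : set (plane R)).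
Hypothesis mOm : measurable Om.
Hypothesis finOm : (area Om < +oo)%E.
Implicit Types (f g : plane R -> R) (e s : plane R -> 'cV[R]_3).

Lemma rintegrable_cst (c : R) : rintegrable Om (fun=> c).
Proof.
rewrite /rintegrable (_ : _ \o _ = cst c%:E)//.
apply/integrableP; split; first exact: measurable_cst.
by rewrite integral_cst//= lte_mul_pinfty// ?lee_fin.
Qed.

Lemma rintegrable_bounded f (c : R) : measurable_fun Om f -> (forall x, Om x -> `|f x| <= c) ->
  rintegrable Om f.
Proof. by move=> mf fc; exact: rintegrable_dominated (rintegrable_cst c) fc. Qed.

Lemma L2_mul f g : L2 Om f -> L2 Om g -> rintegrable Om (fun x => f x * g x).
Proof.
move=> [mf If] [mg Ig].
have I : rintegrable Om (fun x => 1 * f x ^+ 2 + g x ^+ 2) by exact: rintegrable_lin.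
apply: (rintegrable_dominated mOm _ I); first exact: measurable_funM.
move=> x _; rewrite normrM mul1r -[f x ^+ 2]real_normK ?num_real// -[g x ^+ 2]real_normK ?num_real//.
have := sqr_ge0 (`|f x| - `|g x|); rewrite sqrrB.
have := mulr_ge0 (normr_ge0 (f x)) (normr_ge0 (g x)); lra.
Qed.

Lemma L2_cst (c : R) : L2 Om (fun=> c).
Proof. by split; [exact: measurable_cst|exact: rintegrable_cst]. Qed.

Lemma L2_integrable f : L2 Om f -> rintegrable Om f.
Proof.
move=> L2f; have := L2_mul L2f (L2_cst 1).
by congr rintegrable; apply/funext => x; rewrite mulr1.
Qed.

Lemma L2_lin (a : R) f g : L2 Om f -> L2 Om g -> L2 Om (fun x => a * f x + g x).
Proof.
move=> L2f L2g; split.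
  by apply: measurable_funD; [apply: measurable_funM; [exact: measurable_cst|case: L2f]|case: L2g].
have I1 := L2_mul L2f L2f; have I2 := L2_mul L2f L2g; have I3 := L2_mul L2g L2g.
have := rintegrable_lin (a ^+ 2) mOm I1 (rintegrable_lin (2 * a) mOm I2 I3).
by congr (integrable _ _ (EFin \o _)); apply/funext => x; ring.
Qed.

Lemma L2_bounded f (c : R) : measurable_fun Om f -> (forall x, Om x -> `|f x| <= c) -> L2 Om f.
Proof.
move=> mf fc; split => //; apply: (@rintegrable_bounded _ (c ^+ 2)); first exact: measurable_funX.
by move=> x Ox; rewrite normrX lerXn2r ?nnegrE ?fc// (le_trans _ (fc x Ox)).
Qed.

Definition ipW s e : R := int_on Om (fun x => dot3 (s x) (e x)).

Lemma dot3C (s e : 'cV[R]_3) : dot3 s e = dot3 e s.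
Proof. by apply: eq_bigr => i _; rewrite mulrC. Qed.

Lemma dot3_lin (a : R) (s s' e : 'cV[R]_3) : dot3 (a *: s + s') e = a * dot3 s e + dot3 s' e.
Proof.
rewrite /dot3 mulr_sumr -big_split/=; apply: eq_bigr => i _; rewrite !mxE; ring.
Qed.

Lemma dot3_ge0 (e : 'cV[R]_3) : 0 <= dot3 e e.
Proof. by apply: sumr_ge0 => i _; rewrite -expr2 sqr_ge0. Qed.

Lemma dot3_eq0 (e : 'cV[R]_3) : dot3 e e = 0 -> e = 0.
Proof.
move/psumr_eq0P => h; apply/matrixP => i j; rewrite mxE {j}[j]ord1.
have /eqP : e i ord0 * e i ord0 = 0 by apply: h => // k _; rewrite -expr2 sqr_ge0.
by rewrite mulf_eq0 orbb => /eqP.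
Qed.

Lemma dot3_mulmx (D : 'M[R]_3) (s e : 'cV[R]_3) : D^T = D -> dot3 (D *m s) e = dot3 s (D *m e).
Proof.
move=> Dsym; have dotE (a b : 'cV[R]_3) : dot3 a b = (a^T *m b) ord0 ord0.
  by rewrite mxE; apply: eq_bigr => i _; rewrite mxE.
by rewrite !dotE trmx_mul Dsym mulmxA.
Qed.

Lemma ipW_integrable s e : inW Om s -> inW Om e -> rintegrable Om (fun x => dot3 (s x) (e x)).
Proof. by move=> Ws We; apply: rintegrable_sum => // i; exact: L2_mul. Qed.

Lemma ipWC s e : ipW s e = ipW e s.
Proof. by congr int_on; apply/funext => x; rewrite dot3C. Qed.

Lemma ipW_linl (a : R) s s' e : inW Om s -> inW Om s' -> inW Om e ->
  ipW (fun x => a *: s x + s' x) e = a * ipW s e + ipW s' e.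
Proof.
move=> Ws Ws' We; rewrite /ipW -int_on_lin; [|by []|exact: ipW_integrable|exact: ipW_integrable].
by congr int_on; apply/funext => x; rewrite dot3_lin.
Qed.

Lemma ipW_linr (a : R) s e e' : inW Om s -> inW Om e -> inW Om e' ->
  ipW s (fun x => a *: e x + e' x) = a * ipW s e + ipW s e'.
Proof. by move=> *; rewrite ipWC ipW_linl// ipWC [ipW e' s]ipWC. Qed.

Lemma ipWB s e e' : inW Om s -> inW Om e -> inW Om e' ->
  ipW s (fun x => e x - e' x) = ipW s e - ipW s e'.
Proof.
move=> Ws We We'; have := ipW_linr (-1) Ws We' We.
rewrite mulN1r addrC => <-; congr ipW; apply/funext => x.
by rewrite scaleN1r addrC.
Qed.

Lemma ipWBl s s' e : inW Om s -> inW Om s' -> inW Om e ->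
  ipW (fun x => s x - s' x) e = ipW s e - ipW s' e.
Proof. by move=> *; rewrite ipWC ipWB// ![ipW e _]ipWC. Qed.

Lemma ipW_ae s e s' e' : inW Om s -> inW Om e -> inW Om s' -> inW Om e' ->
  ae_on Om (fun x => s x = s' x) -> ae_on Om (fun x => e x = e' x) -> ipW s e = ipW s' e'.
Proof.
move=> Ws We Ws' We' hs he; apply: int_on_ae => //.
- exact: rintegrable_measurable (ipW_integrable Ws We).
- exact: rintegrable_measurable (ipW_integrable Ws' We').
- by refine (ae_on_map2 hs he _) => x _ -> ->.
Qed.

Lemma ipW_eq0 e : inW Om e -> ipW e e = 0 -> ae_on Om (fun x => e x = 0).
Proof.
move=> We /int_on_eq0 h.
have {}h := h mOm (ipW_integrable We We) (fun x _ => dot3_ge0 (e x)).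
by refine (ae_on_map h _) => x _ /dot3_eq0.
Qed.

Lemma inW_lin (a : R) s e : inW Om s -> inW Om e -> inW Om (fun x => a *: s x + e x).
Proof.
move=> Ws We i; have := L2_lin a (Ws i) (We i).
by congr L2; apply/funext => x; rewrite !mxE.
Qed.

Lemma inW0 : inW Om (fun=> 0).
Proof. by move=> i; have := L2_cst 0; congr L2; apply/funext => x; rewrite mxE. Qed.

Lemma inWB s e : inW Om s -> inW Om e -> inW Om (fun x => s x - e x).
Proof.
move=> Ws We; have := inW_lin (-1) We Ws.
by congr inW; apply/funext => x; rewrite scaleN1r addrC.
Qed.

Lemma inW_mulmx (D : 'M[R]_3) e : inW Om e -> inW Om (fun x => D *m e x).
Proof.
move=> We i.
have L2s (r : seq 'I_3) : L2 Om (fun x => \sum_(j <- r) D i j * e x j ord0).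
  elim: r => [|j r IH]; first by have := L2_cst 0; congr L2; apply/funext => x; rewrite big_nil.
  have := L2_lin (D i j) (We j) IH.
  by congr L2; apply/funext => x; rewrite big_cons.
by have := L2s (index_enum _); congr L2; apply/funext => x; rewrite mxE.
Qed.

End L2Space.

(** * Integrals over unions with null overlaps *)

Section NullSets.
Context {R : realType}.
Implicit Types (A B N : set (plane R)) (f : plane R -> R).

Lemma int_on_negligible A f : measurable A -> measurable_fun A f ->
  (@area R).-negligible A -> int_on A f = 0.
Proof.
move=> mA mf /(area_negligibleP mA) A0; rewrite /int_on /Rintegral null_set_integral//.
exact/measurable_EFinP.
Qed.

Lemma int_on_cst A (c : R) : measurable A -> int_on A (fun=> c) = c * fine (area A).
Proof. by move=> mA; rewrite /int_on Rintegral_cst. Qed.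

Lemma int_on_setU A B f : measurable A -> measurable B -> (@area R).-negligible (A `&` B) ->
  rintegrable (A `|` B) f -> int_on (A `|` B) f = int_on A f + int_on B f.
Proof.
move=> mA mB nAB If.
have mBA : measurable (B `\` A) by exact: measurableD.
have mABB : measurable (A `&` B) by exact: measurableI.
have mf : measurable_fun (A `|` B) f := rintegrable_measurable If.
have e1 : A `|` B = A `|` (B `\` A).
  apply/seteqP; split => x [Ax|Bx]; [by left| |by left|by right; case: Bx].
  by have [?|?] := pselect (A x); [left|right].
have e2 : B = (B `\` A) `|` (A `&` B).
  apply/seteqP; split => x; last by move=> [[]|[]].
  by move=> Bx; have [?|?] := pselect (A x); [right|left].
rewrite e1 /int_on Rintegral_setU//; last 2 first.
- by rewrite -e1.
- by apply/disj_setPS => x [Ax []].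
congr (_ + _); rewrite [in RHS]e2 Rintegral_setU//; last 2 first.
- by rewrite -e2; exact: (rintegrable_subset (measurableU _ _ mA mB) mB (@subsetUr _ A B) If).
- by apply/disj_setPS => x [[]] _ nA [].
rewrite -/(int_on (A `&` B) f) int_on_negligible// ?addr0//.
by apply: measurable_funS mf; [exact: measurableU|move=> x []; left].
Qed.

Lemma int_on_bigsetU (I : choiceType) (s : seq I) (A : I -> set (plane R)) f : uniq s ->
  (forall i, i \in s -> measurable (A i)) ->
  (forall i j, i \in s -> j \in s -> i != j -> (@area R).-negligible (A i `&` A j)) ->
  rintegrable (\big[setU/set0]_(i <- s) A i) f ->
  int_on (\big[setU/set0]_(i <- s) A i) f = \sum_(i <- s) int_on (A i) f.
Proof.
elim: s => [|i s IH] /=; first by rewrite !big_nil /int_on Rintegral_set0.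
move=> /andP[si us] mA nA; rewrite !big_cons => If.
have ms : measurable (\big[setU/set0]_(j <- s) A j).
  rewrite big_seq; apply: bigsetU_measurable => j js; apply: mA; by rewrite inE js orbT.
have mi : measurable (A i) by apply: mA; rewrite mem_head.
rewrite int_on_setU//; last first.
  have : (@area R).-negligible (\big[setU/set0]_(j <- s) (A i `&` A j)).
    rewrite big_seq; apply: (big_ind (fun B => (@area R).-negligible B)).
    - exact: negligible_set0.
    - by move=> B C; exact: area_negligibleU.
    - move=> j js; apply: nA; rewrite ?mem_head// ?inE ?js ?orbT//.
      by apply: contraNneq si => ->.
  apply: area_negligibleS => x [Aix].
  rewrite -!bigcup_seq => -[j js Ajx]; by exists j.
congr (_ + _); apply: IH => //.
- by move=> j js; apply: mA; rewrite inE js orbT.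
- by move=> j l js ls; apply: nA; rewrite inE ?js ?ls orbT.
- exact: (rintegrable_subset (measurableU _ _ mi ms) ms (@subsetUr _ _ _) If).
Qed.

Lemma area_ae_set A B : measurable A -> measurable B -> B `<=` A ->
  (@area R).-negligible (A `\` B) -> area A = area B.
Proof.
move=> mA mB BA nAB.
have mAB : measurable (A `\` B) by exact: measurableD.
have e : A = B `|` (A `\` B).
  apply/seteqP; split => x; last by move=> [/BA|[]].
  by move=> Bx; have [?|?] := pselect (B x); [left|right].
rewrite {1}e measureU//; last by rewrite setDE setICA setICr setI0.
have /(area_negligibleP mAB) A0 := nAB.
by transitivity (area B + 0)%E; [congr (_ + _)%E|rewrite adde0].
Qed.

End NullSets.

(** * Cell averages as orthogonal projections *)

Section Averaging.
Context {R : realType} (Om : set (plane R)).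
Hypothesis mOm : measurable Om.
Hypothesis finOm : (area Om < +oo)%E.
Context {k : elt_kind} (M : mesh R k) (cell : corner M -> set (plane R)).
Implicit Types (q : corner M) (e s w : plane R -> 'cV[R]_3).

(** The properties shared by both families of closed cells. Two indices may name the same cell, as
    happens for shared edges; otherwise cells overlap only in null sets. *)
Record cell_family : Prop := CellFamily {
  measurable_cell : forall q, measurable (cell q);
  area_cell_gt0 : forall q, (0 < area (cell q) < +oo)%E;
  cell_overlap : forall q q', cell q = cell q' \/ (@area R).-negligible (cell q `&` cell q');
  cell_cover : Om `<=` \bigcup_q cell q;
  cell_outside : forall q, (@area R).-negligible (cell q `\` Om) }.

Hypothesis hcell : cell_family.

Let mcell := measurable_cell hcell.

Let mOc q : measurable (Om `&` cell q).
Proof. exact: measurableI. Qed.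

Let carea q : R := fine (area (cell q)).

Let carea_gt0 q : 0 < carea q.
Proof. by rewrite fine_gt0// area_cell_gt0. Qed.

Let careaE q : area (Om `&` cell q) = (carea q)%:E.
Proof.
have /andP[c0 coo] := area_cell_gt0 hcell q.
rewrite /carea fineK ?ge0_fin_numE ?(ltW c0)//; apply/esym/area_ae_set => //.
by rewrite setDIr setDv setU0; exact: cell_outside.
Qed.

(** Duplicates are removed because a sum over indices would count the cell of a shared edge
    twice. *)
Let cells : seq (set (plane R)) := undup [seq cell q | q <- enum (corner M)].

Lemma Om_cells : Om = \big[setU/set0]_(A <- cells) (Om `&` A).
Proof.
rewrite -bigcup_seq; apply/seteqP; split => x; last by move=> [A _ []].
move=> Ox; have [q _ qx] := cell_cover hcell Ox.
by exists (cell q) => //=; rewrite mem_undup; apply: map_f; rewrite mem_enum.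
Qed.

Lemma int_on_cells (f : plane R -> R) : rintegrable Om f ->
  int_on Om f = \sum_(A <- cells) int_on (Om `&` A) f.
Proof.
move=> If; rewrite {1}Om_cells.
have cP A : A \in cells -> exists q, A = cell q.
  by rewrite mem_undup => /mapP[q _ ->]; exists q.
apply: int_on_bigsetU.
- exact: undup_uniq.
- by move=> A /cP[q ->]; exact: mOc.
- move=> A B /cP[q ->] /cP[q' ->] qq'.
  have [e|] := cell_overlap hcell q q'; first by rewrite e eqxx in qq'.
  by apply: area_negligibleS => x [[_ ?] [_ ?]].
- by rewrite -Om_cells.
Qed.

Lemma avg_proj_cell e q : ae_on (cell q) (fun x => avg_proj Om cell e x = cell_avg Om (cell q) e).
Proof.
have h : ae_on (cell q) (fun x => forall q', cell q' x -> cell q' = cell q).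
  apply: ae_on_forall => q'.
  have [->|n] := cell_overlap hcell q q'; first exact: ae_onW.
  by apply: (ae_on_negligible n) => x qx nqq q'x; exfalso; apply: nqq.
refine (ae_on_map h _) => x qx hx; rewrite /avg_proj.
case: pickP => [q' /set_mem q'x|/(_ q)]; first by rewrite (hx _ q'x).
by rewrite mem_set.
Qed.

Lemma avg_proj_inW e : inW Om (avg_proj Om cell e).
Proof.
(* The value at [x] depends only on which cells contain [x]. There are finitely many membership
   patterns [b], each on a measurable set, whence measurability and a bound. *)
pose V (b : {ffun corner M -> bool}) : 'cV[R]_3 :=
  if [pick q | b q] is Some q then cell_avg Om (cell q) e else 0.
have eV x : avg_proj Om cell e x = V [ffun q => x \in cell q].
  by rewrite /avg_proj /V; congr (match _ with Some _ => _ | None => _ end);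
    apply: eq_pick => q; rewrite ffunE.
move=> i; apply: (@L2_bounded _ _ mOm finOm _ (\sum_b `|V b i ord0|)).
  move=> _ Y mY; apply: measurableI => //.
  rewrite (_ : _ @^-1` Y = \bigcup_(b in [set b | Y (V b i ord0)])
      \bigcap_q (if b q then cell q else ~` cell q)); last first.
    apply/seteqP; split => x /=.
      rewrite eV => Yx; exists [ffun q => x \in cell q] => //= q _.
      by rewrite ffunE; case: ifPn => [/set_mem|/negP h /mem_set].
    move=> [b Yb bx]; rewrite eV (_ : finfun _ = b)//; apply/ffunP => q; rewrite ffunE.
    by have := bx q I; case: (b q) => h; [rewrite mem_set|apply/negbTE/negP => /set_mem].
  apply: fin_bigcup_measurable; first exact: finite_finset.
  move=> b _; apply: fin_bigcap_measurable; first exact: finite_finset.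
  by move=> q _; case: (b q) => //; exact: measurableC.
by move=> x _; rewrite eV (bigD1 [ffun q => x \in cell q])//= lerDl sumr_ge0.
Qed.

Lemma avg_proj_inWh e : inWh Om cell (avg_proj Om cell e).
Proof.
by split; [exact: avg_proj_inW|move=> q; exists (cell_avg Om (cell q) e); exact: avg_proj_cell].
Qed.

Let ae_cell q (P : plane R -> Prop) : ae_on (cell q) P -> ae_on (Om `&` cell q) P.
Proof. by apply: ae_on_subset => x []. Qed.

(** On each cell [w] is a constant, and averaging preserves the integral over the cell. *)
Lemma avg_proj_ipW e w : inW Om e -> inWh Om cell w ->
  ipW Om (avg_proj Om cell e) w = ipW Om e w.
Proof.
move=> We [Ww wc].
have Wp := avg_proj_inW e.
rewrite /ipW !int_on_cells; [|exact: ipW_integrable|exact: ipW_integrable].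
rewrite big_seq [RHS]big_seq; apply: eq_bigr => A; rewrite mem_undup => /mapP[q _ ->].
have [c wq] := wc q.
have sub : Om `&` cell q `<=` Om by move=> x [].
have W_sub s : inW Om s -> forall i, measurable_fun (Om `&` cell q) (fun x => s x i ord0).
  by move=> Ws i; apply: measurable_funS (Ws i).1.
have mdot s s' : inW Om s -> inW Om s' -> measurable_fun (Om `&` cell q) (fun x => dot3 (s x) (s' x)).
  move=> Ws Ws'; apply: (measurable_funS mOm sub).
  exact: rintegrable_measurable (ipW_integrable mOm Ws Ws').
have Wcst (d : 'cV[R]_3) : inW Om (fun=> d) by move=> i; exact: L2_cst.
transitivity (int_on (Om `&` cell q) (fun=> dot3 (cell_avg Om (cell q) e) c)).
  apply: int_on_ae => //; [exact: mdot|].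
  by refine (ae_on_map2 (ae_cell (avg_proj_cell e q)) (ae_cell wq) _) => x _ -> ->.
transitivity (int_on (Om `&` cell q) (fun x => dot3 (e x) c)); last first.
  apply: int_on_ae => //; [exact: (mdot e (fun=> c))|exact: mdot|].
  by refine (ae_on_map (ae_cell wq) _) => x _ ->.
rewrite int_on_cst// careaE/= /dot3 int_on_sum//; last first.
  by move=> i; apply: (rintegrable_subset mOm _ sub) => //; exact: (L2_mul mOm (We i) (L2_cst mOm finOm _)).
rewrite mulr_suml; apply: eq_bigr => i _.
rewrite /int_on RintegralZr; [|exact: mOc|]; last first.
  by apply: (rintegrable_subset mOm _ sub) => //; exact: (L2_integrable mOm finOm (We i)).
rewrite /cell_avg !mxE -/(carea q) -/(int_on _ _); field.
by rewrite gt_eqF.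
Qed.

Lemma cell_avg_ext e s q : inW Om e -> inW Om s -> ae_on Om (fun x => e x = s x) ->
  cell_avg Om (cell q) e = cell_avg Om (cell q) s.
Proof.
move=> We Ws es; congr (_ *: _); apply/matrixP => i j; rewrite !mxE.
have sub : Om `&` cell q `<=` Om by move=> x [].
apply: int_on_ae => //; [exact: measurable_funS (We i).1|exact: measurable_funS (Ws i).1|].
by apply: (ae_on_subset sub); refine (ae_on_map es _) => x _ ->.
Qed.

(** The conclusion is an equality of functions: averages do not see null sets. Relations between
    strains that hold almost everywhere thus become pointwise after averaging. *)
Lemma avg_proj_ext e s : inW Om e -> inW Om s -> ae_on Om (fun x => e x = s x) ->
  avg_proj Om cell e = avg_proj Om cell s.
Proof.
move=> We Ws es; apply/funext => x; rewrite /avg_proj.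
by case: pickP => // q _; exact: cell_avg_ext.
Qed.

Lemma avg_proj_lin (a : R) e s x : inW Om e -> inW Om s ->
  avg_proj Om cell (fun y => a *: e y + s y) x = a *: avg_proj Om cell e x + avg_proj Om cell s x.
Proof.
move=> We Ws; rewrite /avg_proj; case: pickP => [q _|_]; last by rewrite scaler0 addr0.
rewrite /cell_avg scalerA [a * _]mulrC -scalerA -scalerDr; congr (_ *: _).
apply/matrixP => i j; rewrite !mxE.
have sub : Om `&` cell q `<=` Om by move=> y [].
rewrite -int_on_lin//.
- by congr int_on; apply/funext => y; rewrite !mxE.
- by apply: (rintegrable_subset mOm _ sub) => //; exact: (L2_integrable mOm finOm (We i)).
- by apply: (rintegrable_subset mOm _ sub) => //; exact: (L2_integrable mOm finOm (Ws i)).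
Qed.

Lemma inWhB e s : inWh Om cell e -> inWh Om cell s -> inWh Om cell (fun x => e x - s x).
Proof.
move=> [We ec] [Ws sc]; split; first exact: inWB.
move=> q; have [c hc] := ec q; have [d hd] := sc q; exists (c - d).
by refine (ae_on_map2 hc hd _) => x _ -> ->.
Qed.

Lemma inWh0 : inWh Om cell (fun=> 0).
Proof. by split; [exact: inW0|move=> q; exists 0; exact: ae_onW]. Qed.

Lemma inWh_mulmx (D : 'M[R]_3) e : inWh Om cell e -> inWh Om cell (fun x => D *m e x).
Proof.
move=> [We ec]; split; first exact: inW_mulmx.
by move=> q; have [c hc] := ec q; exists (D *m c); refine (ae_on_map hc _) => x _ ->.
Qed.

Lemma inWh_orthogonal e : inWh Om cell e -> (forall w, inWh Om cell w -> ipW Om e w = 0) ->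
  ae_on Om (fun x => e x = 0).
Proof. by move=> We h; apply: ipW_eq0 => //; [case: We|exact: h]. Qed.

Lemma avg_proj_unique e s : inW Om e -> inWh Om cell s ->
  (forall w, inWh Om cell w -> ipW Om s w = ipW Om e w) ->
  ae_on Om (fun x => s x = avg_proj Om cell e x).
Proof.
move=> We Ws h; have Wp := avg_proj_inWh e.
have : ae_on Om (fun x => s x - avg_proj Om cell e x = 0).
  apply: inWh_orthogonal; first exact: inWhB.
  move=> w Ww; rewrite ipWBl//; [|by case: Ws|by case: Wp|by case: Ww].
  by rewrite h// avg_proj_ipW// subrr.
by move=> h'; refine (ae_on_map h' _) => x _ /eqP; rewrite subr_eq0 => /eqP.
Qed.

Lemma avg_proj_id e : inWh Om cell e -> ae_on Om (fun x => e x = avg_proj Om cell e x).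
Proof. by move=> We; apply: avg_proj_unique => //; case: We. Qed.

End Averaging.

(** * Calculus of [C1] functions on the plane *)

Section ContinuouslyDifferentiable.
Context {R : realType}.
Implicit Types (phi psi : plane R -> R).

Lemma C1_continuous phi : C1 phi -> continuous phi.
Proof. by move=> [h _ _] x; exact: differentiable_continuous. Qed.

Lemma C1_derivable phi x v : C1 phi -> derivable phi x v.
Proof. by move=> [h _ _]; exact: diff_derivable. Qed.

Lemma C1_cst (c : R) : C1 (fun=> c).
Proof.
have D0 v : 'D_v (cst c : plane R -> R) = cst 0 by apply/funext => x; rewrite derive_cst.
by split; [move=> x; exact: differentiable_cst|rewrite D0; exact: cst_continuous|rewrite D0; exact: cst_continuous].
Qed.

Lemma C1D phi psi : C1 phi -> C1 psi -> C1 (fun x => phi x + psi x).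
Proof.
move=> h1 h2; have [d1 cx1 cy1] := h1; have [d2 cx2 cy2] := h2.
have DE v : 'D_v (fun x => phi x + psi x) = (fun x => 'D_v phi x + 'D_v psi x).
  by apply/funext => x; rewrite -[LHS]/('D_v (phi + psi) x) deriveD//; exact: C1_derivable.
split; first by move=> x; exact: differentiableD.
- by rewrite DE => x; apply: cvgD; [exact: cx1|exact: cx2].
- by rewrite DE => x; apply: cvgD; [exact: cy1|exact: cy2].
Qed.

Lemma deriveM_C1 phi psi v x : C1 phi -> C1 psi ->
  'D_v (fun x => phi x * psi x) x = phi x * 'D_v psi x + psi x * 'D_v phi x.
Proof.
by move=> h1 h2; rewrite -[LHS]/('D_v (phi * psi) x) deriveM//; exact: C1_derivable.
Qed.

Lemma C1M phi psi : C1 phi -> C1 psi -> C1 (fun x => phi x * psi x).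
Proof.
move=> h1 h2; have [d1 cx1 cy1] := h1; have [d2 cx2 cy2] := h2.
have DE v : 'D_v (fun x => phi x * psi x) = (fun x => phi x * 'D_v psi x + psi x * 'D_v phi x).
  by apply/funext => x; exact: deriveM_C1.
split; first by move=> x; exact: differentiableM.
- by rewrite DE => x; apply: cvgD; apply: cvgM; [exact: C1_continuous|exact: cx2|exact: C1_continuous|exact: cx1].
- by rewrite DE => x; apply: cvgD; apply: cvgM; [exact: C1_continuous|exact: cy2|exact: C1_continuous|exact: cy1].
Qed.

Lemma C1Z (a : R) phi : C1 phi -> C1 (fun x => a * phi x).
Proof. by move=> h; exact: (C1M (C1_cst a)). Qed.

Lemma C1V phi : C1 phi -> (forall x, phi x != 0) -> C1 (fun x => (phi x)^-1).
Proof.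
move=> h1 n0; have [d1 cx1 cy1] := h1.
have DE v : 'D_v (fun x => (phi x)^-1) = (fun x => - (phi x) ^-2 * 'D_v phi x).
  by apply/funext => x; rewrite deriveV//; exact: C1_derivable.
split; first by move=> x; exact: differentiableV.
- rewrite DE => x; apply: cvgM; last exact: cx1.
  apply: cvgN; apply: cvgV; first by rewrite expf_neq0.
  rewrite expr2; apply: cvgM; exact: C1_continuous.
- rewrite DE => x; apply: cvgM; last exact: cy1.
  apply: cvgN; apply: cvgV; first by rewrite expf_neq0.
  rewrite expr2; apply: cvgM; exact: C1_continuous.
Qed.

Lemma derive_affine_form (a b c : R) v x :
  'D_v (fun z : plane R => a * z.1 + b * z.2 + c) x = a * v.1 + b * v.2.
Proof.
rewrite /derive; set F := (X in X @ _).
suff : F @ 0^' --> a * v.1 + b * v.2 by move/cvg_lim; apply.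
apply: cvg_near_cst.
near=> h; have h0 : h != 0 by near: h; exact: nbhs_dnbhs_neq.
by rewrite /F/= /GRing.scale/=; field.
Unshelve. all: by end_near. Qed.

Lemma differentiable_affine_form (a b c : R) x :
  differentiable (fun z : plane R => a * z.1 + b * z.2 + c) x.
Proof.
have lf : linear (fun z : plane R => a * z.1 + b * z.2).
  by move=> k u w /=; rewrite /GRing.scale/=; ring.
pose L : {linear plane R -> R} := HB.pack (fun z : plane R => a * z.1 + b * z.2)
  (GRing.isLinear.Build R (plane R) R _ _ lf).
apply: (@differentiableD _ _ _ (fun z : plane R => a * z.1 + b * z.2) (cst c)).
  apply: (linear_differentiable (f := L)) => z /=.
  have := @continuous_affine_form R a b 0 z.
  by under [X in continuous_at _ X]eq_fun do rewrite addr0.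
exact: differentiable_cst.
Qed.

Lemma C1_affine_form (a b c : R) : C1 (fun z : plane R => a * z.1 + b * z.2 + c).
Proof.
have DE v : 'D_v (fun z : plane R => a * z.1 + b * z.2 + c) = cst (a * v.1 + b * v.2).
  by apply/funext => x; exact: derive_affine_form.
split; first by move=> x; exact: differentiable_affine_form.
  by rewrite DE; exact: cst_continuous.
by rewrite DE; exact: cst_continuous.
Qed.

Lemma C1_comp (r r' : R -> R) phi : (forall t : R, is_derive t 1 r (r' t)) ->
  continuous r' -> C1 phi -> C1 (fun x => r (phi x)).
Proof.
move=> dr cr' h1; have [d1 cx1 cy1] := h1.
have dfr t : differentiable r t by apply/derivable1_diffP; have [] := dr t.
have DE v : 'D_v (fun x => r (phi x)) = (fun x => r' (phi x) * 'D_v phi x).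
  apply/funext => x; rewrite -[LHS]/('D_v (r \o phi) x).
  rewrite deriveE; last exact: differentiable_comp.
  rewrite diff_comp//= deriveE// mulrC.
  have := deriv1E (_ : derivable r (phi x) 1).
  have [dx rx] := dr (phi x).
  by move=> ->//=; rewrite derive1E rx.
have cr'phi : continuous (fun x => r' (phi x)).
  by move=> x; apply: continuous_comp; [exact: C1_continuous|exact: cr'].
split; first by move=> x; exact: differentiable_comp.
- by rewrite DE => x; apply: cvgM; [exact: cr'phi|exact: cx1].
- by rewrite DE => x; apply: cvgM; [exact: cr'phi|exact: cy1].
Qed.

(** Squaring makes the positive part continuously differentiable. A product of four such factors in
    affine forms is positive exactly inside a box. *)
Definition sqpos (t : R) : R := Num.max 0 t ^+ 2.

Lemma continuous_maxr0 : continuous (fun t : R => 2 * Num.max 0 t).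
Proof.
move=> t; apply: cvgM; first exact: cvg_cst.
by apply: continuous_max; [exact: cvg_cst|exact: cvg_id].
Qed.

(** The derivative is Lipschitz with constant 2, hence the remainder [h ^+ 2], valid at the kink as
    elsewhere. *)
Lemma sqpos_taylor (t h : R) : `|sqpos (t + h) - sqpos t - h * (2 * Num.max 0 t)| <= h ^+ 2.
Proof.
rewrite /sqpos ler_norml.
by have [t0|t0] := lerP 0 t; have [th|th] := lerP 0 (t + h); apply/andP; split; nra.
Qed.

Lemma is_derive_sqpos (t : R) : is_derive t 1 sqpos (2 * Num.max 0 t).
Proof.
pose F (h : R) := h^-1 *: (sqpos (h *: 1 + t) - sqpos t).
suff cF : F @ 0^' --> 2 * Num.max 0 t.
  by split; [apply/cvg_ex; exists (2 * Num.max 0 t)|apply: cvg_lim].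
apply/cvgrPdist_lt => e e0; near=> h.
have h0 : h != 0 by near: h; exact: nbhs_dnbhs_neq.
have he : `|h| < e by near: h; exact: dnbhs0_lt.
apply: le_lt_trans he.
rewrite distrC /F /GRing.scale/= mulr1 [h + t]addrC.
have -> : h^-1 * (sqpos (t + h) - sqpos t) - 2 * Num.max 0 t =
  h^-1 * (sqpos (t + h) - sqpos t - h * (2 * Num.max 0 t)) by field.
rewrite normrM normfV ler_pdivrMl ?normr_gt0// -expr2 real_normK ?num_real//.
exact: sqpos_taylor.
Unshelve. all: by end_near. Qed.

Lemma C1_sqpos phi : C1 phi -> C1 (fun x => sqpos (phi x)).
Proof. exact: C1_comp is_derive_sqpos continuous_maxr0. Qed.

Lemma sqpos_ge0 (t : R) : 0 <= sqpos t.
Proof. exact: sqr_ge0. Qed.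

Lemma sqpos_gt0 (t : R) : 0 < t -> 0 < sqpos t.
Proof. by move=> t0; rewrite /sqpos max_r ?exprn_gt0// ltW. Qed.

Lemma sqpos_eq0 (t : R) : t <= 0 -> sqpos t = 0.
Proof. by move=> t0; rewrite /sqpos max_l// expr0n. Qed.

End ContinuouslyDifferentiable.

(** * The fundamental lemma of the calculus of variations *)

Section TestFunctions.
Context {R : realType}.
Implicit Types (phi psi : plane R -> R) (O : set (plane R)).

Lemma continuous_plane_measurable (f : plane R -> R) : continuous f -> measurable_fun setT f.
Proof.
move=> /continuousP cf.
apply: (measurability (@RGenOInfty.G R)); first exact: RGenOInfty.measurableE.
move=> _ [_ [x ->] <-]; rewrite setTI; apply: open_plane_measurable; apply: cf.
exact: rray_open.
Qed.

Lemma C1_measurable phi A : C1 phi -> measurable A -> measurable_fun A phi.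
Proof.
move=> h mA; have mf := continuous_plane_measurable (C1_continuous h).
exact: (measurable_funS measurableT _ mf).
Qed.

Lemma compact_plane_closed (K : set (plane R)) : compact K -> closed K.
Proof. by apply: compact_closed; exact: norm_hausdorff. Qed.

Lemma derive_eq0_off K phi v x : compact K -> (forall y, ~ K y -> phi y = 0) -> ~ K x ->
  'D_v phi x = 0.
Proof.
move=> cK phi0 Kx; rewrite (@near_eq_derive _ _ _ _ (cst 0)) ?derive_cst//.
have oK : open (~` K) by apply: closed_openC; exact: compact_plane_closed.
by apply: filterS (open_nbhs_nbhs (conj oK Kx)) => y Ky; rewrite phi0.
Qed.

Lemma continuous_bounded_on K (f : plane R -> R) : compact K -> continuous f ->
  exists c, forall x, K x -> `|f x| <= c.
Proof.
move=> cK cf.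
have /compact_bounded [c [_ hc]] : compact (f @` K).
  by apply: continuous_compact => //; exact: continuous_subspaceT.
exists (c + 1) => x Kx; apply: hc; first by rewrite ltrDl.
by exists x.
Qed.

Lemma continuous_bounded K (f : plane R -> R) : compact K -> continuous f ->
  (forall x, ~ K x -> f x = 0) -> exists c, forall x, `|f x| <= c.
Proof.
move=> cK cf f0; have [c hc] := continuous_bounded_on cK cf.
exists (Num.max c 0) => x; have [Kx|Kx] := pselect (K x); rewrite le_max.
  by rewrite hc.
by rewrite (f0 _ Kx) normr0 lexx orbT.
Qed.

Lemma compactly_supported_subset A B phi : A `<=` B ->
  compactly_supported_in A phi -> compactly_supported_in B phi.
Proof. by move=> AB [K [cK KA phi0]]; exists K; split => // x /KA/AB. Qed.

Lemma saturation_cvg (r : R) : 0 < r ->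
  (fun n : nat => n%:R * r * (1 + n%:R * r)^-1) @ \oo --> (1 : R).
Proof.
move=> r0; have den0 (n : nat) : 0 < 1 + n%:R * r by rewrite ltr_pwDl// mulr_ge0// ltW.
have -> : (fun n : nat => n%:R * r * (1 + n%:R * r)^-1) = (fun n => 1 - (1 + n%:R * r)^-1).
  by apply/funext => n; field; rewrite gt_eqF.
rewrite -[X in _ --> X]subr0; apply: cvgB; first exact: cvg_cst.
have h : (fun n : nat => 1 + n%:R * r : R) @ \oo --> +oo.
  apply/cvgryPge => A; near=> n.
  have : A / r <= n%:R by near: n; exact: nbhs_infty_ger.
  by rewrite ler_pdivrMr//; lra.
by apply: (proj2 (gtr0_cvgV0 (f := fun n : nat => 1 + n%:R * r) _) h); exact: nearW.
Unshelve. all: by end_near. Qed.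

Variables (Om : set (plane R)) (h : plane R -> R).
Hypothesis mOm : measurable Om.
Hypothesis Ih : rintegrable Om h.
Variable O : set (plane R).
Hypothesis oO : open O.
Hypothesis OOm : O `<=` Om.
Hypothesis h_test : forall phi, C1 phi -> compactly_supported_in O phi ->
  int_on Om (fun x => h x * phi x) = 0.

(* The test functions [n r / (1 + n r)], with [r] positive exactly inside the box,
   increase to the indicator of the box. *)
Lemma int_box_eq0 (a b c d : R) : `[a, b] `*` `[c, d] `<=` O ->
  int_on (`]a, b[ `*` `]c, d[) h = 0.
Proof.
move=> boxO.
set B := `]a, b[ `*` `]c, d[.
have mB : measurable B by exact: measurableX.
have BOm : B `<=` Om.
  by move=> x [x1 x2]; apply/OOm/boxO; split; apply: subset_itv_oo_cc.
pose r (x : plane R) : R := sqpos (1 * x.1 + 0 * x.2 + - a) * sqpos ((-1) * x.1 + 0 * x.2 + b) *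
  (sqpos (0 * x.1 + 1 * x.2 + - c) * sqpos (0 * x.1 + (-1) * x.2 + d)).
have r0 x : 0 <= r x by apply: mulr_ge0; apply: mulr_ge0; exact: sqpos_ge0.
have Cr : C1 r by apply: C1M; apply: C1M; apply: C1_sqpos; exact: C1_affine_form.
have rB x : B x -> 0 < r x.
  move=> [] /=; rewrite !in_itv/= => /andP[? ?] /andP[? ?].
  by apply: mulr_gt0; apply: mulr_gt0; apply: sqpos_gt0; lra.
have rnB x : ~ B x -> r x = 0.
  move=> nB; rewrite /r; have [x1|x1] := lerP x.1 a.
    by rewrite [sqpos _]sqpos_eq0 ?mul0r//; lra.
  have [x2|x2] := lerP b x.1.
    by rewrite [X in _ * X * _]sqpos_eq0 ?mulr0 ?mul0r//; lra.
  have [x3|x3] := lerP x.2 c.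
    by rewrite [X in _ * _ * (X * _)]sqpos_eq0 ?mul0r ?mulr0//; lra.
  have [x4|x4] := lerP d x.2.
    by rewrite [X in _ * _ * (_ * X)]sqpos_eq0 ?mulr0//; lra.
  by exfalso; apply: nB; split; rewrite /= in_itv/= ?x1 ?x2 ?x3 ?x4.
pose den (n : nat) x : R := 1 + n%:R * r x.
have den_gt0 n x : 0 < den n x by rewrite ltr_pwDl// mulr_ge0.
pose phi (n : nat) x : R := n%:R * r x * (den n x)^-1.
have Cphi n : C1 (phi n).
  apply: C1M; first exact: C1Z.
  apply: C1V => [|x]; last by rewrite gt_eqF.
  by apply: C1D; [exact: C1_cst|exact: C1Z].
have phi_supp n : compactly_supported_in O (phi n).
  exists (`[a, b] `*` `[c, d]); split => //; first by apply: compact_setX; exact: segment_compact.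
  move=> x nx; rewrite /phi rnB ?mulr0 ?mul0r// => -[x1 x2]; apply: nx.
  by split; apply: subset_itv_oo_cc.
have phi01 n x : 0 <= phi n x <= 1.
  rewrite /phi divr_ge0 ?(mulr_ge0 _ (r0 x)) ?(ltW (den_gt0 n x))//=.
  by rewrite ler_pdivrMr ?den_gt0// mul1r /den lerDr.
have mh := rintegrable_measurable Ih.
have [] := @dominated_convergence _ _ R (@area R) Om mOm
  (fun n x => (h x * phi n x)%:E) (fun x => (h x * \1_B x)%:E) (fun x => `|h x|%:E).
- move=> n; apply/measurable_EFinP; apply: measurable_funM => //.
  exact: C1_measurable.
- by apply/measurable_EFinP; apply: measurable_funM.
- apply: (@aeW _ _ _ (@area R)) => x Ox; apply: cvg_EFin; first exact: nearW.
  rewrite /comp/=; apply: cvgM; first exact: cvg_cst.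
  rewrite indicE; have [/set_mem Bx|/negP nBx] := boolP (x \in B).
    by apply: saturation_cvg; exact: rB.
  have -> : phi ^~ x = (fun n => 0).
    apply/funext => n; rewrite /phi rnB ?mulr0 ?mul0r// => Bx; apply: nBx.
    by rewrite inE.
  exact: cvg_cst.
- exact: (rintegrable_norm Ih).
- apply: (@aeW _ _ _ (@area R)) => x n Ox; rewrite lee_fin normrM ler_piMr//.
  by have /andP[? ?] := phi01 n x; rewrite ger0_norm.
move=> Ilim _; rewrite (_ : [sequence _]_n = cst 0%E); last first.
  apply/funext => n /=; have := h_test (Cphi n) (phi_supp n).
  have Ihphi : rintegrable Om (fun x => h x * phi n x).
    apply: (rintegrable_dominated mOm _ (rintegrable_norm Ih)).
      by apply: measurable_funM => //; exact: C1_measurable.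
    move=> x Ox; rewrite normrM ler_piMr//.
    by have /andP[? ?] := phi01 n x; rewrite ger0_norm.
  rewrite /int_on /Rintegral => e; rewrite -[LHS]fineK ?e//.
  exact: (@integrable_fin_num _ _ _ (@area R) Om mOm _ Ihphi).
move=> lim0.
have I0 : (\int[@area R]_(x in Om) (h x * \1_B x)%:E = 0)%E.
  exact: (cvg_unique (@ereal_hausdorff R) lim0 (cvg_cst _)).
rewrite (_ : B = Om `&` B); last first.
  by apply/seteqP; split => x; [move=> Bx; split => //; exact: BOm|case].
rewrite /int_on Rintegral_mkcondr.
transitivity (fine (\int[@area R]_(x in Om) (h x * \1_B x)%:E)%E); last by rewrite I0.
congr fine; apply: eq_integral => x _; congr EFin.
by rewrite patchE indicE; case: ifP => _; rewrite ?mulr1 ?mulr0.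
Qed.

Let boxes : set (set (plane R)) :=
  [set A | exists a b c d : R, A = `]a, b[ `*` `]c, d[].

Lemma itvoo_bigcup : \bigcup_n `](- n%:R), n%:R[%classic = [set: R].
Proof.
apply/seteqP; split => // x _.
exists (Num.bound `|x|) => //=; rewrite in_itv/= -ltr_norml.
exact: archi_boundP.
Qed.

(** This lets Dynkin induction start from open boxes, which are stable under intersection. The
    preimage of an interval by a coordinate is a strip, and a strip is a countable union of
    boxes. *)
Lemma measurable_boxes : @measurable _ (measurableTypeR R * measurableTypeR R)%type = <<s boxes >>.
Proof.
have mR : @measurable _ (measurableTypeR R) = <<s @RGenOpens.G R >> by exact: RGenOpens.measurableE.
apply/seteqP; split; last first.
  apply: smallest_sub; first exact: sigma_algebra_measurable.
  by move=> _ [a [b [c [d ->]]]]; exact: measurableX.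
have sb : sigma_algebra setT <<s boxes >> by exact: smallest_sigma_algebra.
have [s0 sC sU] := sb.
apply: smallest_sub => // A [[X mX <-]|[Y mY <-]]; rewrite setTI.
  suff : @measurable _ (measurableTypeR R) `<=` [set X | <<s boxes >> (fst @^-1` X)].
    by apply.
  rewrite mR; apply: smallest_sub.
    split => [|B h1|F hF] /=; first by rewrite preimage_set0.
      by rewrite setTD preimage_setC -setTD; exact: sC.
    by rewrite preimage_bigcup; exact: sU.
  move=> _ [a [b ->]] /=.
  rewrite (_ : _ @^-1` _ = \bigcup_n (`]a, b[ `*` `](- n%:R), n%:R[)).
    by apply: sU => n; apply: sub_sigma_algebra; exists a, b, (- n%:R), n%:R.
  by rewrite -setX_bigcupr itvoo_bigcup; apply/seteqP; split => x [].
suff : @measurable _ (measurableTypeR R) `<=` [set X | <<s boxes >> (snd @^-1` X)].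
  by apply.
rewrite mR; apply: smallest_sub.
  split => [|B h1|F hF] /=; first by rewrite preimage_set0.
    by rewrite setTD preimage_setC -setTD; exact: sC.
  by rewrite preimage_bigcup; exact: sU.
move=> _ [a [b ->]] /=.
rewrite (_ : _ @^-1` _ = \bigcup_n (`](- n%:R), n%:R[ `*` `]a, b[)).
  by apply: sU => n; apply: sub_sigma_algebra; exists (- n%:R), n%:R, a, b.
by rewrite -setX_bigcupl itvoo_bigcup; apply/seteqP; split => x [].
Qed.

Lemma setI_itvoo (a b c d : R) : `]a, b[ `&` `]c, d[ = `]Num.max a c, Num.min b d[%classic.
Proof.
apply/seteqP; split => x /=; rewrite !in_itv/= gt_max lt_min.
  by move=> [/andP[-> ->] /andP[-> ->]].
by move=> /andP[/andP[-> ->] /andP[-> ->]].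
Qed.

(** Inside a fixed box [B], the sets [A] for which [h] has zero integral over the part of [A] in [B]
    contain the boxes and are stable under complements and countable disjoint unions, so they are
    all the measurable sets. A function with only zero integrals vanishes almost everywhere, and
    countably many boxes cover [O]. *)
Lemma fundamental_lemma : ae_on O (fun x => h x = 0).
Proof.
have mO := open_plane_measurable oO.
suff loc (a b c d : R) : `[a, b] `*` `[c, d] `<=` O -> (@area R).-negligible
    (~` [set x : plane R | (`]a, b[ `*` `]c, d[) x -> h x = 0]).
  have [|F OF nF] := open_plane_countable_cover
    (P := fun A => (@area R).-negligible (~` [set x : plane R | A x -> h x = 0])) oO loc.
    by apply: area_negligibleS (negligible_set0 (@area R)) => x /=; apply.
  rewrite /ae_on OF; apply: (@area_negligibleS _ _ (\bigcup_n ~` [set x : plane R | F n x -> h x = 0])).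
    move=> x /=; apply: contra_notP => nx [n _ Fx]; apply: contrapT => hx.
    by apply: nx; exists n => // /(_ Fx).
  exact: (@negligible_bigcup _ _ _ (@area R)).
move=> boxO; set B := `]a, b[ `*` `]c, d[.
have mB : measurable B by exact: measurableX.
have BO : B `<=` O.
  by move=> x [x1 x2]; apply: boxO; split; apply: subset_itv_oo_cc.
have IB : rintegrable B h by apply: (rintegrable_subset mOm mB _ Ih); exact: subset_trans OOm.
have mAB (A : set (plane R)) : measurable A -> measurable (A `&` B) by move=> mA; exact: measurableI.
have IAB (A : set (plane R)) : measurable A -> rintegrable (A `&` B) h.
  by move=> mA; apply: (rintegrable_subset mB (mAB _ mA) _ IB) => x [].
have eint (A : set (plane R)) : measurable A -> int_on (A `&` B) h = 0 ->
    (\int[@area R]_(x in A `&` B) (h x)%:E = 0)%E.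
  move=> mA e; rewrite -[LHS]fineK; first by rewrite -[fine _]/(int_on (A `&` B) h) e.
  exact: (@integrable_fin_num _ _ _ (@area R) _ (mAB _ mA) _ (IAB _ mA)).
have key (A : set (plane R)) : measurable A -> int_on (A `&` B) h = 0.
  move=> mA.
  have sA : <<s boxes >> A by rewrite -measurable_boxes.
  move: A sA {mA}; apply: (@dynkin_induction _ (measurableTypeR R * measurableTypeR R)%type).
  - exact: measurable_boxes.
  - move=> _ _ [a1 [b1 [c1 [d1 ->]]]] [a2 [b2 [c2 [d2 ->]]]].
    exists (Num.max a1 a2), (Num.min b1 b2), (Num.max c1 c2), (Num.min d1 d2).
    by rewrite -setXI !setI_itvoo.
  - by rewrite setTI; exact: int_box_eq0.
  - move=> _ [a1 [b1 [c1 [d1 ->]]]].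
    rewrite -setXI !setI_itvoo; apply: int_box_eq0; apply: subset_trans boxO.
    move=> x []; rewrite /= !in_itv/= !ge_max !le_min => /andP[/andP[_ x1] /andP[_ x2]] /andP[/andP[_ y1] /andP[_ y2]].
    by split; rewrite /= ?in_itv/= ?x1 ?x2 ?y1 ?y2.
  - move=> A mA e; have mCA := measurableC mA.
    have : int_on B h = 0 by exact: int_box_eq0.
    rewrite {1}(_ : B = (A `&` B) `|` (~` A `&` B)); last by rewrite -setIUl setUCr setTI.
    rewrite int_on_setU ?e ?add0r//; [exact: mAB|exact: mAB| |].
      rewrite (_ : _ `&` _ = set0); first exact: (negligible_set0 (@area R)).
      by apply/seteqP; split => // x [[? _] [? _]].
    by rewrite -setIUl setUCr setTI.
  - move=> F mF tF eF; rewrite setI_bigcupl /int_on /Rintegral.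
    rewrite (@integral_bigcup _ _ _ (@area R)).
    + rewrite eseries0//= => n _ _; exact: (eint _ (mF n) (eF n)).
    + by apply/trivIsetP => i j _ _ ij; rewrite setIACA setIid; move/trivIsetP: tF => -> //; rewrite set0I.
    + by move=> n; exact: (mAB _ (mF n)).
    + by rewrite -setI_bigcupl; apply: IAB; apply: bigcupT_measurable => n; exact: mF.
have := @integral_ae_eq _ _ R (@area R) B mB (cst 0%E) (EFin \o h) IB.
move=> /(_ (measurable_cst _)) hae.
have {}hae : ae_on B (fun x => (h x)%:E = 0%E).
  apply: hae => E EB mE; rewrite integral0.
  by have := eint _ mE (key _ mE); rewrite setIidl.
by refine (ae_on_map hae _) => x _ [].
Qed.

End TestFunctions.

(** * Integrals of derivatives of compactly supported functions *)

Section IntegrationByParts.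
Context {R : realType}.
Implicit Types (phi psi w g : plane R -> R).

Lemma bounded_set_box (A : set (plane R)) : bounded_set A ->
  exists2 N : R, 0 < N & A `<=` `[-N, N] `*` `[-N, N].
Proof.
move=> [M [_ /(_ (`|M| + 1))]] h; exists (`|M| + 1); first by rewrite ltr_wpDl.
have {}h : forall x, A x -> `|x| <= `|M| + 1.
  by apply: h; rewrite (le_lt_trans (ler_norm M))// ltrDl.
move=> [x y] /h; rewrite prod_normE/= ge_max !ler_norml => /andP[? ?].
by split; rewrite /= in_itv.
Qed.

Lemma integral_deriv_eq0 (G g : R -> R) (N : R) : 0 < N ->
  (forall t : R, is_derive t 1 G (g t)) -> continuous g ->
  (forall t : R, N <= `|t| -> G t = 0) -> (forall t : R, N < `|t| -> g t = 0) ->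
  (\int[@lebesgue_measure R]_t (g t)%:E = 0)%E.
Proof.
move=> N0 dG cg G0 g0.
have cG : continuous G.
  by move=> t; apply/differentiable_continuous/derivable1_diffP; have [] := dG t.
have NN : - N < N by lra.
pose I : set R := `[- N, N]%classic.
transitivity (\int[@lebesgue_measure R]_(t in I) (g t)%:E)%E.
  rewrite [RHS]integral_mkcond; apply: eq_integral => t _; rewrite patchE.
  case: ifPn => // /negP tN; rewrite g0// ltNge; apply/negP => tN'; apply: tN.
  by rewrite inE /I/= in_itv/= -ler_norml.
rewrite /I (@continuous_FTC2 R g G)//.
- by rewrite !G0 ?normrN ?ger0_norm ?(ltW N0)// subee.
- exact: continuous_subspaceT.
- split.
  + by move=> t _; have [] := dG t.
  + by apply: cvg_at_right_filter; exact: cG.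
  + by apply: cvg_at_left_filter; exact: cG.
- by move=> t _; rewrite derive1E; have [_ ->] := dG t.
Qed.

Lemma is_derive_slicex phi (x y : R) : C1 phi ->
  is_derive x 1 (fun s => phi (s, y)) ('D_dirx phi (x, y)).
Proof.
move=> Cphi.
have E : (fun h : R => h^-1 *: (phi (h *: 1 + x, y) - phi (x, y))) =
         (fun h : R => h^-1 *: (phi (h *: dirx + (x, y)) - phi (x, y))).
  apply/funext => h; congr (_ *: (phi _ - _)); apply/eqP.
  by rewrite -pair_eqE /pair_eq/= /GRing.scale/= mulr0 add0r !eqxx.
have d : derivable phi (x, y) dirx by exact: C1_derivable.
split; first by rewrite /derivable/= E; exact: d.
by rewrite /derive/= E.
Qed.

Lemma is_derive_slicey phi (x y : R) : C1 phi ->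
  is_derive y 1 (fun s => phi (x, s)) ('D_diry phi (x, y)).
Proof.
move=> Cphi.
have E : (fun h : R => h^-1 *: (phi (x, h *: 1 + y) - phi (x, y))) =
         (fun h : R => h^-1 *: (phi (h *: diry + (x, y)) - phi (x, y))).
  apply/funext => h; congr (_ *: (phi _ - _)); apply/eqP.
  by rewrite -pair_eqE /pair_eq/= /GRing.scale/= mulr0 add0r !eqxx.
have d : derivable phi (x, y) diry by exact: C1_derivable.
split; first by rewrite /derivable/= E; exact: d.
by rewrite /derive/= E.
Qed.

(** Fubini's theorem with the inner integral taken along [d], where the fundamental theorem of
    calculus applies. *)
Lemma integral_derive_eq0 phi d : C1 phi -> compactly_supported_in setT phi ->
  d = dirx \/ d = diry -> int_on setT ('D_d phi) = 0.
Proof.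
move=> Cphi [K [cK _ phi0]] hd.
have [N N0 KN] : exists2 N : R, 0 < N & K `<=` `[-N, N] `*` `[-N, N].
  exact/bounded_set_box/compact_bounded.
have D0 x : ~ K x -> 'D_d phi x = 0 by exact: derive_eq0_off cK phi0.
have Kx x : K x -> `|x.1| <= N /\ `|x.2| <= N.
  by move=> /KN [/=]; rewrite !in_itv/= -!ler_norml.
have [cx cy] : continuous ('D_dirx phi) /\ continuous ('D_diry phi) by have [] := Cphi.
have cD : continuous ('D_d phi) by case: hd => ->.
have [c hc] := continuous_bounded cK cD D0.
pose B : set (plane R) := `[-N, N] `*` `[-N, N].
have mB : measurable B by exact: measurableX.
have finB : (area B < +oo)%E.
  rewrite area_setX// !lebesgue_measure_itv/=.
  by case: ifP => _; rewrite ?mule0 ?mul0e// -!EFinD -EFinM ltry.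
have ID : rintegrable setT ('D_d phi).
  have mD : measurable_fun B ('D_d phi).
    exact: (measurable_funS measurableT _ (continuous_plane_measurable cD)).
  have /(@integrable_mkcond _ _ _ (@area R) B _ mB) := rintegrable_bounded mB finB mD (fun x _ => hc x).
  congr (integrable _ _ _); apply/funext => x; rewrite patchE.
  by case: ifPn => // /negP nx; rewrite /= D0// => /KN kx; apply: nx; rewrite inE.
rewrite /int_on /Rintegral.
case: hd => ed.
- rewrite -(@integral21_prod_meas1 _ _ _ _ R (@lebesgue_measure R) (@lebesgue_measure R) _ ID).
  rewrite integral0_eq//= => y _; rewrite /fubini_G/=.
  (* The support may reach distance [N], and the function must already vanish at the end points of
     the interval, hence [N + 1]. *)
  apply: (@integral_deriv_eq0 (fun x => phi (x, y)) _ (N + 1)); first by lra.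
  + by move=> t; rewrite ed; exact: is_derive_slicex.
  + move=> t; have h : (fun s : R => (s, y)) @ t --> (t, y).
      by apply: (@cvg_pair _ _ _ _ (nbhs t) (nbhs y)); [exact: cvg_id|exact: cvg_cst].
    exact: (continuous_comp h (cD _)).
  + by move=> t tN; apply: phi0 => /Kx[/= t' _]; lra.
  + by move=> t tN; apply: D0 => /Kx[/= t' _]; lra.
- rewrite -(@integral12_prod_meas1 _ _ _ _ R (@lebesgue_measure R) (@lebesgue_measure R) _ ID).
  rewrite integral0_eq//= => x _; rewrite /fubini_F/=.
  apply: (@integral_deriv_eq0 (fun y => phi (x, y)) _ (N + 1)); first by lra.
  + by move=> t; rewrite ed; exact: is_derive_slicey.
  + move=> t; have h : (fun s : R => (x, s)) @ t --> (x, t).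
      by apply: (@cvg_pair _ _ _ _ (nbhs x) (nbhs t)); [exact: cvg_cst|exact: cvg_id].
    exact: (continuous_comp h (cD _)).
  + by move=> t tN; apply: phi0 => /Kx[/= _ t']; lra.
  + by move=> t tN; apply: D0 => /Kx[/= _ t']; lra.
Qed.

End IntegrationByParts.

(** * Weak derivatives and the space H^1 *)

Section WeakDerivatives.
Context {R : realType} (Om : set (plane R)).
Hypothesis oOm : open Om.
Hypothesis bOm : bounded_set Om.
Implicit Types (phi w g : plane R -> R) (d : plane R).

Lemma measurable_domain : measurable Om.
Proof. exact: open_plane_measurable. Qed.
Let mOm := measurable_domain.

Lemma area_domain : (area Om < +oo)%E.
Proof. exact: area_bounded. Qed.
Let fOm := area_domain.

Definition axis d := d = dirx \/ d = diry.

Lemma continuous_L2 (f : plane R -> R) : continuous f -> L2 Om f.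
Proof.
move=> cf; have [N N0 ON] := bounded_set_box bOm.
have cK : compact (`[-N, N] `*` `[-N, N] : set (plane R)).
  by apply: compact_setX; exact: segment_compact.
have [c hc] := continuous_bounded_on cK cf.
apply: (@L2_bounded _ _ mOm fOm _ c) => [|x Ox]; last by apply/hc/ON.
exact: (measurable_funS measurableT _ (continuous_plane_measurable cf)).
Qed.

Lemma C1_L2 phi : C1 phi -> L2 Om phi.
Proof. by move=> Cphi; apply: continuous_L2; exact: C1_continuous. Qed.

Lemma derive_C1_L2 phi d : C1 phi -> axis d -> L2 Om ('D_d phi).
Proof. by move=> [_ cx cy] [->|->]; [exact: continuous_L2 cx|exact: continuous_L2 cy]. Qed.

(** The statement is local because it has two uses: on all of [Om] it gives uniqueness and
    linearity, and inside a subtriangle it compares a displacement with an affine function that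
    agrees with it only there. *)
Lemma weak_deriv_unique_on (O : set (plane R)) d w w' g g' : axis d -> open O -> O `<=` Om ->
  (forall x, O x -> w x = w' x) -> is_weak_deriv Om d w g -> is_weak_deriv Om d w' g' ->
  ae_on O (fun x => g x = g' x).
Proof.
move=> hd oO OOm ww' [L2g wg] [L2g' wg'].
have L2h := L2_lin mOm (-1) L2g' L2g.
have h0 : ae_on O (fun x => -1 * g' x + g x = 0).
  apply: (fundamental_lemma mOm (L2_integrable mOm fOm L2h) oO OOm) => phi Cphi sphi.
  have [K [cK KO phi0]] := sphi.
  have sOm := compactly_supported_subset OOm sphi.
  have L2phi := C1_L2 Cphi.
  transitivity (-1 * int_on Om (fun x => g' x * phi x) + int_on Om (fun x => g x * phi x)).
    rewrite -int_on_lin//; [|exact: L2_mul|exact: L2_mul].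
    by congr int_on; apply/funext => x; ring.
  rewrite mulN1r -(wg' phi Cphi sOm) -[int_on Om (fun x => g x * phi x)]opprK -(wg phi Cphi sOm).
  apply/eqP; rewrite subr_eq0; apply/eqP; congr int_on; apply/funext => x.
  have [Kx|Kx] := pselect (K x); first by rewrite ww'//; exact: KO.
  by rewrite (derive_eq0_off d cK phi0 Kx) !mulr0.
by refine (ae_on_map h0 _) => x _; lra.
Qed.

Lemma weak_deriv_lin d (a : R) w w' g g' : axis d -> L2 Om w -> L2 Om w' ->
  is_weak_deriv Om d w g -> is_weak_deriv Om d w' g' ->
  is_weak_deriv Om d (fun x => a * w x + w' x) (fun x => a * g x + g' x).
Proof.
move=> hd L2w L2w' [L2g wg] [L2g' wg']; split; first exact: L2_lin.
move=> phi Cphi sphi; have L2phi := C1_L2 Cphi; have L2D := derive_C1_L2 Cphi hd.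
transitivity (a * int_on Om (fun x => w x * 'D_d phi x) + int_on Om (fun x => w' x * 'D_d phi x)).
  rewrite -int_on_lin//; [|exact: L2_mul|exact: L2_mul].
  by congr int_on; apply/funext => x; ring.
rewrite wg// wg'// mulrN -opprD; congr (- _).
rewrite -int_on_lin//; [|exact: L2_mul|exact: L2_mul].
by congr int_on; apply/funext => x; ring.
Qed.

Lemma int_on_off K (f : plane R -> R) : K `<=` Om -> (forall x, ~ K x -> f x = 0) ->
  int_on Om f = int_on setT f.
Proof.
move=> KO f0; rewrite /int_on Rintegral_mkcond; congr (Rintegral _ _ _).
apply/funext => x; rewrite patchE; case: ifPn => // /negP nx.
by rewrite f0// => /KO kx; apply: nx; rewrite inE.
Qed.

Lemma weak_deriv_C1 d phi : axis d -> C1 phi -> is_weak_deriv Om d phi ('D_d phi).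
Proof.
move=> hd Cphi; split; first exact: derive_C1_L2.
move=> psi Cpsi [K [cK KO psi0]].
have L2psi := C1_L2 Cpsi; have L2phi := C1_L2 Cphi.
have L2Dpsi := derive_C1_L2 Cpsi hd; have L2Dphi := derive_C1_L2 Cphi hd.
apply/eqP; rewrite -addr_eq0; apply/eqP.
rewrite -[int_on Om (fun x => phi x * _)]mul1r -int_on_lin//; [|exact: L2_mul|exact: L2_mul].
have CM := C1M Cphi Cpsi.
have prod0 x : ~ K x -> phi x * psi x = 0 by move=> /psi0 ->; rewrite mulr0.
transitivity (int_on Om ('D_d (fun x => phi x * psi x))).
  by congr int_on; apply/funext => x; rewrite deriveM_C1//; ring.
rewrite (int_on_off KO); last by move=> x; exact: derive_eq0_off cK prod0.
by apply: integral_derive_eq0 => //; exists K.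
Qed.

Lemma weak_derivP d w : (exists g, is_weak_deriv Om d w g) ->
  is_weak_deriv Om d w (weak_deriv Om d w).
Proof. by move=> [g hg]; rewrite /weak_deriv; case: xgetP => [g' _//|/(_ g)]. Qed.

Lemma H1_weak_deriv d w : axis d -> H1 Om w -> is_weak_deriv Om d w (weak_deriv Om d w).
Proof. by move=> [->|->] [_ hx hy]; exact: weak_derivP. Qed.

Lemma H1_L2 w : H1 Om w -> L2 Om w. Proof. by case. Qed.

Lemma weak_deriv_L2 d w : axis d -> H1 Om w -> L2 Om (weak_deriv Om d w).
Proof. by move=> hd hw; have [] := H1_weak_deriv hd hw. Qed.

Lemma H1_lin (a : R) w w' : H1 Om w -> H1 Om w' -> H1 Om (fun x => a * w x + w' x).
Proof.
move=> hw hw'; have lx := H1_weak_deriv (or_introl erefl) hw.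
have ly := H1_weak_deriv (or_intror erefl) hw.
have lx' := H1_weak_deriv (or_introl erefl) hw'.
have ly' := H1_weak_deriv (or_intror erefl) hw'.
have L2w := H1_L2 hw; have L2w' := H1_L2 hw'.
split; first exact: L2_lin.
- by eexists; apply: (weak_deriv_lin a (or_introl erefl) L2w L2w' lx lx').
- by eexists; apply: (weak_deriv_lin a (or_intror erefl) L2w L2w' ly ly').
Qed.

Lemma weak_deriv_ae_lin d (a : R) w w' : axis d -> H1 Om w -> H1 Om w' ->
  ae_on Om (fun x => weak_deriv Om d (fun x => a * w x + w' x) x =
    a * weak_deriv Om d w x + weak_deriv Om d w' x).
Proof.
move=> hd hw hw'.
apply: (@weak_deriv_unique_on Om d (fun x => a * w x + w' x) (fun x => a * w x + w' x)) => //.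
  exact: (H1_weak_deriv hd (H1_lin a hw hw')).
exact: (weak_deriv_lin a hd (H1_L2 hw) (H1_L2 hw') (H1_weak_deriv hd hw) (H1_weak_deriv hd hw')).
Qed.

Lemma C1_H1 phi : C1 phi -> H1 Om phi.
Proof.
move=> Cphi; split; first exact: C1_L2.
- by exists ('D_dirx phi); apply: weak_deriv_C1 => //; left.
- by exists ('D_diry phi); apply: weak_deriv_C1 => //; right.
Qed.

Lemma H1_zero : H1 Om (fun=> 0).
Proof. exact: C1_H1 (C1_cst 0). Qed.

(** Replaces the triangle inequality: it suffices for passing to the limit in squared norms and
    needs no square roots. *)
Lemma sqr_lin_le (a x y : R) : (a * x + y) ^+ 2 <= 2 * a ^+ 2 * x ^+ 2 + 2 * y ^+ 2.
Proof. have := sqr_ge0 (a * x - y); rewrite sqrrB sqrrD; lra. Qed.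

Lemma int_on_sqr_lin (a : R) (f g h : plane R -> R) : L2 Om f -> L2 Om g -> L2 Om h ->
  ae_on Om (fun x => h x = a * f x + g x) ->
  int_on Om (fun x => h x ^+ 2) <=
    2 * a ^+ 2 * int_on Om (fun x => f x ^+ 2) + 2 * int_on Om (fun x => g x ^+ 2).
Proof.
move=> L2f L2g L2h hh; have L2l := L2_lin mOm a L2f L2g.
rewrite (@int_on_ae _ _ _ (fun x => (a * f x + g x) ^+ 2)) => //; first last.
- by refine (ae_on_map hh _) => x _ ->.
- by apply: measurable_funX; case: L2l.
- by apply: measurable_funX; case: L2h.
have [_ If] := L2f; have [_ Ig] := L2g.
rewrite -(int_onZ 2 mOm Ig) -int_on_lin//; last exact: rintegrableZ.
apply: int_on_le => //.
- by have [_ I] : L2 Om (fun x => a * f x + g x) := L2l.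
- by apply: rintegrable_lin => //; exact: rintegrableZ.
- by move=> x _; exact: sqr_lin_le.
Qed.

Lemma H1sqnorm_ge0 w : 0 <= H1sqnorm Om w.
Proof. by rewrite !addr_ge0// int_on_ge0// => x _; exact: sqr_ge0. Qed.

Lemma lin_bound_sum3 (c A1 A2 A3 B1 B2 B3 C1 C2 C3 : R) : C1 <= c * A1 + 2 * B1 ->
  C2 <= c * A2 + 2 * B2 -> C3 <= c * A3 + 2 * B3 ->
  C1 + C2 + C3 <= c * (A1 + A2 + A3) + 2 * (B1 + B2 + B3).
Proof. by rewrite !mulrDr => h1 h2 h3; lra. Qed.

Lemma sum3_eq0 (A B C : R) : 0 <= A -> 0 <= B -> 0 <= C -> A + B + C = 0 -> A = 0.
Proof. lra. Qed.

Lemma H1sqnorm_lin_le (a : R) w w' : H1 Om w -> H1 Om w' ->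
  H1sqnorm Om (fun x => a * w x + w' x) <= 2 * a ^+ 2 * H1sqnorm Om w + 2 * H1sqnorm Om w'.
Proof.
move=> hw hw'; have hx : axis (@dirx R) by left.
have hy : axis (@diry R) by right.
have hl := H1_lin a hw hw'.
have h0 := int_on_sqr_lin (a := a) (H1_L2 hw) (H1_L2 hw') (H1_L2 hl) (ae_onW (fun x _ => erefl)).
have h1 := int_on_sqr_lin (weak_deriv_L2 hx hw) (weak_deriv_L2 hx hw') (weak_deriv_L2 hx hl)
  (weak_deriv_ae_lin a hx hw hw').
have h2 := int_on_sqr_lin (weak_deriv_L2 hy hw) (weak_deriv_L2 hy hw') (weak_deriv_L2 hy hl)
  (weak_deriv_ae_lin a hy hw hw').
exact: lin_bound_sum3 h0 h1 h2.
Qed.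

Lemma weak_deriv_eq0 d w : axis d -> H1 Om w -> (forall x, Om x -> w x = 0) ->
  ae_on Om (fun x => weak_deriv Om d w x = 0).
Proof.
move=> hd hw w0.
have z : is_weak_deriv Om d (fun=> 0 : R) (fun=> 0).
  have := weak_deriv_C1 hd (C1_cst 0); congr is_weak_deriv.
  by apply/funext => x; exact: derive_cst.
by apply: (weak_deriv_unique_on hd oOm _ w0 (H1_weak_deriv hd hw) z).
Qed.

Lemma H1sqnorm_eq0 w : H1 Om w -> H1sqnorm Om w = 0 -> ae_on Om (fun x => w x = 0).
Proof.
move=> hw e; have [mw Iw] := H1_L2 hw.
have h : ae_on Om (fun x => w x ^+ 2 = 0).
  apply: int_on_eq0 => // [x _|]; first exact: sqr_ge0.
  have h1 : 0 <= int_on Om (fun x => w x ^+ 2) by apply: int_on_ge0 => x _; exact: sqr_ge0.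
  have h2 : 0 <= int_on Om (fun x => weak_deriv Om dirx w x ^+ 2) by apply: int_on_ge0 => x _; exact: sqr_ge0.
  have h3 : 0 <= int_on Om (fun x => weak_deriv Om diry w x ^+ 2) by apply: int_on_ge0 => x _; exact: sqr_ge0.
  exact: (sum3_eq0 h1 h2 h3 e).
by refine (ae_on_map h _) => x _ /eqP; rewrite sqrf_eq0 => /eqP.
Qed.

Lemma H1sqnorm_zero : H1sqnorm Om (fun=> 0) = 0.
Proof.
have sq0 f : L2 Om f -> ae_on Om (fun x => f x = 0) -> int_on Om (fun x => f x ^+ 2) = 0.
  move=> [mf _] f0; rewrite -[RHS](int_on0 Om); apply: int_on_ae => //.
    exact: measurable_funX.
  by refine (ae_on_map f0 _) => x _ ->; rewrite expr0n.
have hx : axis (@dirx R) by left.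
have hy : axis (@diry R) by right.
have e0 := sq0 _ (H1_L2 H1_zero) (ae_onW (fun x _ => erefl)).
have e1 := sq0 _ (weak_deriv_L2 hx H1_zero) (weak_deriv_eq0 hx H1_zero (fun x _ => erefl)).
have e2 := sq0 _ (weak_deriv_L2 hy H1_zero) (weak_deriv_eq0 hy H1_zero (fun x _ => erefl)).
have sum3 (A B C : R) : A = 0 -> B = 0 -> C = 0 -> A + B + C = 0 by move=> -> -> ->; rewrite !addr0.
exact: sum3 e0 e1 e2.
Qed.

End WeakDerivatives.

(** * Square integrable functions on the sides of the polygon *)

Section LineIntegrals.
Context {R : realType}.
Local Notation mu := (@lebesgue_measure R).
Let I : set R := `[0, 1]%classic.
Implicit Types (F G : R -> R).

Definition sqint F := measurable_fun I F /\ mu.-integrable I (EFin \o (fun t => F t ^+ 2)).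

Let mI : measurable I. Proof. exact: measurable_itv. Qed.

Lemma sqint_bound (a : R) F G : sqint F -> sqint G ->
  mu.-integrable I (EFin \o (fun t => 2 * a ^+ 2 * F t ^+ 2 + 2 * G t ^+ 2)).
Proof.
move=> [_ iF] [_ iG].
rewrite (_ : _ \o _ = (fun t => (2 * a ^+ 2)%R%:E * (EFin \o (fun t => (F t ^+ 2)%R)) t)%E
  \+ (fun t => 2%R%:E * (EFin \o (fun t => (G t ^+ 2)%R)) t)%E)//.
by apply: integrableD => //; exact: integrableZl.
Qed.

Lemma sqint_lin (a : R) F G : sqint F -> sqint G -> sqint (fun t => a * F t + G t).
Proof.
move=> sF sG; have mL : measurable_fun I (fun t => a * F t + G t).
  by apply: measurable_funD; [apply: measurable_funM; [exact: measurable_cst|case: sF]|case: sG].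
split => //; apply: le_integrable (sqint_bound a sF sG) => //.
  by apply/measurable_EFinP; exact: measurable_funX.
move=> t _ /=; rewrite lee_fin ger0_norm ?sqr_ge0//.
exact: le_trans (sqr_lin_le a (F t) (G t)) (ler_norm _).
Qed.

Lemma sqint_lin_le (a : R) F G : sqint F -> sqint G ->
  \int[mu]_(t in I) ((a * F t + G t) ^+ 2) <=
  2 * a ^+ 2 * \int[mu]_(t in I) (F t ^+ 2) + 2 * \int[mu]_(t in I) (G t ^+ 2).
Proof.
move=> sF sG; have [_ iF] := sF; have [_ iG] := sG; have [_ iL] := sqint_lin a sF sG.
rewrite -RintegralZl// -[2 * Rintegral _ _ _]RintegralZl// -RintegralD//.
- apply: le_Rintegral => //; first exact: (sqint_bound a sF sG).
  by move=> t _; exact: sqr_lin_le.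
- by rewrite (_ : _ \o _ = (fun t => (2 * a ^+ 2)%R%:E * (EFin \o (fun t => (F t ^+ 2)%R)) t)%E)//; exact: integrableZl.
- by rewrite (_ : _ \o _ = (fun t => 2%R%:E * (EFin \o (fun t => (G t ^+ 2)%R)) t)%E)//; exact: integrableZl.
Qed.

Lemma continuous_segpt (s : plane R * plane R) : continuous (segpt s).
Proof.
move=> t; rewrite /segpt; apply: cvgD.
  by apply: cvgZr_tmp; apply: cvgB; [exact: cvg_cst|exact: cvg_id].
by apply: cvgZr_tmp; exact: cvg_id.
Qed.

Lemma sqint_C1 (phi : plane R -> R) s : C1 phi -> sqint (fun t => phi (segpt s t)).
Proof.
move=> Cphi; have cF : continuous (fun t => phi (segpt s t)).
  by move=> t; apply: continuous_comp; [exact: continuous_segpt|exact: C1_continuous].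
split; first by apply: (measurable_funS measurableT) => //; exact: continuous_measurable_fun.
apply: (@continuous_compact_integrable R (fun t => phi (segpt s t) ^+ 2) I); first exact: segment_compact.
rewrite (_ : (fun t => _) = (fun t => phi (segpt s t) * phi (segpt s t))); last first.
  by apply/funext => t; rewrite expr2.
by apply: continuous_subspaceT => t; apply: cvgM; exact: cF.
Qed.

Lemma line_int_ge0 sides (g : plane R -> R) : 0 <= line_int sides (fun x => g x ^+ 2).
Proof.
apply: sumr_ge0 => s _; rewrite mulr_ge0// ?sqrtr_ge0// Rintegral_ge0// => t _; exact: sqr_ge0.
Qed.

Lemma line_int_sqr_lin_le sides (a : R) (f g : plane R -> R) :
  (forall s, s \in sides -> sqint (fun t => f (segpt s t))) ->
  (forall s, s \in sides -> sqint (fun t => g (segpt s t))) ->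
  line_int sides (fun x => (a * f x + g x) ^+ 2) <=
  2 * a ^+ 2 * line_int sides (fun x => f x ^+ 2) + 2 * line_int sides (fun x => g x ^+ 2).
Proof.
move=> hf hg; rewrite /line_int !mulr_sumr -big_split big_seq [leRHS]big_seq/=.
apply: ler_sum => s ss; have h := sqint_lin_le a (hf s ss) (hg s ss).
have e0 : 0 <= edist s.1 s.2 by exact: sqrtr_ge0.
have key (x y z : R) : x <= 2 * a ^+ 2 * y + 2 * z ->
    edist s.1 s.2 * x <= 2 * a ^+ 2 * (edist s.1 s.2 * y) + 2 * (edist s.1 s.2 * z).
  by move=> hx; rewrite (le_trans (ler_wpM2l e0 hx))// le_eqVlt; apply/orP; left; apply/eqP; ring.
exact: key h.
Qed.

End LineIntegrals.

(** * Linearity of traces, of V and of the strain operator *)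

Section DisplacementSpace.
Context {R : realType} (Om : set (plane R)) (sides : seq (plane R * plane R)) (GD : set (plane R)).
Hypothesis oOm : open Om.
Hypothesis bOm : bounded_set Om.
Implicit Types (w g : plane R -> R) (u v : plane R -> plane R).

Lemma cvg0_lin_bound (a : R) (x y z : nat -> R) : (forall n, 0 <= z n) ->
  (forall n, z n <= 2 * a ^+ 2 * x n + 2 * y n) ->
  x @ \oo --> (0 : R) -> y @ \oo --> (0 : R) -> z @ \oo --> (0 : R).
Proof.
move=> z0 zle x0 y0.
apply: (@squeeze_cvgr _ _ _ _ (fun=> 0) (fun n => 2 * a ^+ 2 * x n + 2 * y n)).
- by apply: nearW => n; rewrite z0 zle.
- exact: cvg_cst.
- rewrite (_ : 0 = 2 * a ^+ 2 * 0 + 2 * 0); last by rewrite !mulr0 addr0.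
  by apply: cvgD; apply: cvgM => //; exact: cvg_cst.
Qed.

(** The same combination of the two approximating [C1] sequences works. This is what makes the
    Dirichlet condition, and so V, stable under linear combinations. *)
Lemma is_trace_lin (a : R) w w' g g' : is_trace Om sides w g -> is_trace Om sides w' g' ->
  is_trace Om sides (fun x => a * w x + w' x) (fun x => a * g x + g' x).
Proof.
move=> [hw mg ig [phi [Cphi phiw phig]]] [hw' mg' ig' [phi' [Cphi' phiw' phig']]].
have sg s : s \in sides -> sqint (fun t => g (segpt s t)).
  by move=> ss; split; [exact: mg|exact: ig].
have sg' s : s \in sides -> sqint (fun t => g' (segpt s t)).
  by move=> ss; split; [exact: mg'|exact: ig'].
split.
- exact: H1_lin.
- by move=> s ss; have [] := sqint_lin a (sg s ss) (sg' s ss).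
- by move=> s ss; have [] := sqint_lin a (sg s ss) (sg' s ss).
exists (fun n x => a * phi n x + phi' n x); split.
- by move=> n; apply: C1D => //; exact: C1Z.
- have sub1 (f h : plane R -> R) : H1 Om f -> H1 Om h -> H1 Om (fun x => f x - h x).
    move=> hf hh; have := H1_lin oOm bOm (-1) hh hf.
    by congr H1; apply/funext => x; rewrite mulN1r addrC.
  have h1 n := sub1 _ _ (C1_H1 oOm bOm (Cphi n)) hw.
  have h2 n := sub1 _ _ (C1_H1 oOm bOm (Cphi' n)) hw'.
  apply: (cvg0_lin_bound (a := a) _ _ phiw phiw') => n; first exact: H1sqnorm_ge0.
  rewrite (_ : (fun x => a * phi n x + phi' n x - _) =
    (fun x => a * (phi n x - w x) + (phi' n x - w' x))); last by apply/funext => x; ring.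
  exact: (H1sqnorm_lin_le oOm bOm a (h1 n) (h2 n)).
- have sub1 (f h : plane R -> R) s : sqint (fun t => f (segpt s t)) -> sqint (fun t => h (segpt s t)) ->
      sqint (fun t => f (segpt s t) - h (segpt s t)).
    move=> hf hh; have := sqint_lin (-1) hh hf.
    by congr sqint; apply/funext => x; rewrite mulN1r addrC.
  apply: (cvg0_lin_bound (a := a) _ _ phig phig') => n; first exact: line_int_ge0.
  rewrite (_ : (fun x => (a * phi n x + phi' n x - _) ^+ 2) =
    (fun x => (a * (phi n x - g x) + (phi' n x - g' x)) ^+ 2)); last by apply/funext => x; congr (_ ^+ 2); ring.
  apply: line_int_sqr_lin_le => s ss.
    by apply: (sub1 (phi n) g) => //; [exact: sqint_C1|exact: sg].
  by apply: (sub1 (phi' n) g') => //; [exact: sqint_C1|exact: sg'].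
Qed.

Lemma is_trace0 : is_trace Om sides (fun=> 0) (fun=> 0).
Proof.
split; [exact: H1_zero|by move=> s _; exact: measurable_cst| |].
- move=> s _; rewrite (_ : _ \o _ = cst 0%E); first exact: integrable0.
  by apply/funext => t; rewrite /= expr0n.
exists (fun _ _ => 0); split; first by move=> n; exact: C1_cst.
- rewrite (_ : (fun n : nat => _) = (fun=> 0)); first exact: cvg_cst.
  apply/funext => n; rewrite -[RHS](H1sqnorm_zero oOm bOm); congr (H1sqnorm _ _).
  by apply/funext => x; rewrite subrr.
- rewrite (_ : (fun n : nat => _) = (fun=> 0)); first exact: cvg_cst.
  apply/funext => n; rewrite /line_int big1// => s _.
  rewrite /Rintegral integral0_eq ?mulr0// => t _.
  by rewrite subrr expr0n.
Qed.

Lemma inV_lin (a : R) u v : inV Om sides GD u -> inV Om sides GD v ->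
  inV Om sides GD (fun x => a *: u x + v x).
Proof.
move=> [h1 h2 [g [t1 t2] g0]] [h1' h2' [g' [t1' t2'] g0']]; split.
- exact: (H1_lin oOm bOm a h1 h1').
- exact: (H1_lin oOm bOm a h2 h2').
exists (fun x => a *: g x + g' x).
  split; [exact: (is_trace_lin a t1 t1')|exact: (is_trace_lin a t2 t2')].
move=> s ss.
refine (@filterS2 _ _ (@ae_filter_ringOfSetsType _ _ _ (@lebesgue_measure R)) _ _ _ _
  (g0 s ss) (g0' s ss)) => t h h' It Gt.
by rewrite h// h'// scaler0 addr0.
Qed.

Lemma inV0 : inV Om sides GD (fun=> 0).
Proof.
split; [exact: (H1_zero oOm bOm)|exact: (H1_zero oOm bOm)|].
exists (fun=> 0); first by split; exact: is_trace0.
by move=> s _; apply: aeW => t.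
Qed.

Lemma Bop_inW u : inV Om sides GD u -> inW Om (Bop Om u).
Proof.
move=> [h1 h2 _]; have hx : axis (@dirx R) by left.
have hy : axis (@diry R) by right.
have mOm := measurable_domain oOm.
move=> i; case: i => -[|[|[|//]]] hi.
- have := weak_deriv_L2 hx h1; congr L2; by apply/funext => x; rewrite mxE.
- have := weak_deriv_L2 hy h2; congr L2; by apply/funext => x; rewrite mxE.
- have := L2_lin mOm 1 (weak_deriv_L2 hy h1) (weak_deriv_L2 hx h2).
  by congr L2; apply/funext => x; rewrite mxE/= mul1r.
Qed.

(** Weak derivatives are chosen representatives, so linearity is asserted almost everywhere only. *)
Lemma Bop_lin (a : R) u v : inV Om sides GD u -> inV Om sides GD v ->
  ae_on Om (fun x => Bop Om (fun y => a *: u y + v y) x = a *: Bop Om u x + Bop Om v x).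
Proof.
move=> [h1 h2 _] [h1' h2' _]; have hx : axis (@dirx R) by left.
have hy : axis (@diry R) by right.
have a1 := ae_on_map2 (weak_deriv_ae_lin oOm bOm a hx h1 h1')
  (weak_deriv_ae_lin oOm bOm a hy h2 h2') (fun x _ p q => conj p q).
have a2 := ae_on_map2 (weak_deriv_ae_lin oOm bOm a hy h1 h1')
  (weak_deriv_ae_lin oOm bOm a hx h2 h2') (fun x _ p q => conj p q).
refine (ae_on_map2 a1 a2 _) => x _ [p1 p2] [p3 p4].
apply/matrixP => i j; rewrite !mxE; case: i => -[|[|[|//]]] hi /=.
- exact: p1.
- exact: p2.
- by rewrite [LHS](congr2 +%R p3 p4) mulrDr addrACA.
Qed.

Lemma Bop_eq0 u : inV Om sides GD u -> (forall x, Om x -> u x = 0) ->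
  ae_on Om (fun x => Bop Om u x = 0).
Proof.
move=> [h1 h2 _] u0; have hx : axis (@dirx R) by left.
have hy : axis (@diry R) by right.
have u1 x : Om x -> fstf u x = 0 by move=> Ox; rewrite /fstf u0.
have u2 x : Om x -> sndf u x = 0 by move=> Ox; rewrite /sndf u0.
have a1 := ae_on_map2 (weak_deriv_eq0 oOm bOm hx h1 u1) (weak_deriv_eq0 oOm bOm hy h2 u2) (fun x _ p q => conj p q).
have a2 := ae_on_map2 (weak_deriv_eq0 oOm bOm hy h1 u1) (weak_deriv_eq0 oOm bOm hx h2 u2) (fun x _ p q => conj p q).
refine (ae_on_map2 a1 a2 _) => x _ [p1 p2] [p3 p4].
apply/matrixP => i j; rewrite !mxE; case: i => -[|[|[|//]]] hi /=.
- exact: p1.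
- exact: p2.
- by rewrite [LHS](congr2 +%R p3 p4) addr0.
Qed.

End DisplacementSpace.

(** * Finite unions of null sets, integrals of constants, monotonicity of area *)

Section FiniteUnions.
Context {R : realType}.
Implicit Types (A : set (plane R)).

Lemma negligible_bigcup_fin (I : finType) (F : I -> set (plane R)) :
  (forall i, (@area R).-negligible (F i)) -> (@area R).-negligible (\bigcup_i F i).
Proof.
move=> nF; have : (@area R).-negligible (\big[setU/set0]_i F i).
  apply: (big_ind (fun B => (@area R).-negligible B)) => [|B C|i _]; last exact: nF.
  - exact: (negligible_set0 (@area R)).
  - exact: area_negligibleU.
apply: area_negligibleS => x [i _ Fx]; rewrite -bigcup_seq.
by exists i => //=; rewrite mem_index_enum.
Qed.

Lemma int_on_ae_cst A (f : plane R -> R) (c : R) : measurable A -> measurable_fun A f ->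
  ae_on A (fun x => f x = c) -> int_on A f = c * fine (area A).
Proof.
move=> mA mf fc; rewrite -int_on_cst//; apply: int_on_ae => //; exact: measurable_cst.
Qed.

Lemma area_subset_le A B : measurable A -> measurable B -> A `<=` B -> (area A <= area B)%E.
Proof. by move=> mA mB AB; apply: (@le_measure _ _ _ (@area R)) => //; rewrite inE. Qed.

End FiniteUnions.

(** * The auxiliary subdivisions as families of cells *)

Section SmoothedStrain.
Context {R : realType} (Om : set (plane R)) (sides : seq (plane R * plane R)) (GD : set (plane R)).
Hypothesis hOm : polygonal_domain Om sides.
Context {k : elt_kind} (M : mesh R k).
Hypothesis hM : subdivision Om M.
Implicit Types (q v : corner M) (u : plane R -> plane R).

Lemma polygonal_open : open Om. Proof. by case: hOm. Qed.
Lemma polygonal_bounded : bounded_set Om. Proof. by case: hOm. Qed.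
Let oOm := polygonal_open.
Let bOm := polygonal_bounded.
Let mOm := measurable_domain oOm.
Let fOm := area_domain oOm bOm.
Let hP : proper_elts M. Proof. by case: hM. Qed.
Let hC : conforming M. Proof. by case: hM. Qed.

Lemma negligible_polygonal_boundary : (@area R).-negligible (closure Om `\` Om).
Proof.
have [_ _ _ _ [_ bE _ s_neq _]] := hOm.
apply: (@area_negligibleS _ _ (boundary Om)).
  by move=> x [clx nx]; split => //; move/interior_subset.
rewrite bE; have : (@area R).-negligible (\big[setU/set0]_(s <- sides) segment s.1 s.2).
  rewrite big_seq; apply: (big_ind (fun B => (@area R).-negligible B)) => [|B C|s ss].
  - exact: (negligible_set0 (@area R)).
  - exact: area_negligibleU.
  - exact/negligible_segment/s_neq.
by rewrite -bigcup_seq.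
Qed.

Lemma csub_closure q : csub q `<=` closure Om.
Proof.
by move=> x xq; have [_ _ ->] := hM; exists q.1 => //; exact: csub_elt xq.
Qed.

Lemma Om_csub : Om `<=` \bigcup_q csub (M := M) q.
Proof.
move=> x /subset_closure; have [_ _ ->] := hM => -[T _ [i _ Tix]].
by exists (T, i).
Qed.

Lemma negligible_outside (A : set (plane R)) : A `<=` closure Om -> (@area R).-negligible (A `\` Om).
Proof.
by move=> AO; apply: area_negligibleS negligible_polygonal_boundary => x [/AO ? ?].
Qed.

Lemma area_inside (A : set (plane R)) : measurable A -> A `<=` closure Om -> area (Om `&` A) = area A.
Proof.
move=> mA AO; apply/esym/area_ae_set => //; first exact: measurableI.
by rewrite setDIr setDv setU0; exact: negligible_outside.
Qed.

Lemma cell1_closure q : cell1 q `<=` closure Om.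
Proof. by move=> x [q' _]; exact: (@csub_closure q'). Qed.

Lemma cell1E q : cell1 q = \big[setU/set0]_(q' <- [seq q' <- enum (corner M) | same_edge q q']) csub q'.
Proof.
rewrite -bigcup_seq; apply/seteqP; split => x [q' h xq']; exists q' => //=.
  by rewrite mem_filter mem_enum andbT; apply/asboolP; rewrite /cedge h.
by move: h; rewrite /= mem_filter => /andP[/asboolP/esym].
Qed.

Lemma measurable_cell1 q : measurable (cell1 q).
Proof. by rewrite cell1E; apply: bigsetU_measurable => q' _; exact: measurable_csub. Qed.

Lemma csub_cell1 q : csub q `<=` cell1 q.
Proof. by move=> x xq; exists q. Qed.

Lemma area_closure_lty (A : set (plane R)) : measurable A -> A `<=` closure Om -> (area A < +oo)%E.
Proof.
move=> mA AO; rewrite -(area_inside mA AO); apply: le_lt_trans fOm.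
exact: (area_subset_le (measurableI _ _ mOm mA) mOm (@subIsetl _ Om A)).
Qed.

Lemma cell1_family : cell_family Om (cell1 (M := M)).
Proof.
split.
- exact: measurable_cell1.
- move=> q; rewrite (area_closure_lty (measurable_cell1 q) (@cell1_closure q)) andbT.
  apply: (lt_le_trans _ (area_subset_le (measurable_csub hP q) (measurable_cell1 q) (@csub_cell1 q))).
  by rewrite area_csub// lte_fin mulr_gt0 ?unit_triangle_area_gt0//; exact: ccross_gt0.
- move=> q q'; have [e|ne] := eqVneq (cedge q) (cedge q'); [left|right].
    by apply/seteqP; split => x [q'' h xq'']; exists q'' => //; move: h; rewrite /= -/(cedge q) -/(cedge q') e.
  (* Different edges have no corner in common, so the overlap lies in finitely many null
     intersections of distinct subtriangles. *)
  apply: (@area_negligibleS _ _ (\bigcup_(p : corner M * corner M)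
      (if p.1 == p.2 then set0 else csub p.1 `&` csub p.2))).
    move=> x [[a ha xa] [b hb xb]]; exists (a, b) => //=.
    case: eqVneq => [ab|_]; last by [].
    by move: ne; rewrite /cedge -[edge q.1 q.2]ha -[edge q'.1 q'.2]hb ab eqxx.
  apply: negligible_bigcup_fin => -[a b] /=; case: eqVneq => [_|ab].
    exact: (negligible_set0 (@area R)).
  exact: negligible_csubI.
- by move=> x /Om_csub[q _ xq]; exists q => //; exact: csub_cell1.
- by move=> q; apply: negligible_outside; exact: cell1_closure.
Qed.

Let mhalf1 q := measurable_half1 hP q.
Let mhalf2 q := measurable_half2 hP q.

Lemma cell2_closure q : cell2 q `<=` closure Om.
Proof.
by rewrite cell2E => x [/half2_sub|/half1_sub]; exact: csub_closure.
Qed.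

Lemma measurable_cell2 q : measurable (cell2 q).
Proof. by rewrite cell2E; apply: measurableU. Qed.

Lemma cprev_inj q v : cprev q = cprev v -> q = v.
Proof.
case: q v => [T i] [T' i'] [-> ii'].
by congr (_, _); rewrite -(ord_predK i) -(ord_predK i'); apply: val_inj; rewrite /= ii'.
Qed.

Lemma negligible_half21 q v : (@area R).-negligible (half2 q `&` half1 v).
Proof.
have [->|qv] := eqVneq q v; first by rewrite setIC; exact: negligible_half12.
apply: area_negligibleS (negligible_csubI hP hC qv) => x [/half2_sub ? /half1_sub ?].
by [].
Qed.

Lemma cell2_family : cell_family Om (cell2 (M := M)).
Proof.
split.
- exact: measurable_cell2.
- move=> q; rewrite (area_closure_lty (measurable_cell2 q) (@cell2_closure q)) andbT.
  have sub : half1 q `<=` cell2 q by rewrite cell2E; right.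
  apply: (lt_le_trans _ (area_subset_le (mhalf1 q) (measurable_cell2 q) sub)).
  by rewrite area_half1// lte_fin mulr_gt0 ?unit_triangle_area_gt0//; exact: half_cross_gt0.
- move=> q q'; have [->|ne] := eqVneq q q'; [by left|right].
  have ne' : cprev q != cprev q' by apply: contraNneq ne => /cprev_inj ->.
  rewrite !cell2E.
  have n1 := negligible_csubI hP hC ne; have n2 := negligible_csubI hP hC ne'.
  have n3 := negligible_half21 (cprev q) q'; have n4 := negligible_half21 (cprev q') q.
  apply: area_negligibleS (area_negligibleU (area_negligibleU n1 n2) (area_negligibleU n3 n4)).
  move=> x [[x1|x1] [x2|x2]].
  + by left; right; split; exact: half2_sub.
  + by right; left.
  + by right; right.
  + by left; left; split; exact: half1_sub.
- move=> x /Om_csub[q _]; rewrite half_split => -[x1|x2].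
    by exists q => //; rewrite cell2E; right.
  (* The second half of a subtriangle belongs to the cell of the next node. *)
  exists (q.1, ordS q.2) => //; rewrite cell2E; left.
  by rewrite /cprev/= ordSK -surjective_pairing.
- by move=> q; apply: negligible_outside; exact: cell2_closure.
Qed.

End SmoothedStrain.

(** * Strains of discrete displacements and their cell averages *)

Section Coercivity.
Context {R : realType} (Om : set (plane R)) (sides : seq (plane R * plane R)) (GD : set (plane R)).
Hypothesis hOm : polygonal_domain Om sides.
Context {k : elt_kind} (M : mesh R k).
Hypothesis hM : subdivision Om M.
Implicit Types (q v : corner M) (u : plane R -> plane R).

Let oOm := polygonal_open hOm.
Let bOm := polygonal_bounded hOm.
Let mOm := measurable_domain oOm.
Let fOm := area_domain oOm bOm.
Let hP : proper_elts M. Proof. by case: hM. Qed.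
Let hC : conforming M. Proof. by case: hM. Qed.

Lemma inVh_P1 u q : inVh Om sides GD M u -> P1_on (csub q) u.
Proof.
move=> [_]; case: k M q => M' q.
  move=> /(_ q.1) [a [b [c h]]]; exists a, b, c => x xq.
  by apply: h; exact: csub_elt xq.
by move=> [/(_ q.1 q.2)].
Qed.

(** Affinity and the centroid for triangles, the definition of V_h for quadrilaterals: this brings
    both elements under the hypothesis of the injectivity argument. *)
Lemma inVh_center u (T : 'I_(nelts M)) : inVh Om sides GD M u ->
  u (center T) = (nnodes k)%:R^-1 *: \sum_i u (node T i).
Proof.
move=> [_]; case: k M T => M' T; last by move=> [_ /(_ T)].
move=> /(_ T) [a [b [c h]]].
have hn i : u (node T i) = a + (node T i).1 *: b + (node T i).2 *: c.
  by apply: h; have [_ + _] := csub_corner (T, i); exact: csub_elt.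
have hc : u (center T) = a + (center T).1 *: b + (center T).2 *: c.
  by apply: h; have [+ _ _] := csub_corner (T, ord0 : 'I_(nnodes Tri3)); exact: csub_elt.
rewrite (eq_bigr _ (fun i _ => hn i)) hc /center !(sum_Tri3 _ ord0).
move: (node T _) (node T _) (node T _) => p q r.
apply/eqP; rewrite -pair_eqE /pair_eq/= /GRing.scale/=.
by apply/andP; split; apply/eqP; field.
Qed.

Lemma measurable_Om_csub q : measurable (Om `&` csub q).
Proof. exact: (measurableI _ _ mOm (measurable_csub hP q)). Qed.

Definition strain_value u q : 'cV[R]_3 := (ccross q)^-1 *: cstrain u q.

Lemma inVh_inV u : inVh Om sides GD M u -> inV Om sides GD u. Proof. by case. Qed.

(** In the open interior of the subtriangle [u] agrees with an affine map, a [C1] function defined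
    on the whole plane, whose classical derivatives are weak ones. The rest of the subtriangle is
    null. *)
Lemma Bop_csub u q : inVh Om sides GD M u ->
  ae_on (Om `&` csub q) (fun x => Bop Om u x = strain_value u q).
Proof.
move=> hu; have [a [b [c h]]] := inVh_P1 q hu.
have [h1 h2 _] := inVh_inV hu.
have hx : axis (@dirx R) by left.
have hy : axis (@diry R) by right.
pose O := Om `&` csub_interior q.
have oO : open O by apply: openI => //; exact: open_triangle_interior.
have OOm : O `<=` Om by move=> x [].
have sub : csub_interior q `<=` csub q.
  by apply: triangle_interior_subset; exact: (ccross_gt0 hP q).
have comp (w : plane R -> R) (a' b' c' : R) d : axis d -> H1 Om w ->
    (forall x, O x -> w x = b' * x.1 + c' * x.2 + a') ->
    ae_on O (fun x => weak_deriv Om d w x = b' * d.1 + c' * d.2).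
  move=> hd hw hwx.
  have wd := weak_deriv_C1 oOm bOm hd (C1_affine_form b' c' a').
  have := weak_deriv_unique_on oOm bOm hd oO OOm hwx (H1_weak_deriv hd hw) wd.
  by move=> hae; refine (ae_on_map hae _) => x _ ->; exact: derive_affine_form.
have w1 x : O x -> fstf u x = b.1 * x.1 + c.1 * x.2 + a.1.
  by move=> [_ /sub xq]; rewrite /fstf h//= /GRing.scale/=; ring.
have w2 x : O x -> sndf u x = b.2 * x.1 + c.2 * x.2 + a.2.
  by move=> [_ /sub xq]; rewrite /sndf h//= /GRing.scale/=; ring.
have e1 := ae_on_map2 (comp _ _ _ _ _ hx h1 w1) (comp _ _ _ _ _ hy h2 w2) (fun x _ s t => conj s t).
have e2 := ae_on_map2 (comp _ _ _ _ _ hy h1 w1) (comp _ _ _ _ _ hx h2 w2) (fun x _ s t => conj s t).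
have eO : ae_on O (fun x => Bop Om u x = strain_value u q).
  refine (ae_on_map2 e1 e2 _) => x _ [p1 p2] [p3 p4].
  have D0 : ccross q != 0 by rewrite gt_eqF//; exact: ccross_gt0.
  have [qc qn qx] := csub_corner q.
  have l1 : lval u q.1 q.2 = (lpos q.1 q.2).1 *: b + (lpos q.1 q.2).2 *: c.
    rewrite /lval -/(cnode q) -/(ccenter q) !h// /lpos.
    by apply/eqP; rewrite -pair_eqE /pair_eq/= /GRing.scale/=; apply/andP; split; apply/eqP; ring.
  have l2 : lval u q.1 (ordS q.2) = (lpos q.1 (ordS q.2)).1 *: b + (lpos q.1 (ordS q.2)).2 *: c.
    rewrite /lval -/(cnext q) -/(ccenter q) !h// /lpos.
    by apply/eqP; rewrite -pair_eqE /pair_eq/= /GRing.scale/=; apply/andP; split; apply/eqP; ring.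
  have DE : ccross q = cross (lpos q.1 q.2) (lpos q.1 (ordS q.2)) by [].
  rewrite /strain_value /cstrain l1 l2 DE; rewrite DE in D0.
  move: (lpos q.1 q.2) (lpos q.1 (ordS q.2)) D0 => A B D0.
  apply: (can_inj (scalerK D0)); rewrite scalerA mulfV// scale1r.
  rewrite /cross /strain /strainx /strainy /strainxy in D0 *.
  apply/matrixP => i j; rewrite !mxE; case: i => -[|[|[|//]]] hi /=; rewrite ?p1 ?p2 ?p3 ?p4 /GRing.scale/=; ring.
have nb := negligible_triangle_boundary (ccross_gt0 hP q).
have nb' : ae_on (Om `&` csub q) (fun x => ~ (csub q `\` csub_interior q) x).
  by apply: (ae_on_negligible nb).
have eO' : ae_on (Om `&` csub q) (fun x => O x -> Bop Om u x = strain_value u q).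
  exact: (@filterS _ _ (@ae_filter_ringOfSetsType _ _ _ (@area R)) _ _ (fun x f _ => f) eO).
refine (ae_on_map2 nb' eO' _) => x [Ox xq] nx; apply; split => //.
by apply: contrapT => ni; apply: nx.
Qed.

Definition avg1 u q : 'cV[R]_3 := cell_avg Om (cell1 q) (Bop Om u).

Let kap := @unit_triangle_area R.
Let kap0 : kap != 0. Proof. by rewrite gt_eqF// unit_triangle_area_gt0. Qed.

Let W_meas (e : plane R -> 'cV[R]_3) (A : set (plane R)) i : inW Om e ->
  measurable_fun (Om `&` A) (fun x => e x i ord0).
Proof.
by move=> We; have [m _] := We i; apply: (measurable_funS mOm _ m) => x [].
Qed.

Let W_int (e : plane R -> 'cV[R]_3) (A : set (plane R)) i : inW Om e -> measurable A ->
  rintegrable (Om `&` A) (fun x => e x i ord0).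
Proof.
move=> We mA; apply: (rintegrable_subset mOm (measurableI _ _ mOm mA) _ (L2_integrable mOm fOm (We i))).
by move=> x [].
Qed.

Lemma int_Bop_csub u q i : inVh Om sides GD M u ->
  int_on (Om `&` csub q) (fun x => Bop Om u x i ord0) = kap * cstrain u q i ord0.
Proof.
move=> hu; have W := Bop_inW oOm (inVh_inV hu).
rewrite (@int_on_ae_cst _ _ _ (strain_value u q i ord0)).
- rewrite (area_inside hOm (measurable_csub hP q) (csub_closure hM (q := q))) area_csub//=.
  rewrite /strain_value mxE -/kap; field.
  by rewrite gt_eqF//; exact: ccross_gt0.
- exact: measurable_Om_csub.
- exact: W_meas.
- by refine (ae_on_map (Bop_csub q hu) _) => x _ ->.
Qed.

Lemma setI_bigsetU_seq (A : set (plane R)) (s : seq (corner M)) (F : corner M -> set (plane R)) :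
  A `&` \big[setU/set0]_(q <- s) F q = \big[setU/set0]_(q <- s) (A `&` F q).
Proof. by rewrite -!bigcup_seq setI_bigcupr. Qed.

Lemma int_cell1 (f : plane R -> R) q : rintegrable Om f ->
  int_on (Om `&` cell1 q) f = \sum_(q' | same_edge q q') int_on (Om `&` csub q') f.
Proof.
move=> If; rewrite cell1E setI_bigsetU_seq int_on_bigsetU.
- by rewrite big_filter big_enum_cond.
- by rewrite filter_uniq// enum_uniq.
- by move=> q' _; exact: measurable_Om_csub.
- move=> q' q'' _ _ n; apply: area_negligibleS (negligible_csubI hP hC n).
  by move=> x [[_ ?] [_ ?]].
- rewrite -setI_bigsetU_seq -cell1E.
  apply: (rintegrable_subset mOm (measurableI _ _ mOm (measurable_cell1 hM q)) _ If).
  by move=> x [].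
Qed.

Lemma sum_class_ccross_gt0 q : 0 < \sum_(q' | same_edge q q') ccross q'.
Proof.
rewrite (bigD1 q) ?same_edgexx//= ltr_pwDl//; first exact: ccross_gt0.
by apply: sumr_ge0 => q' _; exact/ltW/ccross_gt0.
Qed.

Lemma area_cell1 q : fine (area (cell1 q)) = kap * \sum_(q' | same_edge q q') ccross q'.
Proof.
have := int_cell1 q (rintegrable_cst mOm fOm 1).
rewrite int_on_cst; last exact: (measurableI _ _ mOm (measurable_cell1 hM q)).
rewrite mul1r (area_inside hOm (measurable_cell1 hM q) (cell1_closure hM (q := q))) => ->.
rewrite mulr_sumr; apply: eq_bigr => q' _.
rewrite int_on_cst; last exact: measurable_Om_csub.
by rewrite mul1r (area_inside hOm (measurable_csub hP q') (csub_closure hM (q := q'))) area_csub.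
Qed.

(** The area of the cell and the integral over it both carry the factor [kap], which cancels. *)
Lemma avg1_sum u q : inVh Om sides GD M u ->
  (\sum_(q' | same_edge q q') ccross q') *: avg1 u q = \sum_(q' | same_edge q q') cstrain u q'.
Proof.
move=> hu; have W := Bop_inW oOm (inVh_inV hu).
have S0 := lt0r_neq0 (sum_class_ccross_gt0 q).
rewrite /avg1 /cell_avg area_cell1 scalerA invfM mulrCA mulfV// mulr1.
apply: (can_inj (scalerK kap0)); rewrite scalerA mulfV// scale1r.
apply/matrixP => i j; rewrite !mxE {j}[j]ord1.
rewrite int_cell1; last exact: (L2_integrable mOm fOm (W i)).
rewrite summxE mulr_sumr; apply: eq_bigr => q' _; exact: int_Bop_csub.
Qed.

Lemma avg1_same_edge u q q' : same_edge q q' -> avg1 u q = avg1 u q'.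
Proof.
move=> /asboolP e; suff E : cell1 q = cell1 q' by rewrite /avg1 E.
by apply/seteqP; split => x [p h xp]; exists p => //; move: h; rewrite /= -/(cedge q) -/(cedge q') e.
Qed.

Lemma int_P1h_half u (A : set (plane R)) q i : inVh Om sides GD M u -> measurable A ->
  A `<=` csub q ->
  int_on (Om `&` A) (fun x => P1h Om M (Bop Om u) x i ord0) = avg1 u q i ord0 * fine (area A).
Proof.
move=> hu mA Aq.
have W : inW Om (P1h Om M (Bop Om u)) := avg_proj_inW mOm fOm (cell1_family hOm hM) (Bop Om u).
rewrite (@int_on_ae_cst _ _ _ (avg1 u q i ord0)).
- by rewrite (area_inside hOm mA)//; apply: subset_trans Aq _; exact: csub_closure.
- exact: (measurableI _ _ mOm mA).
- exact: W_meas.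
- have h := avg_proj_cell (cell1_family hOm hM) (Bop Om u) q.
  have sub : Om `&` A `<=` cell1 q by move=> x [_ /Aq xq]; exact: csub_cell1.
  by refine (ae_on_map (ae_on_subset sub h) _) => x _; rewrite /P1h => ->.
Qed.

(** The midpoint of an edge cuts its subtriangle into halves of equal area; this gives the weights
    [ccross / 2]. *)
Lemma cell_avg2 u q : inVh Om sides GD M u ->
  fine (area (cell2 q)) *: cell_avg Om (cell2 q) (P1h Om M (Bop Om u)) =
  (kap / 2) *: (ccross (cprev q) *: avg1 u (cprev q) + ccross q *: avg1 u q).
Proof.
move=> hu; have W : inW Om (P1h Om M (Bop Om u)) := avg_proj_inW mOm fOm (cell1_family hOm hM) (Bop Om u).
have /andP[a0 aoo] := area_cell_gt0 (cell2_family hOm hM) q.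
have A0 : fine (area (cell2 q)) != 0 by rewrite gt_eqF// fine_gt0// a0.
have m1 := measurable_half1 hP q; have m2 := measurable_half2 hP (cprev q).
have e1 i := int_P1h_half i hu m1 (@half1_sub _ _ _ q).
have e2 i := int_P1h_half i hu m2 (@half2_sub _ _ _ (cprev q)).
move: (avg1 u (cprev q)) (avg1 u q) (P1h Om M (Bop Om u)) W e1 e2 => a1 a2 f W e1 e2.
rewrite /cell_avg scalerA mulfV// scale1r.
apply/matrixP => i j; rewrite !mxE {j}[j]ord1.
rewrite cell2E setIUr int_on_setU.
- by rewrite e1 e2 area_half1// area_half2//= -/kap; field.
- exact: (measurableI _ _ mOm m2).
- exact: (measurableI _ _ mOm m1).
- by apply: area_negligibleS (negligible_half21 hM (cprev q) q) => x [[_ ?] [_ ?]].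
- by rewrite -setIUr; apply: (W_int _ W); exact: (measurableU _ _ m2 m1).
Qed.

Lemma smoothed_injective u : inVh Om sides GD M u -> ae_on Om (fun x => smoothed Om M u x = 0) ->
  ae_on Om (fun x => Bop Om u x = 0).
Proof.
move=> hu s0.
have avg0 q : cell_avg Om (cell2 q) (P1h Om M (Bop Om u)) = 0.
  have h := avg_proj_cell (cell2_family hOm hM) (P1h Om M (Bop Om u)) q.
  have sub1 : Om `&` cell2 q `<=` cell2 q by move=> x [].
  have sub2 : Om `&` cell2 q `<=` Om by move=> x [].
  have h' : ae_on (Om `&` cell2 q) (fun x => cell_avg Om (cell2 q) (P1h Om M (Bop Om u)) = 0).
    refine (ae_on_map2 (ae_on_subset sub1 h) (ae_on_subset sub2 s0) _) => x _.
    by rewrite /smoothed /P2h => ->.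
  (* A constant that vanishes almost everywhere on a set of positive area is zero. *)
  apply: contrapT => n0.
  have /andP[a0 _] := area_cell_gt0 (cell2_family hOm hM) q.
  have mc := measurable_cell2 hM q.
  have nO : (@area R).-negligible (Om `&` cell2 q).
    by apply: area_negligibleS h' => x xO /= /(_ xO).
  move: a0; rewrite -(area_inside hOm mc (cell2_closure hM (q := q))).
  by have /(area_negligibleP (measurableI _ _ mOm mc)) -> := nO; rewrite ltxx.
have cs0 q : cstrain u q = 0.
  apply: (smoothed_strain_eq0 hP hC (fun T => inVh_center T hu) (G := avg1 u)).
  - by move=> q' q''; exact: avg1_same_edge.
  - move=> q'; rewrite -avg1_sum// scaler_suml; apply: eq_bigr => q'' /avg1_same_edge e.
    by rewrite (e u).
  - move=> q'; apply: (can_inj (scalerK (_ : kap / 2 != 0))).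
      by rewrite mulf_neq0// invr_eq0 pnatr_eq0.
    by rewrite -cell_avg2// avg0 !scaler0.
have all0 : ae_on Om (fun x => forall q, csub q x -> Bop Om u x = 0).
  apply: ae_on_forall => q.
  have h := Bop_csub q hu.
  apply: (@filterS _ _ (@ae_filter_ringOfSetsType _ _ _ (@area R)) _ _ _ h) => x hx Ox xq.
  by rewrite (hx (conj Ox xq)) /strain_value cs0 scaler0.
refine (ae_on_map all0 _) => x Ox hx; have [q _ xq] := Om_csub hM Ox; exact: hx xq.
Qed.

End Coercivity.

(** * Solvability of a finite-dimensional semidefinite problem *)

Section Galerkin.
Context {R : realFieldType} {E : Type} (V : E -> Prop) (lin : R -> E -> E -> E) (z : E).
Context {m : nat} (N : E -> 'rV[R]_m) (A : E -> E -> R) (f : E -> R).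
Hypothesis Vz : V z.
Hypothesis Vlin : forall a u v, V u -> V v -> V (lin a u v).
Hypothesis Nlin : forall a u v, V u -> V v -> N (lin a u v) = a *: N u + N v.
Hypothesis flin : forall a u v, V u -> V v -> f (lin a u v) = a * f u + f v.
Hypothesis Alin : forall a u v w, V u -> V v -> V w -> A (lin a u v) w = a * A u w + A v w.
Hypothesis Asym : forall u v, V u -> V v -> A u v = A v u.
Hypothesis Nz : N z = 0.
Hypothesis fz : f z = 0.
Hypothesis Az : forall v, V v -> A z v = 0.
Hypothesis ker_N : forall u, V u -> N u = 0 -> A u u = 0.
Hypothesis ker_A : forall u, V u -> A u u = 0 -> f u = 0 /\ forall v, V v -> A u v = 0.

Let Nmx p (w : 'I_p -> E) : 'M[R]_(p, m) := \matrix_(i, j) N (w i) ord0 j.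

(** [E] carries no vector space structure, and finite dimension shows only through [N]. A finite
    family for which the matrix of [N]-values has maximal rank spans: adjoining [u] cannot raise the
    rank. *)
Lemma spanning_family : exists p (w : 'I_p -> E), (forall i, V (w i)) /\
  forall u, V u -> (N u <= Nmx w)%MS.
Proof.
pose P r := `[< exists p (w : 'I_p -> E), (forall i, V (w i)) /\ \rank (Nmx w) = r >].
have P0 : exists r, P r.
  by exists (\rank (Nmx (fun _ : 'I_0 => z))); apply/asboolP; exists 0, (fun=> z).
have Pm r : P r -> (r <= m)%N by move=> /asboolP[p [w [_ <-]]]; exact: rank_leq_col.
case: (ex_maxnP P0 Pm) => r /asboolP[p [w [Vw rw]]] rmax.
exists p, w; split => // u Vu.
pose w' (i : 'I_p.+1) := if unlift ord0 i is Some j then w j else u.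
have Vw' i : V (w' i) by rewrite /w'; case: unlift.
have rw' : (\rank (Nmx w') <= r)%N by apply: rmax; apply/asboolP; exists p.+1, w'.
have sub : (Nmx w <= Nmx w')%MS.
  apply/row_subP => i.
  rewrite (_ : row i (Nmx w) = row (lift ord0 i) (Nmx w')) ?row_sub//.
  by apply/rowP => j; rewrite !mxE /w' liftK.
have subu : (N u <= Nmx w')%MS.
  rewrite (_ : N u = row ord0 (Nmx w')) ?row_sub//.
  by apply/rowP => j; rewrite !mxE /w' unlift_none.
apply: submx_trans subu _.
have [le eqr] := mxrank_leqif_sup sub.
by rewrite -eqr eqn_leq le/= rw.
Qed.

(** Linear combinations are built by iterating [lin] from [z], while recording their effect on [N],
    [f] and [A]. *)
Lemma combination p (w : 'I_p -> E) (x : 'rV[R]_p) : (forall i, V (w i)) ->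
  exists e, [/\ V e, N e = x *m Nmx w, f e = \sum_i x ord0 i * f (w i) &
    forall v, V v -> A e v = \sum_i x ord0 i * A (w i) v].
Proof.
move=> Vw.
suff [e [Ve Ne fe Ae]] : exists e, [/\ V e, N e = \sum_(i <- index_enum 'I_p) x ord0 i *: N (w i),
    f e = \sum_(i <- index_enum 'I_p) x ord0 i * f (w i) &
    forall v, V v -> A e v = \sum_(i <- index_enum 'I_p) x ord0 i * A (w i) v].
  exists e; split => //; rewrite Ne; apply/rowP => j; rewrite summxE !mxE.
  by apply: eq_bigr => i _; rewrite !mxE.
elim: (index_enum 'I_p) => [|i s [e [Ve Ne fe Ae]]].
  by exists z; split; rewrite ?big_nil// => v Vv; rewrite big_nil Az.
exists (lin (x ord0 i) (w i) e); split; rewrite ?big_cons.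
- exact: Vlin.
- by rewrite Nlin// Ne.
- by rewrite flin// fe.
- by move=> v Vv; rewrite big_cons Alin// Ae.
Qed.

(* The Gram matrix of a spanning family may be singular, but its kernel is killed by the
   load, so that the load lies in its row space. *)
Lemma galerkin_solvable : exists u, V u /\ forall v, V v -> A u v = f v.
Proof.
have [p [w [Vw span]]] := spanning_family.
pose G : 'M[R]_p := \matrix_(i, j) A (w i) (w j).
pose F : 'rV[R]_p := \row_j f (w j).
have FG : (F <= G)%MS.
  rewrite submxE; apply/eqP/rowP => j; rewrite [RHS]mxE.
  have Gk : G *m col j (cokermx G) = 0 by rewrite !colE mulmxA mulmx_coker mul0mx.
  set y := col j (cokermx G) in Gk.
  have [e [Ve _ fe Ae]] := combination y^T Vw.
  have Aew i : A e (w i) = 0.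
    rewrite Ae//; transitivity ((G *m y) i ord0); last by rewrite Gk mxE.
    by rewrite [RHS]mxE; apply: eq_bigr => l _; rewrite !mxE mulrC Asym.
  have [fe0 _] : f e = 0 /\ forall v, V v -> A e v = 0.
    apply: ker_A => //; rewrite Ae// big1// => i _.
    by rewrite Asym// Aew mulr0.
  rewrite mxE -[RHS]fe0 fe; apply: eq_bigr => i _; by rewrite !mxE mulrC.
have [x Fx] := submxP FG.
have [u [Vu _ _ Au]] := combination x Vw.
have Auw j : A u (w j) = f (w j).
  rewrite Au//; have /rowP/(_ j) := Fx; rewrite !mxE => ->.
  by apply: eq_bigr => i _; rewrite !mxE.
exists u; split => // v Vv.
have [c Nc] := submxP (span v Vv).
have [e [Ve Ne fe Ae]] := combination c Vw.
(* The difference of [v] and the combination [e] is killed by [N], so it contributes neither energy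
   nor load, and testing with [v] amounts to testing with [e]. *)
have Vd : V (lin (-1) e v) by exact: Vlin.
have Nd : N (lin (-1) e v) = 0 by rewrite Nlin// Ne -Nc scaleN1r addNr.
have [fd Ad] := ker_A Vd (ker_N Vd Nd).
have fe_v : f v = f e by move: fd; rewrite flin// => /eqP; rewrite mulN1r addrC subr_eq0 => /eqP.
have Ae_v : A v u = A e u.
  by have := Ad u Vu; rewrite Alin// => /eqP; rewrite mulN1r addrC subr_eq0 => /eqP.
rewrite Asym// Ae_v Ae// fe_v fe; apply: eq_bigr => i _.
by rewrite Asym// Auw.
Qed.

End Galerkin.

(** * The inner product weighted by [D] *)

Section InnerProduct.
Context {R : realType} (Om : set (plane R)).
Hypothesis mOm : measurable Om.
Hypothesis finOm : (area Om < +oo)%E.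
Implicit Types (s e : plane R -> 'cV[R]_3).

Lemma ipW0l e : ipW Om (fun=> 0) e = 0.
Proof.
rewrite /ipW -[RHS](int_on0 Om); congr int_on; apply/funext => x.
by rewrite /dot3 big1// => i _; rewrite mxE mul0r.
Qed.

Lemma ipW0r e : ipW Om e (fun=> 0) = 0.
Proof. by rewrite ipWC ipW0l. Qed.

Lemma ipW_mulmx_sym (D : 'M[R]_3) s e : D^T = D ->
  ipW Om (fun x => D *m s x) e = ipW Om (fun x => D *m e x) s.
Proof.
move=> Dsym; rewrite ipWC; congr int_on; apply/funext => x.
by rewrite -dot3_mulmx.
Qed.

Lemma ipW_mulmx_lin (D : 'M[R]_3) (a : R) s s' s'' e : inW Om s -> inW Om s' -> inW Om e ->
  (forall x, s'' x = a *: s x + s' x) ->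
  ipW Om (fun x => D *m s'' x) e = a * ipW Om (fun x => D *m s x) e + ipW Om (fun x => D *m s' x) e.
Proof.
move=> Ws Ws' We ss''; rewrite -(ipW_linl mOm a (inW_mulmx mOm finOm D Ws) (inW_mulmx mOm finOm D Ws') We).
by congr ipW; apply/funext => x; rewrite ss'' mulmxDr scalemxAr.
Qed.

Lemma ipW_mulmx_eq0 (D : 'M[R]_3) s : sym_posdef D -> inW Om s ->
  ipW Om (fun x => D *m s x) s = 0 -> ae_on Om (fun x => s x = 0).
Proof.
move=> [_ Dpd] Ws e0; have Dpos (e : 'cV[R]_3) : 0 <= dot3 (D *m e) e.
  have [->|n0] := eqVneq e 0; last exact: ltW (Dpd e n0).
  by rewrite /dot3 big1// => i _; rewrite [X in _ * X]mxE mulr0.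
have h := int_on_eq0 mOm (ipW_integrable mOm (inW_mulmx mOm finOm D Ws) Ws) (fun x _ => Dpos (s x)) e0.
refine (ae_on_map h _) => x _; apply: contra_eq => n0.
by rewrite gt_eqF//; exact: Dpd.
Qed.

Lemma ipW_mulmx0 (D : 'M[R]_3) s e : s = (fun=> 0) -> ipW Om (fun x => D *m s x) e = 0.
Proof.
by move=> ->; rewrite mulmx0 ipW0l.
Qed.

End InnerProduct.

Lemma avg_proj0 {R : realType} {k} (Om : set (plane R)) (M : mesh R k) (cell : corner M -> set (plane R)) :
  avg_proj Om cell (fun=> 0) = (fun=> 0).
Proof.
apply/funext => x; rewrite /avg_proj; case: pickP => // q _.
by apply/matrixP => i j; rewrite !mxE int_on0 mulr0.
Qed.

(** * The mixed system for two abstract families of cells *)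

Section TwoAverages.
Context {R : realType} {k : elt_kind} (Om : set (plane R)) (M : mesh R k).
Context (cA cB : corner M -> set (plane R)).
Hypothesis mOm : measurable Om.
Hypothesis finOm : (area Om < +oo)%E.
Hypothesis hA : cell_family Om cA.
Hypothesis hB : cell_family Om cB.
Let PA := avg_proj Om cA.
Let PB := avg_proj Om cB.
Implicit Types (s e w : plane R -> 'cV[R]_3).

(** [PA] is self-adjoint, and [PB] may be inserted because [s] is constant on the cells of [cB].
    This turns the work of the first stress on an exact strain into that of the second on a smoothed
    strain. *)
Lemma avg_proj_comp_ipW s e : inW Om e -> inWh Om cB s ->
  ipW Om (PA s) e = ipW Om s (PB (PA e)).
Proof.
move=> We Hs; have [Ws _] := Hs.
have WA := avg_proj_inWh mOm finOm hA.
rewrite ipWC -(avg_proj_ipW mOm finOm hA We (WA s)) ipWC.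
rewrite (avg_proj_ipW mOm finOm hA Ws (WA e)) ipWC.
by rewrite -(avg_proj_ipW mOm finOm hB (WA e).1 Hs) ipWC.
Qed.

(* The five unknowns are recovered one after the other from the block
   triangular system obtained by varying one test function at a time. *)
Lemma mixed_system_solution (D : 'M[R]_3) (V : Type) (F : V -> R) (B : V -> plane R -> 'cV[R]_3)
    (Bu e1 e2 s1 s2 : plane R -> 'cV[R]_3) (v0 : V) :
  inW Om Bu -> (forall v, inW Om (B v)) -> F v0 = 0 -> ae_on Om (fun x => B v0 x = 0) ->
  inWh Om cA e1 -> inWh Om cB e2 -> inWh Om cA s1 -> inWh Om cB s2 ->
  (forall v d1 d2, inWh Om cA d1 -> inWh Om cB d2 ->
     ipW Om s1 (B v) + ipW Om (fun x => - s1 x + s2 x) d1 +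
     ipW Om (fun x => D *m e2 x - s2 x) d2 = F v) ->
  (forall t1 t2, inWh Om cA t1 -> inWh Om cB t2 ->
     ipW Om t1 (fun x => Bu x - e1 x) + ipW Om t2 (fun x => e1 x - e2 x) = 0) ->
  let E := PB (PA Bu) in
  [/\ ae_on Om (fun x => e1 x = PA Bu x), ae_on Om (fun x => e2 x = E x),
      ae_on Om (fun x => s1 x = PA (fun y => D *m E y) x),
      ae_on Om (fun x => s2 x = D *m E x) &
      forall v, ipW Om (fun x => D *m E x) (PB (PA (B v))) = F v].
Proof.
move=> WBu WB F0 B0 He1 He2 Hs1 Hs2 eqF eqT E.
have [We1 _] := He1; have [We2 _] := He2; have [Ws1 _] := Hs1; have [Ws2 _] := Hs2.
have A0 := inWh0 mOm finOm cA; have B00 := inWh0 mOm finOm cB.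
have W0 := inW0 mOm finOm.
have HE : inWh Om cB E := avg_proj_inWh mOm finOm hB (PA Bu).
have HDE := inWh_mulmx mOm finOm D HE.
have WDe2 := inW_mulmx mOm finOm D We2.
(* The test displacement [v0] has no load and no strain, so it isolates the equations tested by [d1]
   and [d2]. *)
have sBv0 : ipW Om s1 (B v0) = 0.
  by rewrite (ipW_ae mOm Ws1 (WB v0) Ws1 W0 (ae_onW _) B0) ?ipW0r.
have h1 : ae_on Om (fun x => e1 x = PA Bu x).
  apply: (avg_proj_unique mOm finOm hA WBu He1) => w Hw; have [Ww _] := Hw.
  have := eqT w _ Hw B00; rewrite ipW0l addr0 (ipWB mOm Ww WBu We1) => /eqP.
  by rewrite subr_eq0 => /eqP e; rewrite ipWC -e ipWC.
have h2 : ae_on Om (fun x => e2 x = E x).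
  have <- : PB e1 = E by exact: (avg_proj_ext mOm hB We1 (avg_proj_inW mOm finOm hA Bu) h1).
  apply: (avg_proj_unique mOm finOm hB We1 He2) => w Hw; have [Ww _] := Hw.
  have := eqT _ w A0 Hw; rewrite ipW0l add0r (ipWB mOm Ww We1 We2) => /eqP.
  by rewrite subr_eq0 => /eqP e; rewrite ipWC -e ipWC.
have h4' : ae_on Om (fun x => D *m e2 x - s2 x = 0).
  apply: (inWh_orthogonal mOm (inWhB mOm (inWh_mulmx mOm finOm D He2) Hs2)) => w Hw.
  by have := eqF v0 _ w A0 Hw; rewrite F0 sBv0 ipW0r !add0r.
have h4 : ae_on Om (fun x => s2 x = D *m E x).
  by refine (ae_on_map2 h2 h4' _) => x _ -> /eqP; rewrite subr_eq0 => /eqP ->.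
have h3' : ae_on Om (fun x => s1 x = PA s2 x).
  apply: (avg_proj_unique mOm finOm hA Ws2 Hs1) => w Hw; have [Ww _] := Hw.
  have := eqF v0 w _ Hw B00; rewrite F0 sBv0 ipW0r add0r addr0.
  rewrite (_ : (fun x => - s1 x + s2 x) = (fun x => s2 x - s1 x)); last first.
    by apply/funext => x; rewrite addrC.
  by rewrite (ipWBl mOm Ws2 Ws1 Ww) => /eqP; rewrite subr_eq0 => /eqP ->.
have e3 : PA s2 = PA (fun y => D *m E y) by exact: (avg_proj_ext mOm hA Ws2 HDE.1 h4).
split; [exact: h1|exact: h2|by rewrite -e3; exact: h3'|exact: h4|].
move=> v; have := eqF v _ _ A0 B00; rewrite !ipW0r !addr0 => <-.
rewrite -(avg_proj_comp_ipW (WB v) HDE) -e3.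
have WPs := avg_proj_inW mOm finOm hA s2.
by apply: (ipW_ae mOm WPs (WB v) Ws1 (WB v)); [refine (ae_on_map h3' _)|exact: ae_onW].
Qed.

Lemma mixed_system_holds (D : 'M[R]_3) (Bu Bv d1 d2 t1 t2 : plane R -> 'cV[R]_3) :
  inW Om Bu -> inW Om Bv -> inWh Om cA d1 -> inWh Om cB d2 -> inWh Om cA t1 -> inWh Om cB t2 ->
  let E := PB (PA Bu) in let s2 := fun x => D *m E x in
  ipW Om (PA s2) Bv + ipW Om (fun x => - PA s2 x + s2 x) d1 +
     ipW Om (fun x => D *m E x - s2 x) d2 = ipW Om s2 (PB (PA Bv)) /\
  ipW Om t1 (fun x => Bu x - PA Bu x) + ipW Om t2 (fun x => PA Bu x - E x) = 0.
Proof.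
move=> WBu WBv Hd1 Hd2 Ht1 Ht2 E s2.
have HE : inWh Om cB E := avg_proj_inWh mOm finOm hB (PA Bu).
have Hs2 : inWh Om cB s2 := inWh_mulmx mOm finOm D HE.
have WA e : inW Om (PA e) := avg_proj_inW mOm finOm hA e.
split.
  rewrite (avg_proj_comp_ipW WBv Hs2).
  rewrite (_ : (fun x => - PA s2 x + s2 x) = (fun x => s2 x - PA s2 x)); last first.
    by apply/funext => x; rewrite addrC.
  rewrite (_ : (fun x => D *m E x - s2 x) = (fun=> 0)); last first.
    by apply/funext => x; rewrite subrr.
  by rewrite ipW0l (ipWBl mOm Hs2.1 (WA s2) Hd1.1) (avg_proj_ipW mOm finOm hA Hs2.1 Hd1) subrr !addr0.
rewrite (ipWB mOm Ht1.1 WBu (WA Bu)) (ipWB mOm Ht2.1 (WA Bu) HE.1).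
rewrite [X in _ - X]ipWC (avg_proj_ipW mOm finOm hA WBu Ht1) [X in X - _]ipWC subrr add0r.
by rewrite [X in _ - X]ipWC (avg_proj_ipW mOm finOm hB (WA Bu) Ht2) [X in X - _]ipWC subrr.
Qed.

End TwoAverages.

(** * The smoothed problem and its equivalence with the mixed one *)

Section MixedProblem.
Context {R : realType} (Om : set (plane R)) (sides : seq (plane R * plane R)) (GD : set (plane R)).
Context (D : 'M[R]_3) (b t : plane R -> plane R) (f : (plane R -> plane R) -> R).
Context {k : elt_kind} (M : mesh R k).
Hypothesis hOm : polygonal_domain Om sides.
Hypothesis hD : sym_posdef D.
Hypothesis ha : aform_admissible Om sides GD D.
Hypothesis hf : load Om sides GD b t f.
Hypothesis hM : subdivision Om M.
Implicit Types (u v : plane R -> plane R) (e s : plane R -> 'cV[R]_3) (q : corner M).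

Let oOm := polygonal_open hOm.
Let bOm := polygonal_bounded hOm.
Let mOm := measurable_domain oOm.
Let fOm := area_domain oOm bOm.
Let c1 := cell1_family hOm hM.
Let c2 := cell2_family hOm hM.
Let Vh := inVh Om sides GD M.
Let W1 := inWh Om (cell1 (M := M)).
Let W2 := inWh Om (cell2 (M := M)).
Let lin (a : R) u v : plane R -> plane R := fun x => a *: u x + v x.
Let S := smoothed Om M.
Let P1 := P1h Om M.
Let P2 := P2h Om M.

Lemma P1_on_lin (A : set (plane R)) (a : R) u v : P1_on A u -> P1_on A v ->
  P1_on A (fun x => a *: u x + v x).
Proof.
move=> [a1 [b1 [d1 h1]]] [a2 [b2 [d2 h2]]].
exists (a *: a1 + a2), (a *: b1 + b2), (a *: d1 + d2) => x Ax; rewrite h1// h2//.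
apply/eqP; rewrite -pair_eqE /pair_eq/= /GRing.scale/=.
by apply/andP; split; apply/eqP; ring.
Qed.

Lemma inVh_lin (a : R) u v : Vh u -> Vh v -> Vh (lin a u v).
Proof.
rewrite /Vh /lin => -[Vu hu] [Vv hv]; split; first exact: (inV_lin oOm bOm a Vu Vv).
case: k M hu hv => M' hu hv.
  by move=> T; exact: P1_on_lin.
case: hu hv => hu1 hu2 [hv1 hv2]; split; first by move=> T i; exact: P1_on_lin.
move=> T; rewrite hu2 hv2 big_split/= -scaler_sumr scalerDr !scalerA.
by rewrite [a * _]mulrC.
Qed.

Lemma inVh0 : Vh (fun=> 0).
Proof.
split; first exact: (inV0 sides GD oOm bOm).
have P0 (A : set (plane R)) : P1_on A (fun=> 0).
  by exists 0, 0, 0 => x _; rewrite !scaler0 !addr0.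
case: k M => M'; first by move=> T; exact: P0.
split; first by move=> T i; exact: P0.
by move=> T; rewrite big1// scaler0.
Qed.

Lemma Bop_Vh u : Vh u -> inW Om (Bop Om u).
Proof. by move=> [Vu _]; exact: (Bop_inW oOm Vu). Qed.

Lemma P1_W1 e : W1 (P1 e). Proof. exact: (avg_proj_inWh mOm fOm c1). Qed.
Lemma P2_W2 e : W2 (P2 e). Proof. exact: (avg_proj_inWh mOm fOm c2). Qed.
Lemma P1_W e : inW Om (P1 e). Proof. by have [] := P1_W1 e. Qed.
Lemma P2_W e : inW Om (P2 e). Proof. by have [] := P2_W2 e. Qed.

Lemma smoothed_lin (a : R) u v x : Vh u -> Vh v -> S (lin a u v) x = a *: S u x + S v x.
Proof.
move=> hu hv; have [Vu _] := hu; have [Vv _] := hv.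
have Wu := Bop_Vh hu; have Wv := Bop_Vh hv.
rewrite /S /smoothed.
have -> : P1h Om M (Bop Om (lin a u v)) = (fun y => a *: P1 (Bop Om u) y + P1 (Bop Om v) y).
  apply/funext => y; rewrite /P1 /P1h -(avg_proj_lin mOm fOm c1 a y Wu Wv).
  have := avg_proj_ext mOm c1 (Bop_Vh (inVh_lin a hu hv)) (inW_lin mOm a Wu Wv) (Bop_lin oOm bOm a Vu Vv).
  by move=> ->.
exact: (avg_proj_lin mOm fOm c2 a x (P1_W (Bop Om u)) (P1_W (Bop Om v))).
Qed.

Definition energy u v : R := ipW Om (fun x => D *m S u x) (S v).

Lemma smoothed_W u : inW Om (S u). Proof. exact: P2_W. Qed.

Lemma energy_sym u v : energy u v = energy v u.
Proof. by have [Dsym _] := hD; exact: (ipW_mulmx_sym Om (S u) (S v) Dsym). Qed.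

Lemma energy_lin (a : R) u v w : Vh u -> Vh v -> energy (lin a u v) w = a * energy u w + energy v w.
Proof.
move=> hu hv; have hS x := smoothed_lin a x hu hv.
exact: (ipW_mulmx_lin mOm fOm D (smoothed_W u) (smoothed_W v) (smoothed_W w) hS).
Qed.

Lemma energy_eq0 u : energy u u = 0 -> ae_on Om (fun x => S u x = 0).
Proof. exact: (ipW_mulmx_eq0 mOm fOm hD (smoothed_W u)). Qed.

Lemma smoothed_Bop0 u : Vh u -> ae_on Om (fun x => Bop Om u x = 0) -> S u = (fun=> 0).
Proof.
move=> hu B0; rewrite /S /smoothed /P1h.
by rewrite (avg_proj_ext mOm c1 (Bop_Vh hu) (inW0 mOm fOm) B0) avg_proj0; exact: avg_proj0.
Qed.

Lemma energy_Bop0 u v : Vh u -> ae_on Om (fun x => Bop Om u x = 0) -> energy u v = 0.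
Proof. by move=> hu B0; exact: (ipW_mulmx0 Om D (S v) (smoothed_Bop0 hu B0)). Qed.

(** Coercivity of the exact form plays the part of Korn's inequality here: it excludes rigid
    motions. *)
Lemma Bop_eq0_Vsqnorm u : Vh u -> ae_on Om (fun x => Bop Om u x = 0) -> Vsqnorm Om u = 0.
Proof.
move=> hu B0; have [Vu _] := hu; have W := Bop_Vh hu.
have [_ _ [al al0 /(_ u Vu)]] := ha.
have W0 := inW0 mOm fOm.
have -> : aform Om D u u = 0.
  rewrite -(ipW0l Om (fun=> 0)).
  apply: (ipW_ae mOm (inW_mulmx mOm fOm D W) W W0 W0) => //.
  by refine (ae_on_map B0 _) => x _ ->; rewrite mulmx0.
rewrite pmulr_rle0// => le0; apply/eqP; rewrite eq_le le0 /Vsqnorm addr_ge0//; exact: H1sqnorm_ge0.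
Qed.

Lemma Bop_eq0_ae u : Vh u -> ae_on Om (fun x => Bop Om u x = 0) -> ae_on Om (fun x => u x = 0).
Proof.
move=> hu B0; have [[h1 h2 _] _] := hu.
have /eqP := Bop_eq0_Vsqnorm hu B0; rewrite /Vsqnorm paddr_eq0; [|exact: H1sqnorm_ge0|exact: H1sqnorm_ge0].
move=> /andP[/eqP e1 /eqP e2].
refine (ae_on_map2 (H1sqnorm_eq0 oOm h1 e1) (H1sqnorm_eq0 oOm h2 e2) _) => x _ p1 p2.
by rewrite [u x]surjective_pairing; congr (_, _).
Qed.

Lemma load_eq0 u : Vh u -> ae_on Om (fun x => Bop Om u x = 0) -> f u = 0.
Proof.
move=> hu B0; have [Vu _] := hu; have [_ [c hc] _] := hf.
have := hc u Vu; rewrite (Bop_eq0_Vsqnorm hu B0) sqrtr0 mulr0.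
by rewrite normr_le0 => /eqP.
Qed.

(** One entry per element corner and component. Nodes shared by several elements are repeated, which
    spares identifying them and leaves the kernel unchanged. *)
Definition nodal u : 'rV[R]_(#|{: corner M * bool}|) :=
  \row_j let p := enum_val j in if p.2 then (u (cnode p.1)).1 else (u (cnode p.1)).2.

(** The center value is the mean of the nodal values, so [u] vanishes at all three vertices of each
    subtriangle, on which it is affine. *)
Lemma nodal_eq0 u : Vh u -> nodal u = 0 -> forall x, Om x -> u x = 0.
Proof.
move=> hu n0.
have nz q : u (cnode q) = 0.
  have nv c : (if c then (u (cnode q)).1 else (u (cnode q)).2) = 0.
    by have /rowP/(_ (enum_rank (q, c))) := n0; rewrite !mxE enum_rankK.
  by rewrite [u _]surjective_pairing (nv true) (nv false).
have nx q : u (cnext q) = 0 by exact: (nz (q.1, ordS q.2)).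
have nc q : u (ccenter q) = 0.
  rewrite /ccenter (inVh_center _ hu) big1 ?scaler0// => i _; exact: (nz (q.1, i)).
move=> x /(Om_csub hM)[q _ xq].
have [a [b' [d h]]] := inVh_P1 q hu.
have [qc qn qx] := csub_corner q.
have := nc q; have := nz q; have := nx q.
rewrite (h _ qc) (h _ qn) (h _ qx) (h _ xq).
case: xq => al [be [ga [_ _ _ s1 ->]]].
rewrite -/(ccenter q) -/(cnode q) -/(cnext q).
move: (ccenter q) (cnode q) (cnext q) => o p r e1 e2 e3.
transitivity (al *: (a + o.1 *: b' + o.2 *: d) + be *: (a + p.1 *: b' + p.2 *: d) +
  ga *: (a + r.1 *: b' + r.2 *: d)); last by rewrite e1 e2 e3 !scaler0 !addr0.
have -> : al = 1 - be - ga by rewrite -s1; ring.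
apply/eqP; rewrite -pair_eqE /pair_eq/= /GRing.scale/=.
by apply/andP; split; apply/eqP; ring.
Qed.

Lemma energy_ker u : Vh u -> energy u u = 0 ->
  f u = 0 /\ forall v, Vh v -> energy u v = 0.
Proof.
move=> hu e0; have B0 := smoothed_injective hOm hM hu (energy_eq0 e0).
by split=> [|v _]; [exact: load_eq0|exact: energy_Bop0].
Qed.

Lemma load_lin (a : R) u v : Vh u -> Vh v -> f (lin a u v) = a * f u + f v.
Proof. by move=> [Vu _] [Vv _]; have [fl _ _] := hf; exact: fl. Qed.

Lemma smoothed_exists : exists u, Vh u /\ forall v, Vh v -> energy u v = f v.
Proof.
have B00 : ae_on Om (fun x => Bop Om (fun=> 0) x = 0).
  by have [V0 _] := inVh0; exact: (Bop_eq0 oOm bOm V0 (fun x _ => erefl)).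
apply: (@galerkin_solvable R _ Vh lin (fun=> 0) _ nodal energy f).
- exact: inVh0.
- exact: inVh_lin.
- move=> a u v hu hv; apply/rowP => j; rewrite !mxE /lin.
  by case: (enum_val j) => q [].
- exact: load_lin.
- by move=> a u v w hu hv _; exact: energy_lin.
- by move=> u v _ _; exact: energy_sym.
- by apply/rowP => j; rewrite !mxE; case: (enum_val j) => q [].
- exact: load_eq0 inVh0 B00.
- by move=> v _; exact: energy_Bop0 inVh0 B00.
- move=> u hu n0; have [Vu _] := hu.
  exact: energy_Bop0 hu (Bop_eq0 oOm bOm Vu (nodal_eq0 hu n0)).
- exact: energy_ker.
Qed.

(** Equality of the strains is recorded as well: it is what carries uniqueness over to the other
    four unknowns. *)
Lemma smoothed_unique u u' : (Vh u /\ forall v, Vh v -> energy u v = f v) ->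
  (Vh u' /\ forall v, Vh v -> energy u' v = f v) ->
  ae_on Om (fun x => u' x = u x) /\ ae_on Om (fun x => Bop Om u' x = Bop Om u x).
Proof.
move=> [hu su] [hu' su']; pose w := lin (-1) u u'.
have hw : Vh w by exact: inVh_lin.
have B0 : ae_on Om (fun x => Bop Om w x = 0).
  apply: (smoothed_injective hOm hM hw); apply: energy_eq0.
  by rewrite energy_lin// su// su'// mulN1r addNr.
split.
  refine (ae_on_map (Bop_eq0_ae hw B0) _) => x _; rewrite /w /lin scaleN1r addrC.
  by move=> /eqP; rewrite subr_eq0 => /eqP.
have [Vu _] := hu; have [Vu' _] := hu'.
refine (ae_on_map2 B0 (Bop_lin oOm bOm (-1) Vu Vu') _) => x _ h1 h2.
by move: h2; rewrite [LHS]h1 scaleN1r addrC => /esym/eqP; rewrite subr_eq0 => /eqP.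
Qed.

(** [P2] fixes the elements of [W2] almost everywhere, and averages do not see null sets. This
    reconciles the stress found for the abstract system with the stated formula. *)
Lemma P1_P2 s : W2 s -> P1 (P2 s) = P1 s.
Proof.
move=> Hs; apply: (avg_proj_ext mOm c1 (P2_W _) Hs.1).
by refine (ae_on_map (avg_proj_id mOm fOm c2 Hs) _) => x _ /esym.
Qed.

Lemma smoothed_mixed_solution u : smoothed_solution Om sides GD M D f u ->
  mixed_solution Om sides GD M D f u (P1 (Bop Om u)) (S u)
    (P1 (P2 (fun x => D *m S u x))) (fun x => D *m S u x).
Proof.
move=> [hu su]; have WBu := Bop_Vh hu.
have HS : W2 (S u) := P2_W2 _.
have HDS : W2 (fun x => D *m S u x) := inWh_mulmx mOm fOm D HS.
rewrite (P1_P2 HDS).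
split.
- exact: hu.
- split; [exact: P1_W1|exact: HS|exact: P1_W1|exact: HDS].
- move=> v d1 d2 hv Hd1 Hd2; rewrite -(su v hv).
  by have [] := mixed_system_holds mOm fOm c1 c2 D WBu (Bop_Vh hv) Hd1 Hd2 Hd1 Hd2.
- move=> t1 t2 Ht1 Ht2.
  by have [] := mixed_system_holds mOm fOm c1 c2 D WBu WBu Ht1 Ht2 Ht1 Ht2.
Qed.

Lemma mixed_solution_smoothed u e1 e2 s1 s2 : mixed_solution Om sides GD M D f u e1 e2 s1 s2 ->
  [/\ smoothed_solution Om sides GD M D f u,
      ae_on Om (fun x => e1 x = P1 (Bop Om u) x), ae_on Om (fun x => e2 x = S u x),
      ae_on Om (fun x => s1 x = P1 (P2 (fun x => D *m S u x)) x) &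
      ae_on Om (fun x => s2 x = D *m S u x)].
Proof.
move=> [hu [He1 He2 Hs1 Hs2] eqF eqT].
have HDS : W2 (fun x => D *m S u x) := inWh_mulmx mOm fOm D (P2_W2 _).
rewrite (P1_P2 HDS).
have [V0 _] := inVh0; have B00 := Bop_eq0 oOm bOm V0 (fun x _ => erefl).
(* The abstract system lets its test displacements range over a type, whence the subtype. *)
pose T := {v : plane R -> plane R | Vh v}; pose v0 : T := exist _ (fun=> 0) inVh0.
have [h1 h2 h3 h4 h5] := @mixed_system_solution R k Om M _ _ mOm fOm c1 c2 D T
  (fun v : T => f (sval v)) (fun v : T => Bop Om (sval v)) (Bop Om u) e1 e2 s1 s2 v0
  (Bop_Vh hu) (fun v : T => Bop_Vh (svalP v)) (load_eq0 inVh0 B00) B00 He1 He2 Hs1 Hs2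
  (fun (v : T) d1 d2 => eqF (sval v) d1 d2 (svalP v)) eqT.
split; [|exact: h1|exact: h2|exact: h3|exact: h4].
by split=> [|v hv]; [exact: hu|exact: (h5 (exist _ v hv))].
Qed.

End MixedProblem.

Theorem theorem4p4 (R : realType) (Om : set (plane R))
    (sides : seq (plane R * plane R)) (GD : set (plane R))
    (D : 'M[R]_3) (b t : plane R -> plane R) (f : (plane R -> plane R) -> R)
    (k : elt_kind) (M : mesh R k) (kappa : R)
    (hOm : polygonal_domain Om sides)
    (hGD : GD `<=` boundary Om) (hGD0 : GD !=set0) (mGD : measurable GD)
    (hD : sym_posdef D)
    (ha : aform_admissible Om sides GD D)
    (hf : load Om sides GD b t f)
    (hM : subdivision Om M)
    (hkappa : 0 < kappa) (hqu : quasi_uniform kappa M) :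
  exists u eps1 eps2 sig1 sig2,
    [/\ mixed_solution Om sides GD M D f u eps1 eps2 sig1 sig2,
        forall u' eps1' eps2' sig1' sig2',
          mixed_solution Om sides GD M D f u' eps1' eps2' sig1' sig2' ->
          [/\ ae_on Om (fun x => u' x = u x),
              ae_on Om (fun x => eps1' x = eps1 x),
              ae_on Om (fun x => eps2' x = eps2 x),
              ae_on Om (fun x => sig1' x = sig1 x) &
              ae_on Om (fun x => sig2' x = sig2 x)],
        [/\ ae_on Om (fun x => eps1 x = P1h Om M (Bop Om u) x),
            ae_on Om (fun x => eps2 x = P2h Om M (P1h Om M (Bop Om u)) x),
            ae_on Om (fun x => sig1 x =
              P1h Om M (P2h Om M (fun y => D *m P2h Om M (P1h Om M (Bop Om u)) y)) x) &
            ae_on Om (fun x => sig2 x = D *m P2h Om M (P1h Om M (Bop Om u)) x)],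
        smoothed_solution Om sides GD M D f u &
        forall v, smoothed_solution Om sides GD M D f v ->
          ae_on Om (fun x => v x = u x)].
Proof.
have [u su] := smoothed_exists hOm hD ha hf hM.
have mu := smoothed_mixed_solution hOm hM su.
exists u, (P1h Om M (Bop Om u)), (smoothed Om M u),
  (P1h Om M (P2h Om M (fun x => D *m smoothed Om M u x))), (fun x => D *m smoothed Om M u x).
split; [exact: mu| |by split; exact: ae_onW|exact: su|]; last first.
  by move=> v sv; have [] := smoothed_unique hOm hD ha hM su sv.
move=> u' e1 e2 s1 s2 mu'.
have [su' h1 h2 h3 h4] := mixed_solution_smoothed hOm ha hf hM mu'.
have [hu' hB] := smoothed_unique hOm hD ha hM su su'.
have mOm := measurable_domain (polygonal_open hOm).
have [hu _] := su; have [hu'V _] := su'.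
(* Averaging turns the almost everywhere equality of the strains into equality of functions, so the
   formulas for both solutions have the same right-hand sides. *)
have eP : P1h Om M (Bop Om u') = P1h Om M (Bop Om u).
  exact: (avg_proj_ext mOm (cell1_family hOm hM) (Bop_Vh hOm hu'V) (Bop_Vh hOm hu) hB).
have eS : smoothed Om M u' = smoothed Om M u by rewrite /smoothed eP.
by split; rewrite -?eS -?eP.
Qed.
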